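(* Let $V$ be the set-theoretic universe, let $\mathbb{P}\in V$ be a proper forcing which has the Laver property and preserves the ground model reals non-meager, and let $G$ be a $\mathbb{P}$-generic filter over $V$. Assume that the Continuum Hypothesis does not hold in $V[G]$. Let $\mathcal{A}\in V$ be a Boolean algebra which (in $V$) is $\sigma$-complete and of cardinality $\omega_1$. Then, in $V[G]$, the Stone space $K_{\mathcal{A}}$ of the algebra $\mathcal{A}$ is an Efimov space of weight $\omega_1$.
   Context: An Efimov space is an infinite compact Hausdorff space which contains neither a non-trivial (i.e. not eventually constant) convergent sequence nor a (homeomorphic) copy of $\beta\omega$, the Čech--Stone compactification of the discrete space $\omega$. The Stone space $K_{\mathcal{A}}$ is computed in $V[G]$. Laver property: $\mathbb{P}$ has the Laver property if for any $\mathbb{P}$-generic filter $G$ over $V$ and any functions $f\in\omega^\omega\cap V$ and $g\in\omega^\omega\cap V[G]$ such that $f$ eventually dominates $g$ ($g\le^* f$), there exists in $V$ a function $H\colon\omega\to[\omega]^{<\omega}$ such that $|H(n)|\le n+1$ and $g(n)\in H(n)$ for all $n\in\omega$. $\mathbb{P}$ preserves the ground model reals non-meager if $\mathbb{R}^V$ is a non-meager subset of $\mathbb{R}^{V[G]}$ for any $\mathbb{P}$-generic filter $G$ over $V$. *)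

(* Defs.v *)
(* Forcing over models of ZFC.

   "V" is an arbitrary model of ZFC, given as a type with a binary relation, and
   "V[G]" is a second model extending it.  "phi holds in M" means that the
   quantifiers of phi range over the carrier of M: every set-theoretic notion
   below takes the model M as an (implicit) parameter, and is read in the model
   to which its arguments belong. *)

Set Implicit Arguments.
Unset Strict Implicit.

Record set_structure := SetStructure {
  carrier :> Type;
  mem : carrier -> carrier -> Prop }.

Arguments mem {s} _ _.
Notation "x ∈ y" := (mem x y) (at level 70, no associativity).
Notation "x ∉ y" := (~ mem x y) (at level 70, no associativity).

(** * ZFC *)

(* De Bruijn indices: [fAll] binds index 0. *)
Inductive formula : Type :=
  | fMem (i j : nat)
  | fEq (i j : nat)
  | fNot (f : formula)
  | fAnd (f g : formula)
  | fAll (f : formula).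

Definition scons (T : Type) (x : T) (e : nat -> T) (n : nat) : T :=
  match n with 0 => x | S k => e k end.

Fixpoint sat (M : set_structure) (e : nat -> M) (f : formula) : Prop :=
  match f with
  | fMem i j => e i ∈ e j
  | fEq i j => e i = e j
  | fNot g => ~ sat e g
  | fAnd g h => sat e g /\ sat e h
  | fAll g => forall x : M, sat (scons x e) g
  end.

Section Internal.
Variable M : set_structure.
Implicit Types a b c d e f g h k m n o p r s t u v w x y z : M.
Implicit Types A B C D E F G K L N O P Q R S T U X Y : M.

Definition incl x y := forall z, z ∈ x -> z ∈ y.
Definition is_empty x := forall z, z ∉ x.
Definition is_upair p x y := forall z, z ∈ p <-> z = x \/ z = y.
Definition is_union u x := forall z, z ∈ u <-> exists y, z ∈ y /\ y ∈ x.
Definition is_power p x := forall z, z ∈ p <-> incl z x.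
Definition is_succ s x := forall z, z ∈ s <-> z ∈ x \/ z = x.

Definition is_inductive w :=
  (exists x, is_empty x /\ x ∈ w) /\
  (forall x, x ∈ w -> exists s, is_succ s x /\ s ∈ w).

Record ZFC : Prop := {
  ax_extensionality : forall x y, (forall z, z ∈ x <-> z ∈ y) -> x = y;
  ax_foundation : forall x, (exists y, y ∈ x) ->
    exists y, y ∈ x /\ forall z, z ∈ x -> z ∉ y;
  ax_pairing : forall x y, exists p, is_upair p x y;
  ax_union : forall x, exists u, is_union u x;
  ax_power : forall x, exists p, is_power p x;
  ax_infinity : exists w, is_inductive w;
  ax_separation : forall (phi : formula) (env : nat -> M) a,
    exists b, forall x, x ∈ b <-> x ∈ a /\ sat (scons x env) phi;
  ax_replacement : forall (phi : formula) (env : nat -> M) a,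
    (forall x, x ∈ a -> exists! y, sat (scons x (scons y env)) phi) ->
    exists b, forall y,
      y ∈ b <-> exists x, x ∈ a /\ sat (scons x (scons y env)) phi;
  ax_choice : forall F,
    (forall x, x ∈ F -> exists z, z ∈ x) ->
    (forall x y z, x ∈ F -> y ∈ F -> z ∈ x -> z ∈ y -> x = y) ->
    exists c, forall x, x ∈ F -> exists! z, z ∈ x /\ z ∈ c }.

(** * Relations and functions *)

(* Kuratowski pairs *)
Definition is_opair p x y :=
  exists a b, is_upair a x x /\ is_upair b x y /\ is_upair p a b.

(* [app r x y]: the pair (x,y) belongs to r; for a function, r(x) = y *)
Definition app r x y := exists p, is_opair p x y /\ p ∈ r.

Definition is_rel r A := forall p, p ∈ r ->
  exists x y, x ∈ A /\ y ∈ A /\ is_opair p x y.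

Definition is_fun_on f A :=
  (forall p, p ∈ f -> exists x y, x ∈ A /\ is_opair p x y) /\
  (forall x, x ∈ A -> exists! y, app f x y).

Definition is_fun f A B :=
  is_fun_on f A /\ forall x y, app f x y -> y ∈ B.

Definition is_injective f := forall x x' y, app f x y -> app f x' y -> x = x'.
Definition is_onto f B := forall y, y ∈ B -> exists x, app f x y.

Definition injects A B := exists f, is_fun f A B /\ is_injective f.
Definition equinumerous A B :=
  exists f, is_fun f A B /\ is_injective f /\ is_onto f B.

(** * Numbers and cardinals *)

Definition is_omega o := is_inductive o /\ forall w, is_inductive w -> incl o w.
Definition is_nat n := exists o, is_omega o /\ n ∈ o.
(* the order of ordinals, in particular of natural numbers *)
Definition ord_le m n := m ∈ n \/ m = n.

Definition finite A := exists n, is_nat n /\ equinumerous A n.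
Definition countable A := exists o, is_omega o /\ injects A o.
Definition countably_infinite A := exists o, is_omega o /\ equinumerous A o.

Definition transitive A := forall x, x ∈ A -> incl x A.
Definition is_ordinal a := transitive a /\ forall x, x ∈ a -> transitive x.
Definition is_cardinal k :=
  is_ordinal k /\ forall a, a ∈ k -> ~ equinumerous a k.
Definition is_omega1 k :=
  is_cardinal k /\ ~ countable k /\
  forall l, is_cardinal l -> ~ countable l -> ord_le k l.

Definition card_omega1 A := exists k, is_omega1 k /\ equinumerous A k.

Definition CH := exists o p, is_omega o /\ is_power p o /\ card_omega1 p.

(** * Preorders and generic filters *)

Definition is_forcing P le :=
  (exists p, p ∈ P) /\ is_rel le P /\
  (forall p, p ∈ P -> app le p p) /\
  (forall p q r, app le p q -> app le q r -> app le p r).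

Definition dense_in P le D :=
  incl D P /\ forall p, p ∈ P -> exists q, q ∈ D /\ app le q p.

(* filters for the forcing order, in which smaller conditions are stronger *)
Definition is_filter P le G :=
  incl G P /\ (exists p, p ∈ G) /\
  (forall p q, p ∈ G -> app le p q -> q ∈ G) /\
  (forall p q, p ∈ G -> q ∈ G -> exists r, r ∈ G /\ app le r p /\ app le r q).

(** * Names *)

Definition is_name P t :=
  exists E, t ∈ E /\
    forall s, s ∈ E -> forall x, x ∈ s ->
      exists r p, r ∈ E /\ p ∈ P /\ is_opair x r p.

(* f is a function, with domain closed under passing to the names occurring in
   a name, that satisfies the recursion t_G = { s_G | exists p in G, (s,p) in t } *)
Definition is_evaluation G f :=
  (forall x, x ∈ f -> exists t v, is_opair x t v) /\
  (forall t v, app f t v ->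
     (forall s p, app t s p -> exists u, app f s u) /\
     (forall z, z ∈ v <-> exists s p, p ∈ G /\ app t s p /\ app f s z)).

Definition value G t v := exists f, is_evaluation G f /\ app f t v.

(** * Stationary subsets of [L]^omega *)

Definition in_ctbl_subsets x L := incl x L /\ countably_infinite x.

(* closed: the union of any non-empty countable chain from C is in C *)
Definition is_club L C :=
  (forall x, x ∈ C -> in_ctbl_subsets x L) /\
  (forall x, in_ctbl_subsets x L -> exists y, y ∈ C /\ incl x y) /\
  (forall D u, incl D C -> (exists x, x ∈ D) -> countable D ->
     (forall x y, x ∈ D -> y ∈ D -> incl x y \/ incl y x) ->
     is_union u D -> u ∈ C).

Definition is_stationary L S :=
  (forall x, x ∈ S -> in_ctbl_subsets x L) /\
  forall C, is_club L C -> exists x, x ∈ C /\ x ∈ S.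

(** * Baire space and slaloms *)

Definition in_baire f := exists o, is_omega o /\ is_fun f o o.

(* g <=* f *)
Definition eventually_le g f := exists k, is_nat k /\
  forall n a b, is_nat n -> ord_le k n -> app g n a -> app f n b -> ord_le a b.

(* H maps omega to finite subsets of omega, with |H(n)| <= n+1 = {0,...,n} *)
Definition is_slalom H :=
  exists o, is_omega o /\ is_fun_on H o /\
    forall n x, app H n x ->
      incl x o /\ finite x /\ exists s, is_succ s n /\ injects x s.

(** * Topological spaces *)

Definition is_topology X T :=
  (forall U, U ∈ T -> incl U X) /\ X ∈ T /\
  (forall C u, incl C T -> is_union u C -> u ∈ T) /\
  (forall U W I, U ∈ T -> W ∈ T -> (forall x, x ∈ I <-> x ∈ U /\ x ∈ W) ->
     I ∈ T).

Definition is_compact X T :=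
  forall C, incl C T -> (forall x, x ∈ X -> exists U, U ∈ C /\ x ∈ U) ->
    exists D, incl D C /\ finite D /\
      forall x, x ∈ X -> exists U, U ∈ D /\ x ∈ U.

Definition is_hausdorff X T :=
  forall x y, x ∈ X -> y ∈ X -> x <> y ->
    exists U W, U ∈ T /\ W ∈ T /\ x ∈ U /\ y ∈ W /\
      forall z, ~ (z ∈ U /\ z ∈ W).

Definition compact_hausdorff X T :=
  is_topology X T /\ is_compact X T /\ is_hausdorff X T.

Definition is_base X T B :=
  incl B T /\
  forall U x, U ∈ T -> x ∈ U -> exists W, W ∈ B /\ x ∈ W /\ incl W U.

(* the least cardinality of a base is k *)
Definition has_weight X T k :=
  (exists B, is_base X T B /\ equinumerous B k) /\
  (forall B, is_base X T B -> injects k B).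

Definition is_preimage f X W U :=
  forall x, x ∈ U <-> x ∈ X /\ exists y, app f x y /\ y ∈ W.

Definition continuous f X T Y S :=
  is_fun f X Y /\
  forall W, W ∈ S -> exists U, U ∈ T /\ is_preimage f X W U.

(* homeomorphism onto the image with its subspace topology *)
Definition embedding f X T Y S :=
  is_fun f X Y /\ is_injective f /\
  forall U, U ∈ T <-> exists W, W ∈ S /\ is_preimage f X W U.

Definition in_closure X T N x :=
  x ∈ X /\ forall U, U ∈ T -> x ∈ U -> exists y, y ∈ U /\ y ∈ N.

Definition nowhere_dense X T N :=
  incl N X /\
  ~ exists U, U ∈ T /\ (exists x, x ∈ U) /\
      forall x, x ∈ U -> in_closure X T N x.

Definition meager X T N :=
  incl N X /\
  exists C, countable C /\ (forall E, E ∈ C -> nowhere_dense X T E) /\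
    forall x, x ∈ N -> exists E, E ∈ C /\ x ∈ E.

(** * The real line *)

(* By Cantor's theorem, these are exactly the isomorphic copies of the rationals. *)
Definition is_rationals Q lt :=
  (exists q, q ∈ Q) /\ countable Q /\ is_rel lt Q /\
  (forall p, ~ app lt p p) /\
  (forall p q r, app lt p q -> app lt q r -> app lt p r) /\
  (forall p q, p ∈ Q -> q ∈ Q -> app lt p q \/ p = q \/ app lt q p) /\
  (forall p q, app lt p q -> exists r, app lt p r /\ app lt r q) /\
  (forall p, p ∈ Q -> (exists q, app lt q p) /\ (exists q, app lt p q)).

(* Dedekind cuts: x is the set of the rationals below the real number *)
Definition is_cut Q lt x :=
  incl x Q /\ (exists q, q ∈ x) /\ (exists q, q ∈ Q /\ q ∉ x) /\
  (forall p q, q ∈ x -> app lt p q -> p ∈ x) /\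
  (forall q, q ∈ x -> exists r, r ∈ x /\ app lt q r).

Definition is_reals Q lt R := forall x, x ∈ R <-> is_cut Q lt x.

(* p < x < q for p, q rational *)
Definition in_interval Q lt p q x :=
  p ∈ x /\ exists r, r ∈ Q /\ r ∉ x /\ app lt r q.

Definition is_real_topology Q lt R T :=
  forall U, U ∈ T <->
    incl U R /\
    forall x, x ∈ U -> exists p q, p ∈ Q /\ q ∈ Q /\ in_interval Q lt p q x /\
      forall y, y ∈ R -> in_interval Q lt p q y -> y ∈ U.

(** * Boolean algebras and Stone spaces *)

Definition is_poset A le :=
  is_rel le A /\
  (forall a, a ∈ A -> app le a a) /\
  (forall a b, app le a b -> app le b a -> a = b) /\
  (forall a b c, app le a b -> app le b c -> app le a c).

Definition is_bot A le z := z ∈ A /\ forall a, a ∈ A -> app le z a.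
Definition is_top A le t := t ∈ A /\ forall a, a ∈ A -> app le a t.

Definition is_sup A le B s :=
  s ∈ A /\ (forall b, b ∈ B -> app le b s) /\
  forall t, t ∈ A -> (forall b, b ∈ B -> app le b t) -> app le s t.

Definition is_join A le a b s :=
  s ∈ A /\ app le a s /\ app le b s /\
  forall t, t ∈ A -> app le a t -> app le b t -> app le s t.

Definition is_meet A le a b m :=
  m ∈ A /\ app le m a /\ app le m b /\
  forall t, t ∈ A -> app le t a -> app le t b -> app le t m.

Definition is_compl A le a c :=
  c ∈ A /\ (exists z, is_bot A le z /\ is_meet A le a c z) /\
  (exists t, is_top A le t /\ is_join A le a c t).

(* complemented distributive lattice *)
Definition is_boolean_algebra A le :=
  is_poset A le /\
  (exists z, is_bot A le z) /\ (exists t, is_top A le t) /\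
  (forall a b, a ∈ A -> b ∈ A ->
     (exists s, is_join A le a b s) /\ (exists m, is_meet A le a b m)) /\
  (forall a b c s m x y,
     is_join A le b c s -> is_meet A le a s m ->
     is_meet A le a b x -> is_meet A le a c y -> is_join A le x y m) /\
  (forall a, a ∈ A -> exists c, is_compl A le a c).

Definition is_sigma_complete A le :=
  forall B, incl B A -> countable B -> exists s, is_sup A le B s.

Definition is_ultrafilter A le u :=
  incl u A /\ (exists a, a ∈ u) /\ (forall z, is_bot A le z -> z ∉ u) /\
  (forall a b, a ∈ u -> app le a b -> b ∈ u) /\
  (forall a b m, a ∈ u -> b ∈ u -> is_meet A le a b m -> m ∈ u) /\
  (forall a c, a ∈ A -> is_compl A le a c -> a ∈ u \/ c ∈ u).

(* X is the set of ultrafilters, T is generated by the sets {u | a in u} *)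
Definition is_stone_space A le X T :=
  (forall u, u ∈ X <-> is_ultrafilter A le u) /\
  (forall U, U ∈ T <->
     incl U X /\
     forall u, u ∈ U -> exists a, a ∈ u /\ forall v, v ∈ X -> a ∈ v -> v ∈ U).

(** * Efimov spaces *)

Definition converges X T f x :=
  x ∈ X /\
  forall U, U ∈ T -> x ∈ U -> exists k, is_nat k /\
    forall n y, is_nat n -> ord_le k n -> app f n y -> y ∈ U.

Definition eventually_constant f :=
  exists k y, is_nat k /\ forall n, is_nat n -> ord_le k n -> app f n y.

(* (B,S) is a Čech-Stone compactification of the discrete space omega *)
Definition is_beta_omega B S :=
  compact_hausdorff B S /\
  exists o D i,
    is_omega o /\ is_power D o /\
    embedding i o D B S /\
    (forall U, U ∈ S -> (exists b, b ∈ U) -> exists n b, app i n b /\ b ∈ U) /\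
    (forall K TK f, compact_hausdorff K TK -> continuous f o D K TK ->
       exists F, continuous F B S K TK /\
         forall n b y, app i n b -> app f n y -> app F b y).

Definition is_efimov X T :=
  compact_hausdorff X T /\ ~ finite X /\
  (~ exists o f x, is_omega o /\ is_fun f o X /\ converges X T f x /\
       ~ eventually_constant f) /\
  (~ exists B S h, is_beta_omega B S /\ embedding h B S X T).

End Internal.

(** * Generic extensions *)

(* V[G]: the model [ext] of ZFC contains V as a transitive class (via [emb]) and
   the filter [gen] on P, generic over V, and each of its elements is the value
   of a P-name from V.  That the values of the names form a model of ZFC is the
   generic model theorem; over a possibly ill-founded V it also provides the
   ambient model in which the evaluation of names by recursion makes sense. *)
Record generic_extension (V : set_structure) (P le : V) := GenericExtension {
  ext :> set_structure;
  emb : V -> ext;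
  gen : ext;
  ext_ZFC : ZFC ext;
  emb_mem : forall x y : V, emb x ∈ emb y <-> x ∈ y;
  emb_transitive : forall (x : V) (w : ext), w ∈ emb x -> exists y : V, w = emb y;
  gen_filter : is_filter (emb P) (emb le) gen;
  gen_generic : forall D : V, dense_in P le D -> exists p : V, p ∈ D /\ emb p ∈ gen;
  ext_names : forall w : ext, exists t : V, is_name P t /\ value gen (emb t) w }.

Section Properties.
Variables (V : set_structure) (P le : V).

(* Properness, as in Jech's "Set Theory": for every uncountable cardinal L, the
   stationary subsets of [L]^omega remain stationary in generic extensions. *)
Definition is_proper :=
  forall (W : generic_extension P le) (L S : V),
    is_cardinal L -> ~ countable L ->
    is_stationary L S -> is_stationary (emb W L) (emb W S).

Definition has_laver_property :=
  forall (W : generic_extension P le) (f : V) (g : W),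
    in_baire f -> in_baire g -> eventually_le g (emb W f) ->
    exists H : V, is_slalom H /\
      forall n : W, is_nat n ->
        exists h k : W, app (emb W H) n h /\ app g n k /\ k ∈ h.

(* The reals of V are the cuts in V, those of the extension are the cuts in the
   extension of the same ordered set of rationals (Q,lt) from V. *)
Definition preserves_reals_nonmeager :=
  forall (W : generic_extension P le) (Q lt RV : V) (RW TW : W),
    is_rationals Q lt -> is_reals Q lt RV ->
    is_reals (emb W Q) (emb W lt) RW ->
    is_real_topology (emb W Q) (emb W lt) RW TW ->
    ~ meager RW TW (emb W RV).

End Properties.

(* Main.v *)
(* Let [f n] converge to [x] in the Stone space, without being eventually constant. Properness
   keeps omega_1 uncountable, so the elements of the algebra that separate terms of the sequence
   lie in the range of some [c : omega -> A] of V. As the ground model reals are non-meager, some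
   [I ⊂ omega] in V is such that, for infinitely many [k], the [c i] with [i] below the next
   element of [I] already separate [k+2] terms of index at least [k]. Take in V finite partitions
   of unity deciding these [c i]. The Laver property yields at most [k+1] parts of the [k]-th one,
   among them the part that contains [x]; let [d k] be their supremum. Every [d k] belongs to [x],
   but by the pigeonhole principle infinitely many terms miss some [d k]. So in V there are
   pairwise disjoint [g k], none of them in [x], that together meet infinitely many terms.
   Non-meagerness gives again an [I] in V that splits the infinite set of those [k] for which
   [g k] belongs to some term; then the supremum of the [g k] with [k] in [I] belongs to
   infinitely many terms and is missed by infinitely many others, against convergence.

   A copy of beta omega in the Stone space would map the algebra, of size omega_1, onto the power
   set of omega, contradicting the failure of CH. *)

From Stdlib Require Import ssreflect ssrbool Classical ClassicalEpsilon PeanoNat.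
Require Import Defs.

Set Implicit Arguments.
Unset Strict Implicit.

(** How much of [c] is needed at level [k] is bounded by a function of the extension, which no
    function of V need dominate; so V may be unable to prepare a suitable partition for every [k].
    Non-meagerness yields an [I] in V that is sparse enough at infinitely many [k], and this
    suffices. The function handed to the Laver property, the index of a part containing [x], is by
    contrast bounded in V by the number of parts. A slalom allows [k+1] parts at [k], hence the
    groups of [k+2] terms. By convergence each [d k] is missed by finitely many terms only, so the
    escaping terms use infinitely many [k]. This is why [g k] is what the earlier [d j] have in
    common outside [d k]: a term belongs to [g k] for the first [d k] that it misses. Both models
    may be ill-founded, with non-standard natural numbers. Induction and comprehension are therefore
    internal, for predicates definable with parameters ([dfn]), and facts pass between the models by
    absoluteness of [emb]. *)

Record zmodel := Zmodel { zset :> set_structure; zax : ZFC zset }.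

(** * Definable predicates *)

Fixpoint ren (r : nat -> nat) (f : formula) : formula :=
  match f with
  | fMem i j => fMem (r i) (r j)
  | fEq i j => fEq (r i) (r j)
  | fNot g => fNot (ren r g)
  | fAnd g h => fAnd (ren r g) (ren r h)
  | fAll g => fAll (ren (fun n => match n with 0 => 0 | S k => S (r k) end) g)
  end.

Section Definability.
Context {M : zmodel}.
Implicit Types (e : nat -> M) (P Q : (nat -> M) -> Prop).

Lemma sat_ren f : forall r e e', (forall n, e (r n) = e' n) ->
  sat e (ren r f) <-> sat e' f.
Proof.
elim: f => [i j|i j|g IH|g IHg h IHh|g IH] r e e' E /=; rewrite ?E //.
- by rewrite (IH _ _ _ E).
- by rewrite (IHg _ _ _ E) (IHh _ _ _ E).
- have K x : sat (scons x e) (ren (fun n => match n with 0 => 0 | S k => S (r k) end) g) <->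
       sat (scons x e') g.
    by apply: IH; case=> [|n] /=.
  by split=> H x; apply/K.
Qed.

(* The even variables are the arguments, the odd ones are parameters. *)
Definition mix e (s : nat -> M) (n : nat) : M :=
  if Nat.even n then e (Nat.div2 n) else s (Nat.div2 n).

(** The formula and its parameters are only asserted to exist: definability is then derived by
    closure lemmas on Rocq predicates, and later proofs write no formula by hand. *)
Definition dfn P := exists (f : formula) (s : nat -> M),
  forall e, P e <-> sat (mix e s) f.

(** An operation is definable when its graph is; variable 0 is the value, and the arguments are
    shifted up by one. *)
Definition dterm (t : (nat -> M) -> M) :=
  dfn (fun e => e 0 = t (fun n => e (S n))).

Lemma mix_arg e s n : mix e s (2 * n) = e n.
Proof. by rewrite /mix Nat.even_mul /= Nat.div2_double. Qed.

Lemma mix_par e s n : mix e s (2 * n + 1) = s n.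
Proof.
by rewrite /mix Nat.add_1_r Nat.div2_succ_double Nat.even_succ Nat.odd_mul.
Qed.

Lemma mix_ren (e e' s s' : nat -> M) (ra rp : nat -> nat) :
  (forall n, mix e s (ra n) = e' n) -> (forall n, mix e s (rp n) = s' n) ->
  forall n, mix e s
    (if Nat.even n then ra (Nat.div2 n) else rp (Nat.div2 n)) = mix e' s' n.
Proof. by move=> Ha Hp n; rewrite {2}/mix; case: (Nat.even n). Qed.

Lemma dfn_ext P Q : (forall e, P e <-> Q e) -> dfn Q -> dfn P.
Proof. by move=> E [f [s H]]; exists f, s => e; rewrite E. Qed.

Lemma dfn_ren (r : nat -> nat) P : dfn P -> dfn (fun e => P (fun n => e (r n))).
Proof.
move=> [f [s H]].
exists (ren (fun n => if Nat.even n then 2 * r (Nat.div2 n)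
                      else 2 * (Nat.div2 n) + 1) f), s => e.
rewrite H; symmetry; apply: sat_ren.
apply: (mix_ren (ra := fun n => 2 * r n) (rp := fun n => 2 * n + 1)) => n.
- by rewrite mix_arg.
- by rewrite mix_par.
Qed.

Lemma inhabited_zfc : exists c : M, True.
Proof. by have [w _] := ax_infinity (zax M); exists w. Qed.

(** By excluded middle a true or a false formula does, however external [A] is; it may even speak of
    another model. *)
Lemma dfn_const (A : Prop) : dfn (fun _ => A).
Proof.
have [c _] := inhabited_zfc.
case: (classic A) => HA; [exists (fEq 0 0)|exists (fNot (fEq 0 0))];
  exists (fun _ => c) => e /=; tauto.
Qed.

Lemma dfn_not P : dfn P -> dfn (fun e => ~ P e).
Proof. by move=> [f [s H]]; exists (fNot f), s => e /=; rewrite H. Qed.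

Lemma dfn_and P Q : dfn P -> dfn Q -> dfn (fun e => P e /\ Q e).
Proof.
move=> [f [s Hf]] [g [t Hg]].
(* The two parameter sequences are interleaved into [mix s t]; [r 0] and [r 1] lead each formula to
   its own half and leave the arguments alone. *)
pose r b n := if Nat.even n then 2 * (Nat.div2 n)
              else 2 * (2 * (Nat.div2 n) + b) + 1.
exists (fAnd (ren (r 0) f) (ren (r 1) g)), (mix s t) => e /=.
have -> : P e <-> sat (mix e (mix s t)) (ren (r 0) f).
  rewrite Hf; symmetry; apply: sat_ren.
  apply: (mix_ren (ra := fun n => 2 * n) (rp := fun n => 2 * (2 * n + 0) + 1)) => n;
    by rewrite ?mix_par ?Nat.add_0_r mix_arg.
have -> : Q e <-> sat (mix e (mix s t)) (ren (r 1) g).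
  rewrite Hg; symmetry; apply: sat_ren.
  apply: (mix_ren (ra := fun n => 2 * n) (rp := fun n => 2 * (2 * n + 1) + 1)) => n;
    by rewrite ?mix_par ?mix_arg.
by [].
Qed.

Lemma dfn_all (P : (nat -> M) -> M -> Prop) :
  dfn (fun e => P (fun n => e (S n)) (e 0)) -> dfn (fun e => forall x, P e x).
Proof.
move=> [f [s H]].
(* The binder puts [x] in front of arguments and parameters together, while [mix (scons x e) s] puts
   it in front of the arguments only; [ra] and [rp] translate between the two layouts. *)
pose ra n := match n with 0 => 0 | S k => S (2 * k) end.
pose rp n := S (2 * n + 1).
exists (fAll (ren (fun n => if Nat.even n then ra (Nat.div2 n)
                            else rp (Nat.div2 n)) f)), s => e /=.
have E x : P e x <-> sat (scons x (mix e s)) (ren (fun n =>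
    if Nat.even n then ra (Nat.div2 n) else rp (Nat.div2 n)) f).
  have -> : P e x <-> sat (mix (scons x e) s) f by rewrite -H.
  symmetry; apply: sat_ren => n.
  rewrite {2}/mix; case: (Nat.even n); rewrite /ra /rp.
    by case: (Nat.div2 n) => [|k] //; rewrite /scons mix_arg.
  by rewrite /scons mix_par.
by split=> K x; apply/E.
Qed.

Lemma dfn_imp P Q : dfn P -> dfn Q -> dfn (fun e => P e -> Q e).
Proof.
move=> HP HQ; apply: (@dfn_ext _ (fun e => ~ (P e /\ ~ Q e))); first by move=> e; tauto.
by apply/dfn_not/dfn_and => //; apply: dfn_not.
Qed.

Lemma dfn_or P Q : dfn P -> dfn Q -> dfn (fun e => P e \/ Q e).
Proof.
move=> HP HQ; apply: (@dfn_ext _ (fun e => ~ P e -> Q e)); first by move=> e; tauto.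
by apply/dfn_imp => //; apply: dfn_not.
Qed.

Lemma dfn_iff P Q : dfn P -> dfn Q -> dfn (fun e => P e <-> Q e).
Proof. by move=> HP HQ; apply/dfn_and; apply/dfn_imp. Qed.

Lemma dfn_ex (P : (nat -> M) -> M -> Prop) :
  dfn (fun e => P (fun n => e (S n)) (e 0)) -> dfn (fun e => exists x, P e x).
Proof.
move=> H; apply: (@dfn_ext _ (fun e => ~ forall x, ~ P e x)).
  move=> e; split=> [[x Hx] /(_ x)|N] //.
  by apply: NNPP => K; apply: N => x Hx; apply: K; exists x.
by apply/dfn_not/dfn_all/dfn_not.
Qed.

Lemma dfn_mem0 i j : dfn (fun e => e i ∈ e j).
Proof.
have [c _] := inhabited_zfc.
by exists (fMem (2 * i) (2 * j)), (fun _ => c) => e; rewrite /sat !mix_arg.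
Qed.

Lemma dfn_eq0 i j : dfn (fun e => e i = e j).
Proof.
have [c _] := inhabited_zfc.
by exists (fEq (2 * i) (2 * j)), (fun _ => c) => e; rewrite /sat !mix_arg.
Qed.

Lemma dterm_var k : dterm (fun e => e k).
Proof. exact: dfn_eq0. Qed.

Lemma dterm_const c : dterm (fun _ => c).
Proof.
exists (fEq (2 * 0) (2 * 0 + 1)), (fun _ => c) => e.
by rewrite /sat mix_arg mix_par.
Qed.

Lemma dfn_sub1 (R : M -> Prop) a : dfn (fun e => R (e 0)) -> dterm a ->
  dfn (fun e => R (a e)).
Proof.
move=> HR Ha; apply: (@dfn_ext _ (fun e => exists x, x = a e /\ R x)).
  by move=> e; split=> [H|[x [-> H]]] //; exists (a e).
by apply/dfn_ex/dfn_and.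
Qed.

Lemma dfn_sub2 (R : M -> M -> Prop) a b : dfn (fun e => R (e 0) (e 1)) ->
  dterm a -> dterm b -> dfn (fun e => R (a e) (b e)).
Proof.
move=> HR Ha Hb.
apply: (@dfn_ext _ (fun e => exists y, y = b e /\ exists x, x = a e /\ R x y)).
  by move=> e; split=> [H|[y [-> [x [-> H]]]]] //; exists (b e); split=> //; exists (a e).
apply/dfn_ex/dfn_and => //; apply/dfn_ex/dfn_and => //.
exact: (@dfn_ren (fun n => match n with 0 => 0 | S k => S (S k) end) _ Ha).
Qed.

Lemma dfn_sub3 (R : M -> M -> M -> Prop) a b c :
  dfn (fun e => R (e 0) (e 1) (e 2)) ->
  dterm a -> dterm b -> dterm c -> dfn (fun e => R (a e) (b e) (c e)).
Proof.
move=> HR Ha Hb Hc.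
apply: (@dfn_ext _ (fun e => exists z, z = c e /\ exists y, y = b e /\
    exists x, x = a e /\ R x y z)).
  move=> e; split=> [H|[z [-> [y [-> [x [-> H]]]]]]] //; exists (c e); split=> //.
  by exists (b e); split=> //; exists (a e).
apply/dfn_ex/dfn_and => //; apply/dfn_ex/dfn_and.
  exact: (@dfn_ren (fun n => match n with 0 => 0 | S k => S (S k) end) _ Hb).
apply/dfn_ex/dfn_and => //.
exact: (@dfn_ren (fun n => match n with 0 => 0 | S k => S (S (S k)) end) _ Ha).
Qed.

Lemma dfn_mem a b : dterm a -> dterm b -> dfn (fun e => a e ∈ b e).
Proof. by apply: dfn_sub2; apply: dfn_mem0. Qed.

Lemma dfn_eq a b : dterm a -> dterm b -> dfn (fun e => a e = b e).
Proof. by apply: (@dfn_sub2 eq); apply: dfn_eq0. Qed.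

Lemma dterm_op1 (F : M -> M) a : dfn (fun e => e 0 = F (e 1)) ->
  dterm a -> dterm (fun e => F (a e)).
Proof.
move=> HF Ha; apply: (@dfn_sub2 (fun x y => x = F y) (fun e => e 0)
  (fun e => a (fun n => e (S n)))) => //; first exact: dterm_var.
exact: (@dfn_ren (fun n => match n with 0 => 0 | S k => S (S k) end) _ Ha).
Qed.

Lemma dterm_op2 (F : M -> M -> M) a b : dfn (fun e => e 0 = F (e 1) (e 2)) ->
  dterm a -> dterm b -> dterm (fun e => F (a e) (b e)).
Proof.
move=> HF Ha Hb; apply: (@dfn_sub3 (fun x y z => x = F y z) (fun e => e 0)
  (fun e => a (fun n => e (S n))) (fun e => b (fun n => e (S n)))) => //.
- exact: dterm_var.
- exact: (@dfn_ren (fun n => match n with 0 => 0 | S k => S (S k) end) _ Ha).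
- exact: (@dfn_ren (fun n => match n with 0 => 0 | S k => S (S k) end) _ Hb).
Qed.

End Definability.

(** Redefined each time further set operations are known to be definable. *)
Ltac dfn_hook := fail.

(** The closing alternatives unify up to unfolding, which opens defined notions such as [is_fun]. A
    hypothesis that a local predicate is definable makes that predicate an atom. *)
Ltac dfn_step :=
  cbv beta;
  lazymatch goal with
  | |- dterm (fun e => e _) => apply dterm_var
  | |- dterm (fun _ => _) => first [apply dterm_const | dfn_hook | assumption]
  | |- dfn (fun _ => ?P) => apply dfn_const
  | |- dfn (fun e => @?A e /\ @?B e) => apply (@dfn_and _ A B)
  | |- dfn (fun e => @?A e <-> @?B e) => apply (@dfn_iff _ A B)
  | |- dfn (fun e => @?A e \/ @?B e) => apply (@dfn_or _ A B)
  | |- dfn (fun e => ~ @?A e) => apply (@dfn_not _ A)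
  | |- dfn (fun e => exists x, @?A e x) => apply (@dfn_ex _ A)
  | |- dfn (fun e => @mem _ (@?A e) (@?B e)) => apply (@dfn_mem _ A B)
  | |- dfn (fun e => @eq _ (@?A e) (@?B e)) => apply (@dfn_eq _ A B)
  | |- dfn (fun e => forall x : carrier _, @?A e x) => apply (@dfn_all _ A)
  | |- dfn (fun e => @?A e -> @?B e) => apply (@dfn_imp _ A B)
  | _ =>
    first
    [ assumption
    | dfn_hook
    | match goal with
      | H : dfn (fun e => _ (e 0)) |- _ => apply (dfn_sub1 H)
      | H : dfn (fun e => _ (e 0) (e 1)) |- _ => apply (dfn_sub2 H)
      | H : dfn (fun e => _ (e 0) (e 1) (e 2)) |- _ => apply (dfn_sub3 H)
      end
    | apply dfn_and | apply dfn_iff | apply dfn_or | apply dfn_not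
    | apply dfn_imp | apply dfn_all | apply dfn_ex | apply dfn_mem | apply dfn_eq ]
  end.
Ltac dfn_auto := repeat dfn_step.

(** * Sets *)

Section Sets.
Context {M : zmodel}.
Implicit Types (x y z a b c f g p A B C : M).

Lemma ext x y : (forall z, z ∈ x <-> z ∈ y) -> x = y.
Proof. exact: (ax_extensionality (zax M)). Qed.

Definition the x (P : M -> Prop) : M := epsilon (inhabits x) P.

Lemma theP x (P : M -> Prop) : (exists y, P y) -> P (the x P).
Proof. exact: epsilon_spec. Qed.

(** Written down for every [P], but separation guarantees the intended value only for a definable
    one; hence the [dfn] premise of [in_sep]. *)
Definition sep a (P : M -> Prop) := the a (fun b => forall x, x ∈ b <-> x ∈ a /\ P x).

Lemma in_sep a (P : M -> Prop) : dfn (fun e => P (e 0)) ->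
  forall x, x ∈ sep a P <-> x ∈ a /\ P x.
Proof.
move=> [f [s H]]; apply: (theP a (P := fun b => forall x, x ∈ b <-> x ∈ a /\ P x)).
(* Every argument becomes variable 0, the tested element, and the parameters follow it. *)
have [b Hb] := ax_separation (zax M)
  (ren (fun n => if Nat.even n then 0 else S (Nat.div2 n)) f) s a.
exists b => x; rewrite Hb; apply: and_iff_compat_l.
rewrite (H (fun _ => x)); apply: sat_ren => n.
by rewrite /mix; case: (Nat.even n).
Qed.

Definition upair x y := the x (fun p => is_upair p x y).

Lemma in_upair z x y : z ∈ upair x y <-> z = x \/ z = y.
Proof. exact: (theP x (P := fun p => is_upair p x y) (ax_pairing (zax M) x y)). Qed.

Definition union x := the x (fun u => is_union u x).

Lemma in_union z x : z ∈ union x <-> exists y, z ∈ y /\ y ∈ x.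
Proof. exact: (theP x (P := fun u => is_union u x) (ax_union (zax M) x)). Qed.

Definition power x := the x (fun p => is_power p x).

Lemma in_power z x : z ∈ power x <-> incl z x.
Proof. exact: (theP x (P := fun p => is_power p x) (ax_power (zax M) x)). Qed.

Definition emptyset := sep
  (epsilon (match inhabited_zfc with ex_intro _ c _ => inhabits c end) (fun _ => True))
  (fun _ => False).

Lemma in_empty z : ~ z ∈ emptyset.
Proof. by rewrite in_sep; [apply: dfn_const|case]. Qed.

Lemma emptyP x : (forall z, ~ z ∈ x) -> x = emptyset.
Proof. by move=> H; apply: ext => z; split=> [/H|/in_empty]. Qed.

Definition sing x := upair x x.

Lemma in_sing z x : z ∈ sing x <-> z = x.
Proof. by rewrite in_upair; tauto. Qed.

Definition cup a b := union (upair a b).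

Lemma in_cup z a b : z ∈ cup a b <-> z ∈ a \/ z ∈ b.
Proof.
rewrite in_union; split=> [[y [Hz /in_upair [E|E]]]|[Hz|Hz]].
- by left; rewrite -E.
- by right; rewrite -E.
- by exists a; rewrite in_upair; tauto.
- by exists b; rewrite in_upair; tauto.
Qed.

Definition adj a x := cup a (sing x).

Lemma in_adj z a x : z ∈ adj a x <-> z ∈ a \/ z = x.
Proof. by rewrite in_cup in_sing. Qed.

Definition succ x := adj x x.

Lemma in_succ z x : z ∈ succ x <-> z ∈ x \/ z = x.
Proof. exact: in_adj. Qed.

Lemma is_succE s x : is_succ s x <-> s = succ x.
Proof.
split=> [H|-> z]; last exact: in_succ.
by apply: ext => z; rewrite in_succ.
Qed.

Definition opair x y := upair (upair x x) (upair x y).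

Lemma is_upairE p x y : is_upair p x y <-> p = upair x y.
Proof.
split=> [H|-> z]; last exact: in_upair.
by apply: ext => z; rewrite in_upair.
Qed.

Lemma is_opairE p x y : is_opair p x y <-> p = opair x y.
Proof.
split=> [[a [b [/is_upairE -> [/is_upairE -> /is_upairE ->]]]]|->] //.
by exists (upair x x), (upair x y); rewrite !is_upairE.
Qed.

Lemma upair_inj x y z : upair x y = upair x z -> y = z.
Proof.
move=> E.
have /in_upair [Hy|//] : y ∈ upair x z by rewrite -E in_upair; right.
have /in_upair [Hz|//] : z ∈ upair x y by rewrite E in_upair; right.
by rewrite Hy Hz.
Qed.

Lemma opair_inj x y x' y' : opair x y = opair x' y' -> x = x' /\ y = y'.
Proof.
move=> E.
have Ex : x = x'.
  have /in_upair [H|H] : upair x' x' ∈ opair x y by rewrite E in_upair; left.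
    by have /in_sing : x' ∈ upair x x by rewrite -H; apply/in_sing.
  by have /in_sing : x ∈ upair x' x' by rewrite H in_upair; left.
by move: E; rewrite Ex => /upair_inj /upair_inj.
Qed.

Lemma appE r x y : app r x y <-> opair x y ∈ r.
Proof.
split=> [[p [/is_opairE -> //]]|H].
by exists (opair x y); rewrite is_opairE.
Qed.

Lemma is_unionE u x : is_union u x <-> u = union x.
Proof.
split=> [H|-> z]; last exact: in_union.
by apply: ext => z; rewrite in_union.
Qed.

Lemma is_powerE u x : is_power u x <-> u = power x.
Proof.
split=> [H|-> z]; last exact: in_power.
by apply: ext => z; rewrite in_power.
Qed.

End Sets.

(** * Definability of the basic set operations *)

Section DefinableTerms.
Context {M : zmodel}.
Implicit Types (a b r : (nat -> M) -> M).

Lemma dterm_upair a b : dterm a -> dterm b -> dterm (fun e => upair (a e) (b e)).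
Proof.
apply: dterm_op2; apply: (@dfn_ext _ (fun _ => _) (fun e => is_upair (e 0) (e 1) (e 2))).
  by move=> e; rewrite is_upairE.
by dfn_auto.
Qed.

Lemma dterm_sing a : dterm a -> dterm (fun e => sing (a e)).
Proof. by move=> Ha; apply: dterm_upair. Qed.

Lemma dterm_opair a b : dterm a -> dterm b -> dterm (fun e => opair (a e) (b e)).
Proof. by move=> Ha Hb; do !apply: dterm_upair. Qed.

Lemma dterm_union a : dterm a -> dterm (fun e => union (a e)).
Proof.
apply: dterm_op1; apply: (@dfn_ext _ (fun _ => _) (fun e => is_union (e 0) (e 1))).
  by move=> e; rewrite is_unionE.
by dfn_auto.
Qed.

Lemma dterm_power a : dterm a -> dterm (fun e => power (a e)).
Proof.
apply: dterm_op1; apply: (@dfn_ext _ (fun _ => _) (fun e => is_power (e 0) (e 1))).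
  by move=> e; rewrite is_powerE.
by dfn_auto.
Qed.

Lemma dterm_cup a b : dterm a -> dterm b -> dterm (fun e => cup (a e) (b e)).
Proof. by move=> Ha Hb; apply/dterm_union/dterm_upair. Qed.

Lemma dterm_adj a b : dterm a -> dterm b -> dterm (fun e => adj (a e) (b e)).
Proof. by move=> Ha Hb; apply/dterm_cup => //; apply: dterm_sing. Qed.

Lemma dterm_succ a : dterm a -> dterm (fun e => succ (a e)).
Proof. by move=> Ha; apply: dterm_adj. Qed.

Lemma dfn_app r a b : dterm r -> dterm a -> dterm b ->
  dfn (fun e => app (r e) (a e) (b e)).
Proof.
move=> Hr Ha Hb; apply: (@dfn_ext _ _ (fun e => opair (a e) (b e) ∈ r e)).
  by move=> e; rewrite appE.
by apply: dfn_mem => //; apply: dterm_opair.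
Qed.

End DefinableTerms.

Ltac dfn_hook ::= first
  [ apply dterm_upair | apply dterm_sing | apply dterm_opair | apply dterm_union
  | apply dterm_power | apply dterm_cup | apply dterm_adj | apply dterm_succ
  | apply dfn_app ].

(** * Functions *)

Section Functions.
Context {M : zmodel}.
Implicit Types (x y z a b c f g h p A B C D : M).

Definition prod A B := sep (power (power (cup A B)))
  (fun p => exists x y, x ∈ A /\ y ∈ B /\ p = opair x y).

Lemma in_prod A B p : p ∈ prod A B <-> exists x y, x ∈ A /\ y ∈ B /\ p = opair x y.
Proof.
rewrite in_sep; first by dfn_auto.
split=> [[]//|H]; split=> //; move: H => [x [y [Hx [Hy ->]]]].
rewrite in_power => w /in_upair [->|->]; rewrite in_power => z /in_upair [->|->];
  by rewrite in_cup; tauto.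
Qed.

Lemma opair_prod A B x y : opair x y ∈ prod A B <-> x ∈ A /\ y ∈ B.
Proof.
rewrite in_prod; split=> [[x' [y' [Hx [Hy /opair_inj [-> ->]]]]]|[Hx Hy]] //.
by exists x, y.
Qed.

(* Sealed, so that rewriting with [in_sep] does not unfold it *)
Lemma ap_sig f x : {z | forall w, w ∈ z <-> exists y, app f x y /\ w ∈ y}.
Proof.
exists (sep (union (union (union f))) (fun z => exists y, app f x y /\ z ∈ y)) => z.
rewrite in_sep; first by dfn_auto.
split=> [[]//|H]; split=> //; move: H => [y [/appE H Hz]].
rewrite in_union; exists y; split=> //.
rewrite in_union; exists (upair x y); split; first by rewrite in_upair; right.
rewrite in_union; exists (opair x y); split=> //.
by rewrite in_upair; right.
Qed.

(** The union of all values at [x]: total, with a definable graph, and equal to the value as soon as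
    there is exactly one. *)
Definition ap f x := proj1_sig (ap_sig f x).

Lemma in_ap f x z : z ∈ ap f x <-> exists y, app f x y /\ z ∈ y.
Proof. exact: (proj2_sig (ap_sig f x)). Qed.

Lemma ap_unique f x y : app f x y -> (forall z, app f x z -> z = y) -> ap f x = y.
Proof.
move=> H U; apply: ext => w; rewrite in_ap; split=> [[z [/U ->]]|] //.
by exists y.
Qed.

Lemma fun_app f A B x : is_fun f A B -> x ∈ A -> app f x (ap f x).
Proof.
move=> [[_ H] _] /H [y [Hy U]]; rewrite (ap_unique (y := y)) // => z /U //.
Qed.

Lemma funE f A B x y : is_fun f A B -> app f x y <-> x ∈ A /\ y = ap f x.
Proof.
move=> F; split=> [H|[Hx ->]]; last exact: fun_app F Hx.
have Hx : x ∈ A.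
  move: F H => [[F _] _] /appE /F [x' [y' [Hx' /is_opairE /opair_inj [-> _]]]] //.
split=> //; move: (F) => [[_ /(_ x Hx) [z [_ U]]] _].
by rewrite -(U _ H) -(U _ (fun_app F Hx)).
Qed.

Lemma ap_in f A B x : is_fun f A B -> x ∈ A -> ap f x ∈ B.
Proof. by move=> F Hx; apply: (proj2 F x); apply: fun_app F Hx. Qed.

Lemma fun_intro f A B : incl f (prod A B) ->
  (forall x, x ∈ A -> exists! y, app f x y) -> is_fun f A B.
Proof.
move=> H1 H2; split; first split=> // p /H1 /in_prod [x [y [Hx [_ ->]]]].
  by exists x, y; split=> //; rewrite is_opairE.
by move=> x y /appE /H1 /opair_prod [].
Qed.

Lemma fun_prod f A B : is_fun f A B -> incl f (prod A B).
Proof.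
move=> F p Hp; move: (F) => [[F1 F2] F3].
have [x [y [Hx /is_opairE E]]] := F1 p Hp.
by rewrite E opair_prod; split=> //; apply: (F3 x); apply/appE; rewrite -E.
Qed.

Lemma fun_widen f A B C : is_fun f A B -> (forall x, x ∈ A -> ap f x ∈ C) -> is_fun f A C.
Proof.
move=> F H; split; first exact: (proj1 F).
by move=> x y /(funE _ _ F) [/H Hx ->].
Qed.

Lemma injE f A B : is_fun f A B ->
  is_injective f <-> (forall x x', x ∈ A -> x' ∈ A -> ap f x = ap f x' -> x = x').
Proof.
move=> F; split=> I x x'.
  by move=> Hx Hx' E; apply: (I x x' (ap f x)); rewrite (funE _ _ F).
by move=> y /(funE _ _ F) [Hx ->] /(funE _ _ F) [Hx' E]; apply: I.
Qed.

Lemma ontoE f A B : is_fun f A B ->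
  is_onto f B <-> (forall y, y ∈ B -> exists x, x ∈ A /\ y = ap f x).
Proof.
by move=> F; split=> H y /H [x Hx]; exists x; move: Hx; rewrite (funE _ _ F).
Qed.

(** The axiom of choice is applied to the sets {x} × {y ∈ B | R x y}, which are disjoint thanks to
    the first coordinate. A transversal, cut down to the pairs in [R], is the graph of the
    function. *)
Lemma choice (R : M -> M -> Prop) A B : dfn (fun e => R (e 0) (e 1)) ->
  (forall x, x ∈ A -> exists y, y ∈ B /\ R x y) ->
  exists f, is_fun f A B /\ forall x, x ∈ A -> R x (ap f x).
Proof.
move=> HR H.
pose F := sep (power (prod A B)) (fun Z => exists x, x ∈ A /\
  forall p, p ∈ Z <-> exists y, y ∈ B /\ R x y /\ p = opair x y).
have inF Z : Z ∈ F <-> exists x, x ∈ A /\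
  forall p, p ∈ Z <-> exists y, y ∈ B /\ R x y /\ p = opair x y.
  rewrite in_sep; first by dfn_auto.
  split=> [[]//|K]; split=> //; move: K => [x [Hx K]].
  by rewrite in_power => p /K [y [Hy [_ ->]]]; rewrite opair_prod.
have [||c Hc] := ax_choice (zax M) (F := F).
{ move=> Z /inF [x [Hx K]]; have [y [Hy Rxy]] := H x Hx.
  by exists (opair x y); apply/K; exists y. }
{ move=> Z Z' p /inF [x [Hx K]] /inF [x' [Hx' K']] /K [y [_ [_ E]]].
  move=> /K' [y' [_ [_ E']]].
  have [Exx _] : x = x' /\ y = y' by apply: opair_inj; rewrite -E.
  by apply: ext => q; rewrite K K' Exx. }
pose f := sep (prod A B) (fun p => p ∈ c /\ exists x y, R x y /\ p = opair x y).
have appf x y : app f x y <-> [/\ x ∈ A, y ∈ B, opair x y ∈ c & R x y].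
  rewrite appE in_sep; first by dfn_auto.
  rewrite opair_prod; split.
    by move=> [[Hx Hy] [Hp [x' [y' [K /opair_inj [Ex Ey]]]]]]; subst x' y'.
  by move=> [Hx Hy Hp K]; split=> //; split=> //; exists x, y.
have Hf : is_fun f A B.
  apply: fun_intro.
    by move=> p; rewrite in_sep; [dfn_auto|case].
  move=> x Hx.
  pose Z := sep (prod A B) (fun p => exists y, y ∈ B /\ R x y /\ p = opair x y).
  have HZ p : p ∈ Z <-> exists y, y ∈ B /\ R x y /\ p = opair x y.
    rewrite in_sep; first by dfn_auto.
    split=> [[]//|K]; split=> //; move: K => [y [Hy [_ ->]]].
    by rewrite opair_prod.
  have [|p [[/HZ [y [Hy [Rxy E]]] Hpc] U]] := Hc Z.
    by apply/inF; exists x.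
  exists y; split; first by rewrite appf; split=> //; rewrite -E.
  move=> y' /appf [_ Hy' Hp' Rxy'].
  have := U (opair x y'); rewrite E => /(_ _) /opair_inj [] //.
  by split=> //; apply/HZ; exists y'.
exists f; split=> // x Hx.
by have /appf [] := fun_app Hf Hx.
Qed.

Lemma dterm_ap (t u : (nat -> M) -> M) : dterm t -> dterm u -> dterm (fun e => ap (t e) (u e)).
Proof.
apply: dterm_op2.
apply: (@dfn_ext _ _ (fun e => forall z, z ∈ e 0 <-> exists y, app (e 1) (e 2) y /\ z ∈ y)).
  move=> e; split=> [-> z|H]; first exact: in_ap.
  by apply: ext => z; rewrite in_ap.
by dfn_auto.
Qed.

End Functions.

Ltac dfn_hook ::= first
  [ apply dterm_upair | apply dterm_sing | apply dterm_opair | apply dterm_union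
  | apply dterm_power | apply dterm_cup | apply dterm_adj | apply dterm_succ
  | apply dterm_ap | apply dfn_app ].

(** * Injections and bijections *)

Section Cardinality.
Context {M : zmodel}.
Implicit Types (x y z a b c f g h p A B C D : M).

(** [R] may offer several values, among which [choice] picks one; later injections are given by a
    relation rather than by a graph. *)
Lemma injects_intro (R : M -> M -> Prop) A B : dfn (fun e => R (e 0) (e 1)) ->
  (forall x, x ∈ A -> exists y, y ∈ B /\ R x y) ->
  (forall x x' y, x ∈ A -> x' ∈ A -> y ∈ B -> R x y -> R x' y -> x = x') ->
  injects A B.
Proof.
move=> HR H1 H2; have [f [Hf K]] := choice HR H1.
exists f; split=> //; apply/(injE Hf) => x x' Hx Hx' E.
by apply: (H2 _ _ (ap f x)) => //; [apply: ap_in Hf Hx|apply: K|rewrite E; apply: K].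
Qed.

Lemma equi_intro (R : M -> M -> Prop) A B : dfn (fun e => R (e 0) (e 1)) ->
  (forall x, x ∈ A -> exists y, y ∈ B /\ R x y) ->
  (forall y, y ∈ B -> exists x, x ∈ A /\ R x y) ->
  (forall x x' y, x ∈ A -> x' ∈ A -> y ∈ B -> R x y -> R x' y -> x = x') ->
  (forall x y y', x ∈ A -> y ∈ B -> y' ∈ B -> R x y -> R x y' -> y = y') ->
  equinumerous A B.
Proof.
move=> HR H1 H2 H3 H4; have [f [Hf K]] := choice HR H1.
exists f; split=> //; split.
  apply/(injE Hf) => x x' Hx Hx' E.
  by apply: (H3 _ _ (ap f x)) => //; [apply: ap_in Hf Hx|apply: K|rewrite E; apply: K].
apply/(ontoE Hf) => y Hy; have [x [Hx Rxy]] := H2 y Hy.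
exists x; split=> //; apply: (H4 x) => //; [exact: ap_in Hf Hx|exact: K].
Qed.

Lemma equi_refl A : equinumerous A A.
Proof.
apply: (@equi_intro (fun x y => x = y)); first by dfn_auto.
- by move=> x; exists x.
- by move=> x; exists x.
- by move=> x x' y _ _ _ -> ->.
- by move=> x x' y _ _ _ -> ->.
Qed.

Lemma injects_incl A B : incl A B -> injects A B.
Proof.
move=> H; apply: (@injects_intro (fun x y => x = y)); first by dfn_auto.
- by move=> x /H; exists x.
- by move=> x x' y _ _ _ -> ->.
Qed.

Lemma equi_sym A B : equinumerous A B -> equinumerous B A.
Proof.
move=> [f [F [/(injE F) I /(ontoE F) S]]].
apply: (@equi_intro (fun x y => x = ap f y)); first by dfn_auto.
- by [].
- by move=> x Hx; exists (ap f x); split=> //; apply: ap_in F Hx.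
- by move=> x x' y _ _ _ -> ->.
- by move=> x y y' _ Hy Hy' E E'; apply: I => //; rewrite -E.
Qed.

Lemma equi_injects A B : equinumerous A B -> injects A B.
Proof. by move=> [f [F [I _]]]; exists f. Qed.

Lemma injects_trans A B C : injects A B -> injects B C -> injects A C.
Proof.
move=> [f [F /(injE F) I]] [g [G /(injE G) J]].
apply: (@injects_intro (fun x y => y = ap g (ap f x))); first by dfn_auto.
- by move=> x Hx; exists (ap g (ap f x)); split=> //; apply/(ap_in G)/(ap_in F).
- move=> x x' y Hx Hx' _ -> E; apply/I/J => //; exact: ap_in F _.
Qed.

Lemma equi_trans A B C : equinumerous A B -> equinumerous B C -> equinumerous A C.
Proof.
move=> [f [F [/(injE F) I /(ontoE F) S]]] [g [G [/(injE G) J /(ontoE G) T]]].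
apply: (@equi_intro (fun x y => y = ap g (ap f x))); first by dfn_auto.
- by move=> x Hx; exists (ap g (ap f x)); split=> //; apply/(ap_in G)/(ap_in F).
- move=> z /T [y [/S [x [Hx ->]] ->]]; by exists x.
- move=> x x' y Hx Hx' _ -> E; apply/I/J => //; exact: ap_in F _.
- by move=> x y y' _ _ _ -> ->.
Qed.

Lemma injects_range A B : injects A B -> exists C, incl C B /\ equinumerous A C.
Proof.
move=> [f [F /(injE F) I]].
exists (sep B (fun y => exists x, x ∈ A /\ y = ap f x)).
have inC y : y ∈ sep B (fun y => exists x, x ∈ A /\ y = ap f x) <->
    exists x, x ∈ A /\ y = ap f x.
  rewrite in_sep; first by dfn_auto.
  split=> [[]//|H]; split=> //; move: H => [x [Hx ->]]; exact: ap_in F Hx.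
split; first by move=> y /inC [x [Hx ->]]; apply: ap_in F Hx.
apply: (@equi_intro (fun x y => y = ap f x)); first by dfn_auto.
- by move=> x Hx; exists (ap f x); split=> //; apply/inC; exists x.
- by move=> y /inC.
- by move=> x x' y Hx Hx' _ -> E; apply: I.
- by move=> x y y' _ _ _ -> ->.
Qed.

(* Knaster-Tarski: [S] is the union of the [X] contained in their double image. *)
Lemma cantor_bernstein A B : injects A B -> injects B A -> equinumerous A B.
Proof.
move=> [f [F /(injE F) I]] [g [G /(injE G) J]].
(* [Phi X] is A minus the image under [g] of B minus f[X], which is monotone in X. *)
pose Phi X x := x ∈ A /\ forall b, b ∈ B -> x = ap g b -> exists a, a ∈ X /\ b = ap f a.
pose S := sep A (fun x => exists X, incl X A /\ x ∈ X /\ forall z, z ∈ X -> Phi X z).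
have inS x : x ∈ S <-> exists X, incl X A /\ x ∈ X /\ forall z, z ∈ X -> Phi X z.
  rewrite in_sep; first by dfn_auto.
  by split=> [[]//|H]; split=> //; move: H => [X [HX [/HX]]].
have S1 x : x ∈ S -> Phi S x.
  move=> /inS [X [XA [xX H]]]; have [xA K] := H x xX; split=> // b Hb E.
  have [a [aX Ea]] := K b Hb E; exists a; split=> //; apply/inS; exists X; by split.
have S2 x : Phi S x -> x ∈ S.
  move=> P; apply/inS; exists (adj S x); split; last split.
  { by move=> z /in_adj [/S1 []|->] //; case: P. }
  { by apply/in_adj; right. }
  { move=> z Hz; have [zA K] : Phi S z by case/in_adj: Hz => [/S1|->].
    split=> // b Hb E; have [a [aS Ea]] := K b Hb E.
    by exists a; split=> //; apply/in_adj; left. }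
have S3 x : x ∈ A -> ~ x ∈ S -> exists b, [/\ b ∈ B, x = ap g b & forall a, a ∈ S -> b <> ap f a].
  move=> xA N; apply: NNPP => K; apply: N; apply: S2; split=> // b Hb E.
  by apply: NNPP => K'; apply: K; exists b; split=> // a aS Ea; apply: K'; exists a.
(* The bijection is [f] on [S] and the inverse of [g] off [S]. *)
apply: (@equi_intro (fun x y => (x ∈ S /\ y = ap f x) \/ (~ x ∈ S /\ x = ap g y))).
- by dfn_auto.
- move=> x Hx; case: (classic (x ∈ S)) => [xS|xS].
    by exists (ap f x); split; [apply: ap_in F Hx|left].
  by have [b [Hb E _]] := S3 x Hx xS; exists b; split=> //; right.
- move=> y Hy; case: (classic (ap g y ∈ S)) => [/S1 [_ /(_ y Hy eq_refl) [a [aS E]]]|N].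
    by exists a; split; [case: (S1 _ aS)|left].
  by exists (ap g y); split; [apply: ap_in G Hy|right].
- move=> x x' y Hx Hx' Hy [[xS E]|[xS E]] [[xS' E']|[xS' E']].
  + by apply: I => //; rewrite -E.
  + have [b [Hb Eb K]] := S3 x' Hx' xS'.
    have Eby : b = y by apply: J => //; rewrite -Eb.
    by case: (K x xS); rewrite Eby.
  + have [b [Hb Eb K]] := S3 x Hx xS.
    have Eby : b = y by apply: J => //; rewrite -Eb.
    by case: (K x' xS'); rewrite Eby.
  + by rewrite E E'.
- move=> x y y' Hx Hy Hy' [[xS E]|[xS E]] [[xS' E']|[xS' E']] //.
  + by rewrite E.
  + by apply: J => //; rewrite -E.
Qed.

End Cardinality.

Arguments equi_refl {M} A.

(** * Ordinals and natural numbers *)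

Section Ordinals.
Context {M : zmodel}.
Implicit Types (x y z a b c f g h k l m n o A B C D : M).

(** Foundation applied to a separated subset. It replaces induction along ∈, which fails for
    arbitrary Rocq predicates when the model is ill-founded. *)
Lemma mem_min (P : M -> Prop) a : dfn (fun e => P (e 0)) ->
  (exists x, x ∈ a /\ P x) -> exists x, x ∈ a /\ P x /\ forall z, z ∈ x -> z ∈ a -> ~ P z.
Proof.
move=> HP [x Hx].
have [|y [Hy K]] := ax_foundation (zax M) (x := sep a P).
  by exists x; apply/in_sep.
move: Hy; rewrite in_sep // => -[Hy Py]; exists y; split=> //; split=> // z Hz Hza Pz.
by apply: (K z); [apply/in_sep|].
Qed.

Lemma mem_irrefl x : ~ x ∈ x.
Proof.
move=> H; have [|y [/in_sing -> K]] := ax_foundation (zax M) (x := sing x).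
  by exists x; apply/in_sing.
by apply: (K x) => //; apply/in_sing.
Qed.

Lemma mem_asym x y : x ∈ y -> ~ y ∈ x.
Proof.
move=> H H'; have [|z [/in_upair [->|->] K]] := ax_foundation (zax M) (x := upair x y).
- by exists x; apply/in_upair; left.
- by apply: (K y) => //; apply/in_upair; right.
- by apply: (K x) => //; apply/in_upair; left.
Qed.

Lemma ord_in a x : is_ordinal a -> x ∈ a -> is_ordinal x.
Proof.
by move=> [T H] Hx; split; [apply: H|move=> y Hy; apply: H; apply: (T x)].
Qed.

Lemma ord_trans a x y : is_ordinal a -> x ∈ a -> y ∈ x -> y ∈ a.
Proof. by move=> [T _] Hx; apply: (T x). Qed.

Lemma ord_succ a : is_ordinal a -> is_ordinal (succ a).
Proof.
move=> Ha; split.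
  by move=> x /in_succ [Hx|->] y Hy; apply/in_succ; left => //; apply: ord_trans Ha Hx Hy.
by move=> x /in_succ [Hx|->]; [case: (ord_in Ha Hx)|case: Ha].
Qed.

(** Take the least [x] incomparable with something, then the least [y] incomparable with [x]: by
    minimality each element of one belongs to the other, so they are equal after all. *)
Lemma ord_total a b : is_ordinal a -> is_ordinal b -> a ∈ b \/ a = b \/ b ∈ a.
Proof.
move=> Ha Hb.
pose comp x y := x ∈ y \/ x = y \/ y ∈ x.
apply: NNPP => N.
have [||x [Hx [[y0 [Hy0 N0]] minx]]] :=
  @mem_min (fun x => exists y, y ∈ succ b /\ ~ comp x y) (succ a).
{ by dfn_auto. }
{ by exists a; split; [apply/in_succ; right|exists b; split=> //; apply/in_succ; right]. }
have [||y [Hy [Nxy miny]]] := @mem_min (fun y => ~ comp x y) (succ b).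
{ by dfn_auto. }
{ by exists y0. }
have Hoa := ord_succ Ha; have Hob := ord_succ Hb.
have Ox := ord_in Hoa Hx; have Oy := ord_in Hob Hy.
apply: (Nxy); right; left; apply: ext => z; split=> Hz.
- have Czy : comp z y.
    apply: NNPP => Nz; apply: (minx z Hz (ord_trans Hoa Hx Hz)); by exists y.
  case: Czy => [//|[E|K]]; case: Nxy; right; right; first by rewrite -E.
  exact: ord_trans Ox Hz K.
- have Cxz : comp x z.
    by apply: NNPP => Nz; apply: (miny z Hz (ord_trans Hob Hy Hz)).
  case: Cxz => [K|[E|//]]; case: Nxy; left; last by rewrite E.
  exact: ord_trans Oy Hz K.
Qed.

Definition om := epsilon (inhabits emptyset) (@is_omega M).

Lemma om_is_omega : is_omega om.
Proof.
apply: epsilon_spec.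
have [w Hw] := ax_infinity (zax M).
have inO x : x ∈ sep w (fun x => forall v, is_inductive v -> x ∈ v) <->
    forall v, is_inductive v -> x ∈ v.
  rewrite in_sep; first by dfn_auto.
  by split=> [[]//|H]; split=> //; apply: H.
exists (sep w (fun x => forall v, is_inductive v -> x ∈ v)).
split; last by move=> v Hv x /inO; apply.
split.
  exists emptyset; split; first exact: in_empty.
  by apply/inO => v [[x [/emptyP ->]]].
move=> x /inO Hx; exists (succ x); split; first by apply/is_succE.
apply/inO => v Hv; have [_ /(_ x (Hx v Hv)) [s [/is_succE -> //]]] := Hv.
Qed.

Lemma is_omegaE o : is_omega o <-> o = om.
Proof.
split=> [[H1 H2]|->]; last exact: om_is_omega.
have [K1 K2] := om_is_omega.
by apply: ext => z; split; [apply: H2|apply: K2].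
Qed.

Lemma is_natE n : is_nat n <-> n ∈ om.
Proof.
split=> [[o [/is_omegaE -> //]]|H].
by exists om; rewrite is_omegaE.
Qed.

Lemma om_zero : emptyset ∈ om.
Proof. by have [[[x [/emptyP ->]]]] := om_is_omega. Qed.

Lemma om_succ n : n ∈ om -> succ n ∈ om.
Proof. by have [[_ H] _] := om_is_omega; move=> /H [s [/is_succE ->]]. Qed.

(** The elements of [om] satisfying [P] form an inductive set of the model. As [om] may be
    non-standard, induction on the Rocq type [nat] could not replace this. *)
Lemma nat_ind (P : M -> Prop) : dfn (fun e => P (e 0)) -> P emptyset ->
  (forall n, n ∈ om -> P n -> P (succ n)) -> forall n, n ∈ om -> P n.
Proof.
move=> HP P0 PS n Hn; have [_ H] := om_is_omega.
suff: n ∈ sep om P by move=> /(in_sep om HP) [].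
suff K : is_inductive (sep om P) by exact: (H _ K n Hn).
split.
  exists emptyset; split; first exact: in_empty.
  by apply/(in_sep om HP); split=> //; exact: om_zero.
move=> x /(in_sep om HP) [Hx Px]; exists (succ x); split; first by apply/is_succE.
by apply/(in_sep om HP); split; [apply: om_succ|apply: PS].
Qed.

Lemma nat_ord n : n ∈ om -> is_ordinal n.
Proof.
move: n; apply: nat_ind; first by dfn_auto.
  by split=> x /in_empty.
by move=> n _; exact: ord_succ.
Qed.

Lemma om_trans n x : n ∈ om -> x ∈ n -> x ∈ om.
Proof.
move=> Hn; move: n Hn x; apply: nat_ind; first by dfn_auto.
  by move=> x /in_empty.
by move=> n Hn H x /in_succ [/H|->].
Qed.

Lemma om_ord : is_ordinal om.
Proof.
by split=> n Hn; [move=> x; apply: om_trans|case: (nat_ord Hn)].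
Qed.

Lemma nat_total m n : m ∈ om -> n ∈ om -> m ∈ n \/ m = n \/ n ∈ m.
Proof. by move=> /nat_ord Hm /nat_ord; apply: ord_total. Qed.

Lemma nat_trans m n x : n ∈ om -> m ∈ n -> x ∈ m -> x ∈ n.
Proof. by move=> /nat_ord; apply: ord_trans. Qed.

(** From here on m ≤ n is expressed as [m ∈ succ n]. *)
Lemma ord_leE m n : ord_le m n <-> m ∈ succ n.
Proof. by rewrite in_succ. Qed.

Lemma nat_le_lt m n : m ∈ om -> n ∈ om -> m ∈ succ n \/ n ∈ m.
Proof. by move=> Hm /(nat_total Hm); rewrite in_succ; tauto. Qed.

Lemma nat_le_ltN m n : m ∈ om -> n ∈ om -> ~ m ∈ n -> n ∈ succ m.
Proof. by move=> Hm /(nat_total Hm); rewrite in_succ => -[|[->|]]; tauto. Qed.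

Lemma nat_lt_le_trans a b c : c ∈ om -> a ∈ b -> b ∈ succ c -> a ∈ c.
Proof. by move=> Hc Hab /in_succ [Hb|<-] //; apply: nat_trans Hb Hab. Qed.

Lemma nat_le_lt_trans a b c : c ∈ om -> a ∈ succ b -> b ∈ c -> a ∈ c.
Proof. by move=> Hc /in_succ [Ha|->] // Hb; apply: nat_trans Hb Ha. Qed.

Lemma nat_le_trans a b c : c ∈ om -> a ∈ succ b -> b ∈ succ c -> a ∈ succ c.
Proof. by move=> /om_succ; exact: nat_le_lt_trans. Qed.

Lemma self_succ a : a ∈ succ a.
Proof. by apply/in_succ; right. Qed.

Lemma mem_succ a b : a ∈ b -> a ∈ succ b.
Proof. by move=> H; apply/in_succ; left. Qed.

Lemma nat_max m n : m ∈ om -> n ∈ om ->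
  exists k, k ∈ om /\ m ∈ succ k /\ n ∈ succ k.
Proof.
move=> Hm Hn; have [H|H] := nat_le_lt Hm Hn.
  by exists n; split=> //; split=> //; exact: self_succ.
by exists m; split=> //; split; [exact: self_succ|exact: mem_succ].
Qed.

Lemma nat_least (P : M -> Prop) : dfn (fun e => P (e 0)) ->
  (exists n, n ∈ om /\ P n) ->
  exists n, n ∈ om /\ P n /\ forall m, m ∈ n -> ~ P m.
Proof.
move=> HP /(mem_min HP) [n [Hn [Pn K]]]; exists n; split=> //; split=> // m Hm.
by apply: K => //; apply: om_trans Hm.
Qed.

Lemma nat_cases n : n ∈ om -> n = emptyset \/ exists m, m ∈ om /\ n = succ m.
Proof.
move: n; apply: nat_ind; first by dfn_auto.
  by left.
by move=> n Hn _; right; exists n.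
Qed.

Lemma succ_inj m n : m ∈ om -> n ∈ om -> succ m = succ n -> m = n.
Proof.
move=> Hm Hn E.
have /in_succ [H|//] : m ∈ succ n by rewrite -E; exact: self_succ.
have /in_succ [/(mem_asym H) //|-> //] : n ∈ succ m by rewrite E; exact: self_succ.
Qed.

End Ordinals.

(** * Finite and countable sets *)

Section Finite.
Context {M : zmodel}.
Implicit Types (x y z a b c f g h k l m n o A B C D F X Y Z : M).

Lemma finiteE A : finite A <-> exists n, n ∈ om /\ equinumerous A n.
Proof. by split=> -[n [Hn H]]; exists n; move: Hn; rewrite is_natE. Qed.

Lemma countableE A : countable A <-> injects A om.
Proof.
split=> [[o [/is_omegaE -> //]]|H].
by exists om; rewrite is_omegaE.
Qed.

Lemma equi_adj A B a b : equinumerous A B -> ~ a ∈ A -> ~ b ∈ B ->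
  equinumerous (adj A a) (adj B b).
Proof.
move=> [f [F [/(injE F) I /(ontoE F) S]]] Na Nb.
apply: (@equi_intro _ (fun x y => (x ∈ A /\ y = ap f x) \/ (x = a /\ y = b))).
- by dfn_auto.
- move=> x /in_adj [Hx|->]; last by exists b; rewrite in_adj; tauto.
  by exists (ap f x); rewrite in_adj; split; left => //; apply: ap_in F Hx.
- move=> y /in_adj [/S [x [Hx ->]]|->]; last by exists a; rewrite in_adj; tauto.
  by exists x; rewrite in_adj; tauto.
- move=> x x' y _ _ _ [[Hx ->]|[-> ->]] [[Hx' E]|[-> E]] //; first exact: I.
  + by case: Nb; rewrite -E; apply: ap_in F Hx.
  + by case: Nb; rewrite E; apply: ap_in F Hx'.
- by move=> x y y' _ _ _ [[Hx ->]|[-> ->]] [[Hx' ->]|[E ->]] //; case: Na; rewrite -?E.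
Qed.

Lemma equi_remove A n : n ∈ om -> equinumerous A (succ n) ->
  exists B a, [/\ A = adj B a, ~ a ∈ B & equinumerous B n].
Proof.
move=> Hn [f [F [/(injE F) I /(ontoE F) S]]].
have [a [Ha Ea]] := S n (self_succ n).
have inB x : x ∈ sep A (fun x => x <> a) <-> x ∈ A /\ x <> a.
  by apply: in_sep; dfn_auto.
exists (sep A (fun x => x <> a)), a; split.
{ apply: ext => x; rewrite in_adj inB; split=> [Hx|[[]|->] //].
  by case: (classic (x = a)); tauto. }
{ by rewrite inB => -[_]; apply. }
apply: (@equi_intro _ (fun x y => y = ap f x)); first by dfn_auto.
- move=> x /inB [Hx Nx]; exists (ap f x); split=> //.
  have := ap_in F Hx; move=> /in_succ [//|E].
  by case: Nx; apply: I => //; rewrite E.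
- move=> y Hy; have [x [Hx E]] := S y (mem_succ Hy); exists x; split=> //.
  apply/inB; split=> // Exa; move: Hy; rewrite E Exa -Ea; exact: mem_irrefl.
- by move=> x x' y /inB [Hx _] /inB [Hx' _] _ -> E; apply: I.
- by move=> x y y' _ _ _ -> ->.
Qed.

Lemma finite_ind (P : M -> Prop) : dfn (fun e => P (e 0)) -> P emptyset ->
  (forall A a, finite A -> ~ a ∈ A -> P A -> P (adj A a)) ->
  forall A, finite A -> P A.
Proof.
move=> HP P0 PS A /finiteE [n [Hn]]; move: n Hn A; apply: nat_ind.
- by dfn_auto.
- move=> A [f [F _]]; suff -> : A = emptyset by [].
  by apply: emptyP => x /(ap_in F) /in_empty.
- move=> n Hn IH A /(equi_remove Hn) [B [a [-> Na HB]]].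
  by apply: PS => //; [apply/finiteE; exists n|apply: IH].
Qed.

Lemma finite_equi A B : equinumerous A B -> finite A -> finite B.
Proof.
move=> E /finiteE [n [Hn K]]; apply/finiteE; exists n; split=> //.
exact: equi_trans (equi_sym E) K.
Qed.

Lemma finite_nat n : n ∈ om -> finite n.
Proof. by move=> Hn; apply/finiteE; exists n; split=> //; apply: equi_refl. Qed.

Lemma finite_empty : finite (emptyset : M).
Proof. exact/finite_nat/om_zero. Qed.

Lemma finite_adj A a : finite A -> finite (adj A a).
Proof.
move=> HA; case: (classic (a ∈ A)) => [Ha|Na].
  suff -> : adj A a = A by [].
  by apply: ext => x; rewrite in_adj; split=> [[|->]|]; tauto.
move: HA => /finiteE [n [Hn E]]; apply/finiteE; exists (succ n); split.
  exact: om_succ.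
by apply: equi_adj => //; exact: mem_irrefl.
Qed.

Lemma finite_sub A B : finite B -> incl A B -> finite A.
Proof.
move=> HB; move: B HB A; apply: finite_ind; first by dfn_auto.
  move=> A HA; suff -> : A = emptyset by exact: finite_empty.
  by apply: emptyP => x /HA /in_empty.
move=> B b _ Nb IH A HA.
have inA' x : x ∈ sep A (fun x => x <> b) <-> x ∈ A /\ x <> b.
  by apply: in_sep; dfn_auto.
have FA' : finite (sep A (fun x => x <> b)).
  by apply: IH => x /inA' [/HA /in_adj []].
case: (classic (b ∈ A)) => [Hb|Nb'].
  suff -> : A = adj (sep A (fun x => x <> b)) b by apply: finite_adj.
  apply: ext => x; rewrite in_adj inA'; split=> [Hx|[[]|->] //].
  by case: (classic (x = b)); tauto.
suff -> : A = sep A (fun x => x <> b) by [].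
by apply: ext => x; rewrite inA'; split=> [Hx|[]//]; split=> // E; rewrite -E in Nb'.
Qed.

Lemma finite_injects A B : finite B -> injects A B -> finite A.
Proof.
move=> FB /injects_range [C [CB E]].
by apply: finite_equi (equi_sym E) _; apply: finite_sub CB.
Qed.

Lemma finite_cup A B : finite A -> finite B -> finite (cup A B).
Proof.
move=> HA HB; move: A HA; apply: finite_ind; first by dfn_auto.
  suff -> : cup (emptyset : M) B = B by [].
  by apply: ext => x; rewrite in_cup; split=> [[/in_empty|]|]; tauto.
move=> A a _ _ IH; suff -> : cup (adj A a) B = adj (cup A B) a by apply: finite_adj.
by apply: ext => x; rewrite !(in_adj, in_cup); tauto.
Qed.

Lemma finite_upair a b : finite (upair a b).
Proof.
suff -> : upair a b = adj (adj emptyset a) b by do !apply: finite_adj; exact: finite_empty.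
apply: ext => x; rewrite !in_adj in_upair; split=> [|[[/in_empty|]|]]; tauto.
Qed.

Lemma finite_image (R : M -> M -> Prop) A B : dfn (fun e => R (e 0) (e 1)) ->
  finite A -> (forall y, y ∈ B -> exists x, x ∈ A /\ R x y) ->
  (forall x y y', R x y -> R x y' -> y = y') -> finite B.
Proof.
move=> HR HA H U; apply: finite_injects HA _.
apply: (@injects_intro _ (fun y x => R x y)) => //; first by dfn_auto.
by move=> y y' x _ _ _; apply: U.
Qed.

Lemma finite_power A : finite A -> finite (power A).
Proof.
move: A; apply: finite_ind; first by dfn_auto.
  suff -> : power emptyset = sing (emptyset : M) by apply: finite_upair.
  apply: ext => x; rewrite in_power in_sing; split=> [H|-> //].
  by apply: emptyP => z /H /in_empty.
move=> A a _ Na IH.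
pose Q := sep (power (adj A a)) (fun Y => a ∈ Y).
have inQ Y : Y ∈ Q <-> incl Y (adj A a) /\ a ∈ Y.
  by rewrite in_sep ?in_power //; dfn_auto.
apply: (@finite_sub _ (cup (power A) Q)).
  apply: finite_cup => //.
  apply: (@finite_image (fun Y Z => Z = adj Y a) (power A)) => //.
  { by dfn_auto. }
  { move=> Z /inQ [HZ Ha].
    have inY x : x ∈ sep Z (fun x => x <> a) <-> x ∈ Z /\ x <> a.
      by apply: in_sep; dfn_auto.
    exists (sep Z (fun x => x <> a)); split.
      by apply/in_power => x /inY [/HZ /in_adj []].
    apply: ext => x; rewrite in_adj inY; split=> [Hx|[[]|->] //].
    by case: (classic (x = a)); tauto. }
  by move=> x y y' -> ->.
move=> Y /in_power HY; apply/in_cup; rewrite in_power inQ.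
case: (classic (a ∈ Y)); first by right.
by move=> N; left=> x Hx; have /in_adj [//|E] := HY x Hx; case: N; rewrite -E.
Qed.

(** An injection [f] of n+2 into n+1 becomes one of n+1 into n when a point of value n is redirected
    to the value of [f] at n+1. *)
Lemma pigeonhole n : n ∈ om -> ~ injects (succ n) n.
Proof.
move: n; apply: nat_ind; first by dfn_auto.
  by move=> [f [F _]]; have := ap_in F (self_succ (emptyset : M)); move=> /in_empty.
move=> n Hn IH [f [F /(injE F) I]]; apply: IH.
have Hs x : x ∈ succ n -> x ∈ succ (succ n) by exact: mem_succ.
have Nx x : x ∈ succ n -> x <> succ n by move=> Hx E; move: Hx; rewrite E => /mem_irrefl.
apply: (@injects_intro _ (fun x y =>
  (ap f x <> n /\ y = ap f x) \/ (ap f x = n /\ y = ap f (succ n)))).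
- by dfn_auto.
- move=> x Hx; case: (classic (ap f x = n)) => E.
    exists (ap f (succ n)); split; last by right.
    have := ap_in F (self_succ (succ n)); move=> /in_succ [//|E'].
    by case: (Nx x Hx); apply: I; [exact: Hs|exact: self_succ|rewrite E'].
  exists (ap f x); split; last by left.
  by have := ap_in F (Hs _ Hx); move=> /in_succ [].
- move=> x x' y Hx Hx' _ [[N ->]|[N ->]] [[N' E]|[N' E]].
  + by apply: I => //; apply: Hs.
  + by case: (Nx x Hx); apply: I => //; [exact: Hs|exact: self_succ].
  + by case: (Nx x' Hx'); apply: I => //; [exact: Hs|exact: self_succ].
  + by apply: I; [exact: Hs|exact: Hs|rewrite N N'].
Qed.

(** The common source of bounds for finitely many numbers, of lower bounds inside an ultrafilter,
    and of finite joins in an ideal. *)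
Lemma finite_directed (R : M -> M -> Prop) (le : M -> M -> Prop) F S :
  dfn (fun e => R (e 0) (e 1)) -> finite F -> (exists s, s ∈ S) ->
  (forall s t, s ∈ S -> t ∈ S -> exists r, [/\ r ∈ S, le s r & le t r]) ->
  (forall i s t, i ∈ F -> s ∈ S -> t ∈ S -> R i s -> le s t -> R i t) ->
  (forall i, i ∈ F -> exists s, s ∈ S /\ R i s) ->
  exists s, s ∈ S /\ forall i, i ∈ F -> R i s.
Proof.
move=> HR FF [s0 Hs0] Hd Hm He.
suff : forall D, finite D -> incl D F -> exists s, s ∈ S /\ forall i, i ∈ D -> R i s.
  by apply.
apply: finite_ind; first by dfn_auto.
  by move=> _; exists s0; split=> // i /in_empty.
move=> D d _ _ IH HD.
have [|s [Hs Ks]] := IH; first by move=> x Hx; apply: HD; apply/in_adj; left.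
have Hd' : d ∈ F by apply: HD; apply/in_adj; right.
have [t [Ht Kt]] := He d Hd'.
have [r [Hr Hsr Htr]] := Hd s t Hs Ht.
exists r; split=> // i /in_adj [Hi|->]; last by apply: Hm Hd' Ht Hr Kt Htr.
apply: (Hm i s r) => //; last exact: Ks.
by apply: HD; apply/in_adj; left.
Qed.

Lemma finite_bound (R : M -> M -> Prop) F : dfn (fun e => R (e 0) (e 1)) -> finite F ->
  (forall i n m, i ∈ F -> m ∈ om -> R i n -> n ∈ succ m -> R i m) ->
  (forall i, i ∈ F -> exists n, n ∈ om /\ R i n) ->
  exists n, n ∈ om /\ forall i, i ∈ F -> R i n.
Proof.
move=> HR FF Hm; apply: (finite_directed (le := fun n m => n ∈ succ m)) => //.
- by exists emptyset; exact: om_zero.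
- by move=> s t Hs Ht; have [r [? [? ?]]] := nat_max Hs Ht; exists r.
- by move=> i s t Hi _ Ht; apply: Hm.
Qed.

Lemma finite_om_bounded F : finite F -> incl F om -> exists n, n ∈ om /\ incl F n.
Proof.
move=> FF HF; apply: (@finite_bound (fun i n => i ∈ n)) => //; first by dfn_auto.
  by move=> i n m Hi Hm Hin Hn; apply: nat_lt_le_trans Hin Hn.
by move=> i /HF Hi; exists (succ i); split; [apply: om_succ|apply: self_succ].
Qed.

(* Injectivity comes from counting: each element of [X] is sent to the number of its
   predecessors, for the order that compares first the stage of appearance. *)
Lemma countable_union_chain (R lt : M -> M -> Prop) X :
  dfn (fun e => R (e 0) (e 1)) -> dfn (fun e => lt (e 0) (e 1)) ->
  (forall n x, n ∈ om -> R n x -> R (succ n) x) ->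
  (forall x, x ∈ X -> exists n, n ∈ om /\ R n x) ->
  (forall n, n ∈ om -> finite (sep X (fun x => R n x))) ->
  (forall x, ~ lt x x) -> (forall x y z, x ∈ X -> y ∈ X -> z ∈ X -> lt x y -> lt y z -> lt x z) ->
  (forall x y, x ∈ X -> y ∈ X -> lt x y \/ x = y \/ lt y x) ->
  countable X.
Proof.
move=> HR Hlt Rs Rex Rfin ltI ltT ltC.
have Rmono m n x : n ∈ om -> m ∈ succ n -> R m x -> R n x.
  move=> Hn; move: n Hn m; apply: nat_ind; first by dfn_auto.
    by move=> m /in_succ [/in_empty|->].
  move=> n Hn IH m /in_succ [Hm|->] // H.
  exact: Rs _ _ Hn (IH _ Hm H).
pose rk x n := n ∈ om /\ R n x /\ forall m, m ∈ n -> ~ R m x.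
have rkex x : x ∈ X -> exists n, rk x n by move=> /Rex; apply: nat_least; dfn_auto.
have rk_dfn : dfn (fun e => rk (e 0) (e 1)) by dfn_auto.
have rkU x m n : rk x m -> rk x n -> m = n.
  move=> [Hm [Rm Km]] [Hn [Rn Kn]].
  by have [/Kn|[|/Km]] := nat_total Hm Hn.
(* Note the order of arguments: in [below x z] it is [z] that comes before [x]. *)
pose below x z := exists n m, rk x n /\ rk z m /\ (m ∈ n \/ (m = n /\ lt z x)).
have b_dfn : dfn (fun e => below (e 0) (e 1)) by dfn_auto.
have bT x y z : x ∈ X -> y ∈ X -> z ∈ X -> below y x -> below z y -> below z x.
  move=> Hx Hy Hz [n [m [Ry [Rx D]]]] [k [n' [Rz [Ry' D']]]].
  have E := rkU _ _ _ Ry' Ry; subst n'.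
  have Hk : k ∈ om by case: Rz.
  exists k, m; split=> //; split=> //; case: D D' => [Hm|[-> L]] [Hn|[En L']].
  { by left; apply: nat_trans Hn Hm. }
  { by left; rewrite -En. }
  { by left. }
  by right; split=> //; apply: ltT L L'.
have bI x : ~ below x x.
  move=> [n [m [Rn [Rm]]]]; rewrite (rkU _ _ _ Rm Rn) => -[/mem_irrefl|[_ /ltI]] //.
have bC x y : x ∈ X -> y ∈ X -> below x y \/ x = y \/ below y x.
  move=> Hx Hy; have [n Rx] := rkex x Hx; have [m Ry] := rkex y Hy.
  have [Hn Hm] : n ∈ om /\ m ∈ om by case: Rx; case: Ry.
  have [H|[H|H]] := nat_total Hn Hm.
  { by right; right; exists m, n; tauto. }
  { subst m; have [H|[H|H]] := ltC x y Hx Hy; [right; right|by tauto|left];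
      by exists n, n; tauto. }
  by left; exists n, m; tauto.
pose T x := sep X (fun z => below x z).
have inT x z : z ∈ T x <-> z ∈ X /\ below x z by apply: in_sep; dfn_auto.
have Tfin x : x ∈ X -> finite (T x).
  move=> /rkex [n Rx]; have Hn : n ∈ om by case: Rx.
  apply: finite_sub (Rfin n Hn) _ => z /inT [Hz [n' [m [Rx' [[_ [Rz _]] D]]]]].
  apply/in_sep; first by dfn_auto.
  split=> //; apply: Rmono Hn _ Rz; rewrite (rkU _ _ _ Rx Rx').
  by apply/in_succ; tauto.
have strict x y n : x ∈ X -> y ∈ X -> n ∈ om -> below y x ->
    equinumerous (T x) n -> ~ equinumerous (T y) n.
  move=> Hx Hy Hn Bxy Ex Ey; apply: (pigeonhole Hn).
  have K : ~ x ∈ T x by move=> /inT [_ /bI].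
  have Es := equi_adj Ex K (@mem_irrefl _ n).
  apply: injects_trans (equi_injects (equi_sym Es)) _.
  apply: injects_trans (equi_injects Ey); apply: injects_incl => z.
  move=> /in_adj [/inT [Hz Bz]|->]; apply/inT; split=> //.
  exact: (@bT z x y).
apply/countableE.
apply: (@injects_intro _ (fun x n => n ∈ om /\ exists t, t = T x /\ equinumerous t n)).
(* [T x] is a [sep] term, for which there is no definability rule; a quantified set with the same
   elements replaces it. *)
- apply: (@dfn_ext _ _ (fun e => e 1 ∈ om /\
    exists t, (forall z, z ∈ t <-> z ∈ X /\ below (e 0) z) /\ equinumerous t (e 1))).
    move=> e; split=> -[He [t [Ht K]]]; split=> //; exists t; split=> //.
      by move=> z; rewrite Ht inT.
    by apply: ext => z; rewrite inT.
  by dfn_auto.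
- by move=> x /Tfin /finiteE [n [Hn E]]; exists n; split=> //; split=> //; exists (T x).
- move=> x x' n Hx Hx' _ [Hn [_ [-> E]]] [_ [_ [-> E']]].
  have [H|[//|H]] := bC x x' Hx Hx'.
    by case: (strict x' x n).
  by case: (strict x x' n).
Qed.

End Finite.

(** * Zorn's lemma and uncountable ordinals *)

Section Zorn.
Context {M : zmodel}.
Implicit Types (x y z a b c f g h k l m n o A B C D F S T X Y Z : M).

Definition chain C := forall X Y, X ∈ C -> Y ∈ C -> incl X Y \/ incl Y X.

Lemma incl_refl X : incl X X.
Proof. by []. Qed.

Lemma incl_asym X Y : incl X Y -> incl Y X -> X = Y.
Proof. by move=> H K; apply: ext => z; split; [apply: H|apply: K]. Qed.

Lemma incl_trans X Y Z : incl X Y -> incl Y Z -> incl X Z.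
Proof. by move=> H K z /H /K. Qed.

Lemma union_sub C Y : (forall X, X ∈ C -> incl X Y) -> incl (union C) Y.
Proof. by move=> H z /in_union [X [Hz /H]]; apply. Qed.

Lemma sub_union C X : X ∈ C -> incl X (union C).
Proof. by move=> H z Hz; apply/in_union; exists X. Qed.

(* If no element were maximal, a function [g] with [X ⊊ g X] would exist; the least family
   closed under [g] and unions of chains is then itself a chain, whose union is a fixed point. *)
Lemma zorn F : (exists X, X ∈ F) ->
  (forall C, incl C F -> (exists X, X ∈ C) -> chain C -> union C ∈ F) ->
  exists X, X ∈ F /\ forall Y, Y ∈ F -> incl X Y -> Y = X.
Proof.
move=> [X0 HX0] HF; apply: NNPP => N.
have [||g [Hg Kg]] := @choice M (fun X Y => incl X Y /\ Y <> X) F F.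
{ by dfn_auto. }
{ move=> X HX; apply: NNPP => K; apply: N; exists X; split=> // Y HY HXY.
  by apply: NNPP => NE; apply: K; exists Y. }
pose tower S := incl S F /\ X0 ∈ S /\ (forall X, X ∈ S -> ap g X ∈ S) /\
  forall C, incl C S -> (exists X, X ∈ C) -> chain C -> union C ∈ S.
pose T := sep F (fun X => forall S, tower S -> X ∈ S).
have inT X : X ∈ T <-> X ∈ F /\ forall S, tower S -> X ∈ S by apply: in_sep; dfn_auto.
have TF : incl T F by move=> X /inT [].
have T0 : X0 ∈ T by apply/inT; split=> // S [_ []].
have Tg X : X ∈ T -> ap g X ∈ T.
  move=> /inT [HX K]; apply/inT; split; first exact: ap_in Hg HX.
  by move=> S HS; move: (HS) => [_ [_ [/(_ X) H _]]]; apply: H; apply: K.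
have TC C : incl C T -> (exists X, X ∈ C) -> chain C -> union C ∈ T.
  move=> CT C1 C2; apply/inT; split; first by apply: HF => // X /CT /TF.
  move=> S HS; move: (HS) => [_ [_ [_]]]; apply=> // X /CT /inT [_]; exact.
have Tind (P : M -> Prop) : dfn (fun e => P (e 0)) -> P X0 ->
    (forall X, X ∈ T -> P X -> P (ap g X)) ->
    (forall C, incl C T -> (exists X, X ∈ C) -> chain C -> (forall X, X ∈ C -> P X) -> P (union C)) ->
    forall X, X ∈ T -> P X.
  move=> HP P0 Pg PC X HX.
  have inS Y : Y ∈ sep T P <-> Y ∈ T /\ P Y by apply: in_sep.
  have /inT [_ /(_ (sep T P))] := HX; rewrite inS => -[] //; split; last split; last split.
  { by move=> Y /inS [/TF]. }
  { by apply/inS. }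
  { by move=> Y /inS [HY PY]; apply/inS; split; [apply: Tg|apply: Pg]. }
  { move=> C CS C1 C2; have CT : incl C T by move=> Y /CS /inS [].
    by apply/inS; split; [apply: TC|apply: PC => // Y /CS /inS []]. }
have g1 X : X ∈ T -> incl X (ap g X) by move=> /TF /Kg [].
have A X : X ∈ T -> incl X0 X.
  move: X; apply: Tind; first by dfn_auto.
  { by []. }
  { by move=> X HX H; apply: incl_trans H (g1 X HX). }
  { move=> C _ [X HX] _ H; exact: incl_trans (H X HX) (sub_union HX). }
(* The Bourbaki-Witt argument: an extreme [e] is comparable with the whole tower, with nothing
   strictly between [e] and [ap g e]; and all members of the tower are extreme. *)
pose extr (e : M) := forall X, X ∈ T -> incl X e -> X <> e -> incl (ap g X) e.
have B (e : M) : e ∈ T -> extr e -> forall X, X ∈ T -> incl X e \/ incl (ap g e) X.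
  move=> He Ee; apply: Tind; first by dfn_auto.
  { by left; apply: A. }
  { move=> X HX [H|H]; last by right; apply: incl_trans H (g1 X HX).
    by case: (classic (X = e)) => [->|NE]; [right|left; apply: Ee]. }
  { move=> C CT _ _ H; case: (classic (exists X, X ∈ C /\ incl (ap g e) X)).
      by move=> [X [HX K]]; right; apply: incl_trans K (sub_union HX).
    move=> K; left; apply: union_sub => X HX.
    by have [//|K'] := H X HX; case: K; exists X. }
have Ex (e : M) : e ∈ T -> extr e.
  move: e; apply: Tind; first by dfn_auto.
  { by move=> X HX K; case; apply: incl_asym K (A X HX). }
  { move=> e He Ee X HX K NE; have [H|H] := B e He Ee X HX.
      case: (classic (X = e)) => [->|NE'] //.
      by apply: incl_trans (Ee X HX H NE') (g1 e He).
    by case: NE; apply: incl_asym. }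
  { move=> C CT _ _ H X HX K NE.
    have [c [Hc Nc]] : exists c, c ∈ C /\ ~ incl c X.
      apply: NNPP => N'; apply: NE; apply: incl_asym => //; apply: union_sub => c Hc.
      by apply: NNPP => K'; apply: N'; exists c.
    have HcT := CT c Hc.
    have [K'|K'] := B c HcT (H c Hc) X HX; last by case: Nc; apply: incl_trans (g1 c HcT) K'.
    apply: incl_trans (sub_union Hc); apply: (H c Hc) => // E; by apply: Nc; rewrite E. }
have HU : union T ∈ T.
  apply: TC => //; first by exists X0.
  move=> X Y HX HY; have [H|H] := B X HX (Ex X HX) Y HY; [by right|left].
  exact: incl_trans (g1 X HX) H.
have [K []] := Kg _ (TF _ HU).
by apply: incl_asym K; apply/sub_union/Tg.
Qed.

End Zorn.

(** * The first uncountable ordinal and its regularity *)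

Section Omega1.
Context {M : zmodel}.
Implicit Types (x y z a b c f g h k l m n o A B C D F S T X Y Z : M).

(* Zorn's lemma for the injections from an initial segment of [k] into [B] *)
Lemma ord_compare k B : is_ordinal k -> injects k B \/ exists a, a ∈ k /\ injects B a.
Proof.
move=> Hk.
pose ok f := (forall x y y', app f x y -> app f x y' -> y = y') /\
  (forall x x' y, app f x y -> app f x' y -> x = x') /\
  (forall x x' y, app f x y -> x' ∈ x -> exists y', app f x' y').
have inF f : f ∈ sep (power (prod k B)) ok <-> incl f (prod k B) /\ ok f.
  by rewrite in_sep ?in_power //; dfn_auto.
have appU C x y : app (union C) x y <-> exists f, f ∈ C /\ app f x y.
  rewrite appE in_union; split=> -[f]; rewrite ?appE => -[H H']; exists f; rewrite ?appE //.
have [||f [/inF [fP [f1 [f2 f3]]] fmax]] := @zorn M (sep (power (prod k B)) ok).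
{ exists emptyset; apply/inF; split; first by move=> p /in_empty.
  by split; last split; move=> ? ? ? /appE /in_empty. }
{ move=> C CF _ Cch; apply/inF; split; first by apply: union_sub => f /CF /inF [].
  have two f g : f ∈ C -> g ∈ C -> exists h, [/\ h ∈ C, incl f h & incl g h].
    by move=> Hf Hg; have [H|H] := Cch f g Hf Hg; [exists g|exists f]; split=> //; exact: incl_refl.
  have incl_app f g x y : incl f g -> app f x y -> app g x y.
    by move=> H; rewrite !appE; apply: H.
  split; last split.
  + move=> x y y' /appU [f [Hf K]] /appU [g [Hg K']].
    have [h [Hh Hfh Hgh]] := two f g Hf Hg.
    have /inF [_ [h1 _]] := CF h Hh.
    exact: h1 (incl_app _ _ _ _ Hfh K) (incl_app _ _ _ _ Hgh K').
  + move=> x x' y /appU [f [Hf K]] /appU [g [Hg K']].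
    have [h [Hh Hfh Hgh]] := two f g Hf Hg.
    have /inF [_ [_ [h2 _]]] := CF h Hh.
    exact: h2 (incl_app _ _ _ _ Hfh K) (incl_app _ _ _ _ Hgh K').
  + move=> x x' y /appU [f [Hf K]] Hx.
    have /inF [_ [_ [_ h3]]] := CF f Hf.
    by have [y' Hy'] := h3 _ _ _ K Hx; exists y'; apply/appU; exists f. }
have fkB x y : app f x y -> x ∈ k /\ y ∈ B by move/appE/fP/opair_prod.
case: (classic (forall x, x ∈ k -> exists y, app f x y)) => [tot|ntot].
  left; exists f; split; last exact: f2.
  apply: fun_intro => // x /tot [y Hy]; exists y; split=> // y'; exact: f1 Hy.
(* The domain of [f] is an initial segment, hence equal to [a]. A point [b] outside the range would
   allow adding the pair (a, b), so [f] is onto [B] and can be inverted. *)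
have [||a [Ha [Na mina]]] := @mem_min M (fun x => ~ exists y, app f x y) k.
{ by dfn_auto. }
{ apply: NNPP => N; apply: ntot => x Hx; apply: NNPP => K; apply: N; by exists x. }
have doma x y : app f x y -> x ∈ a.
  move=> H; have [Hx _] := fkB _ _ H.
  have [//|[E|K]] := ord_total (ord_in Hk Hx) (ord_in Hk Ha).
    by case: Na; exists y; rewrite -E.
  by case: Na; apply: f3 H K.
right; exists a; split=> //.
apply: (@injects_intro _ (fun y x => app f x y)); first by dfn_auto.
  move=> b Hb; apply: NNPP => N.
  have Nb x : ~ app f x b by move=> K; apply: N; exists x; split=> //; apply: doma K.
  have appf' x y : app (adj f (opair a b)) x y <-> app f x y \/ (x = a /\ y = b).
    rewrite !appE in_adj; split=> [[|/opair_inj]|[|[-> ->]]]; tauto.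
  suff E : adj f (opair a b) = f.
    by apply: (Na); exists b; apply/appE; rewrite -E; apply/in_adj; right.
  apply: fmax; last by move=> p Hp; apply/in_adj; left.
  apply/inF; split.
    by move=> p /in_adj [/fP //|->]; rewrite opair_prod.
  split; last split.
  { move=> x y y' /appf' [H|[-> ->]] /appf' [H'|[E ->]] //; first exact: f1 H H'.
        by case: Na; exists y; rewrite -E.
      by case: Na; exists y'. }
  { move=> x x' y /appf' [H|[-> ->]] /appf' [H'|[-> E]] //; first exact: f2 H H'.
        by case: (Nb x); rewrite -E.
      by case: (Nb x'). }
  { move=> x x' y /appf' [H|[-> _]] Hx.
        by have [y' Hy'] := f3 _ _ _ H Hx; exists y'; apply/appf'; left.
      have [y' Hy'] : exists y', app f x' y'.
        apply: NNPP => K; apply: (mina x') => //; exact: ord_trans Hk Ha Hx.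
      by exists y'; apply/appf'; left. }
by move=> y y' x _ _ _; apply: f1.
Qed.

Lemma countable_injects A B : countable B -> injects A B -> countable A.
Proof. by rewrite !countableE => HB HA; apply: injects_trans HA HB. Qed.

(** The minimality in [is_omega1] concerns cardinals only, so an uncountable [a] is first replaced
    by the least ordinal equinumerous with it. *)
Lemma omega1_elt k a : is_omega1 k -> a ∈ k -> countable a.
Proof.
move=> [[Ok Ck] [Nk Kk]] Ha; apply: NNPP => Na.
have [||l [Hl [El minl]]] := @mem_min M (fun x => equinumerous a x) (succ a).
{ by dfn_auto. }
{ by exists a; split; [exact: self_succ|exact: equi_refl]. }
have Oa := ord_in Ok Ha.
have Ol : is_ordinal l := ord_in (ord_succ Oa) Hl.
have Nl : ~ countable l by move=> H; apply: Na; apply: countable_injects H (equi_injects El).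
have Hlk : l ∈ k by move: Hl => /in_succ [/(ord_trans Ok Ha)|->].
have : ord_le k l.
  apply: Kk => //; split=> // b Hb Eb; apply: (minl b) => //.
    by apply: ord_trans (ord_succ Oa) Hl Hb.
  exact: equi_trans El (equi_sym Eb).
by move=> [/(mem_asym Hlk)|E] //; move: Hlk; rewrite E => /mem_irrefl.
Qed.

Lemma omega1_intro k : is_ordinal k -> ~ countable k ->
  (forall a, a ∈ k -> countable a) -> is_omega1 k.
Proof.
move=> Ok Nk H; split; first split=> // a Ha E.
  by apply: Nk; apply: countable_injects (H a Ha) (equi_injects (equi_sym E)).
split=> // l [Ol _] Nl; have [K|[K|K]] := ord_total Ok Ol; [by left|by right|].
by case: Nl; apply: H.
Qed.

Lemma omega1_om k : is_omega1 k -> om ∈ k.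
Proof.
move=> [[Ok _] [Nk _]]; have [//|[E|K]] := ord_total om_ord Ok; case: Nk; apply/countableE.
  by rewrite -E; apply: injects_incl.
by apply: injects_incl; case: (@om_ord M) => T _; exact: T K.
Qed.

(** If the values were cofinal, choose an injection of each ordinal below [k] into [om]. Stage n
    collects the elements of some [ap f i] with i ≤ n whose code there is at most n; these finite
    stages would exhaust [k], making it countable. *)
Lemma omega1_regular k f : is_omega1 k -> is_fun f om k ->
  exists d, d ∈ k /\ forall i, i ∈ om -> ap f i ∈ succ d.
Proof.
move=> Hk Hf; have [[Ok _] [Nk _]] := Hk; apply: NNPP => N.
have cof x : x ∈ k -> exists i, i ∈ om /\ x ∈ ap f i.
  move=> Hx; apply: NNPP => K; apply: N; exists x; split=> // i Hi.
  have Hfi := ap_in Hf Hi.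
  have [H|[H|H]] := ord_total (ord_in Ok Hx) (ord_in Ok Hfi).
  { by case: K; exists i. }
  { by rewrite -H; apply: self_succ. }
  { by apply: mem_succ. }
have [||h [Hh Kh]] := @choice M (fun a g => is_fun g a om /\ is_injective g) k (power (prod k om)).
{ by dfn_auto. }
{ move=> a Ha; have /countableE [g [Hg Ig]] := omega1_elt Hk Ha; exists g; split=> //.
  apply/in_power => p /(fun_prod Hg) /in_prod [x [y [Hx [Hy ->]]]].
  by apply/opair_prod; split=> //; apply: ord_trans Ok Ha Hx. }
have hk i : i ∈ om -> is_fun (ap h (ap f i)) (ap f i) om /\ is_injective (ap h (ap f i)).
  by move=> Hi; apply: Kh; apply: ap_in Hf Hi.
pose R n x := exists i, i ∈ succ n /\ x ∈ ap f i /\ ap (ap h (ap f i)) x ∈ succ n.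
have R_dfn : dfn (fun e => R (e 0) (e 1)) by dfn_auto.
apply: Nk; apply: (@countable_union_chain _ R (fun x y => x ∈ y)) => //.
- by dfn_auto.
- move=> n x Hn [i [Hi [Hx K]]]; exists i; split; first exact: mem_succ.
  by split=> //; exact: mem_succ.
- move=> x /cof [i [Hi Hx]]; have Hy := ap_in (proj1 (hk i Hi)) Hx.
  have [n [Hn [H1 H2]]] := nat_max Hi Hy.
  by exists n; split=> //; exists i.
- move=> n Hn.
  suff H : forall l, l ∈ om -> finite (sep k (fun x =>
      exists i, i ∈ l /\ i ∈ om /\ x ∈ ap f i /\ ap (ap h (ap f i)) x ∈ succ n)).
    apply: finite_sub (H _ (om_succ Hn)) _ => x; rewrite !in_sep; [by dfn_auto..|].
    move=> [Hx [i [Hi [K1 K2]]]]; split=> //; exists i; split=> //; split=> //.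
    exact: om_trans (om_succ Hn) Hi.
  apply: nat_ind.
  + apply: (@dfn_ext _ _ (fun e => exists s, finite s /\ forall x, x ∈ s <-> x ∈ k /\
      exists i, i ∈ e 0 /\ i ∈ om /\ x ∈ ap f i /\ ap (ap h (ap f i)) x ∈ succ n)).
      move=> e; split=> [H|[s [Hs Ks]]].
        by eexists; split; first exact: H; move=> x; apply: in_sep; dfn_auto.
      apply: finite_sub Hs _ => x; rewrite in_sep; [by dfn_auto|by rewrite Ks].
    by dfn_auto.
  + apply: finite_sub finite_empty _ => x; rewrite in_sep; first by dfn_auto.
    by move=> [_ [i [/in_empty]]].
  + move=> l Hl IH.
    have [Hg Ig] := hk l Hl.
    apply: (@finite_sub _ _ (cup (sep k (fun x => exists i, i ∈ l /\ i ∈ om /\ x ∈ ap f i /\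
        ap (ap h (ap f i)) x ∈ succ n))
      (sep (ap f l) (fun x => ap (ap h (ap f l)) x ∈ succ n)))).
      apply: finite_cup => //.
      apply: finite_injects (finite_nat (om_succ Hn)) _.
      apply: (@injects_intro _ (fun x y => x ∈ ap f l /\ y = ap (ap h (ap f l)) x)).
      { by dfn_auto. }
      { move=> x; rewrite in_sep; first by dfn_auto.
        move=> [Hx K]; by exists (ap (ap h (ap f l)) x). }
      by move=> x x' y _ _ _ [Hx ->] [Hx' E]; exact: (proj1 (injE Hg) Ig).
    move=> x; rewrite in_cup !in_sep; [by dfn_auto..|].
    move=> [Hx [i [/in_succ [Hi|->] K]]]; last by right; tauto.
    by left; split=> //; exists i.
- exact: mem_irrefl.
- by move=> x y z _ _ Hz Hxy Hyz; apply: ord_trans (ord_in Ok Hz) Hyz Hxy.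
- by move=> x y Hx Hy; apply: ord_total; apply: ord_in Ok _.
Qed.

End Omega1.

(** * Boolean algebras and Stone spaces *)

Section BooleanAlgebra.
Context {M : zmodel} (A le : M).
Implicit Types (x y z a b c s t u v w m g B C D F I S T X Y Z U : M).
Notation "a ≼ b" := (app le a b) (at level 70).

(** Phrased with lower bounds, so that no meet has to be chosen. *)
Definition disj a b := forall z, z ≼ a -> z ≼ b -> is_bot A le z.

Hypothesis HBA : is_boolean_algebra A le.

Lemma le_in a b : a ≼ b -> a ∈ A /\ b ∈ A.
Proof.
have [[H _] _] := HBA; move/appE/H => [x [y [Hx [Hy /is_opairE /opair_inj [-> ->]]]]] //.
Qed.

Lemma le_refl a : a ∈ A -> a ≼ a.
Proof. by have [[_ [H _]] _] := HBA; apply: H. Qed.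

Lemma le_anti a b : a ≼ b -> b ≼ a -> a = b.
Proof. by have [[_ [_ [H _]]] _] := HBA; apply: H. Qed.

Lemma le_trans a b c : a ≼ b -> b ≼ c -> a ≼ c.
Proof. by have [[_ [_ [_ H]]] _] := HBA; apply: H. Qed.

Lemma bot_le z w : is_bot A le z -> w ≼ z -> is_bot A le w.
Proof.
move=> [Hz H] Hwz; have [Hw _] := le_in Hwz; split=> // a Ha.
exact: (le_trans Hwz (H a Ha)).
Qed.

Lemma disj_sym a b : disj a b -> disj b a.
Proof. by move=> H z Hzb Hza; apply: H. Qed.

Lemma disj_le a a' b b' : a' ≼ a -> b' ≼ b -> disj a b -> disj a' b'.
Proof. by move=> Ha Hb H z Hza Hzb; apply: H; [apply: le_trans Hza Ha|apply: le_trans Hzb Hb]. Qed.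

Lemma bot_ex : exists z, is_bot A le z.
Proof. by case: HBA => _ []. Qed.

Lemma top_ex : exists t, is_top A le t.
Proof. by case: HBA => _ [_ []]. Qed.

Lemma meet_ex a b : a ∈ A -> b ∈ A -> exists m, is_meet A le a b m.
Proof. by move=> Ha Hb; have [_ [_ [_ [/(_ a b Ha Hb) [_ //] _]]]] := HBA. Qed.

Lemma join_ex a b : a ∈ A -> b ∈ A -> exists s, is_join A le a b s.
Proof. by move=> Ha Hb; have [_ [_ [_ [/(_ a b Ha Hb) [//] _]]]] := HBA. Qed.

Lemma compl_ex a : a ∈ A -> exists c, is_compl A le a c.
Proof. by have [_ [_ [_ [_ [_ H]]]]] := HBA; apply: H. Qed.

(** By distributivity z is the join of its meets with [a] and with [c]. The Boolean computations
    below run through this equivalence. *)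
Lemma complE a c z : a ∈ A -> is_compl A le a c -> z ∈ A -> z ≼ c <-> disj z a.
Proof.
move=> Ha [Hc [[o [Ho [_ [_ [_ Hm]]]]] [t [Ht Hj]]]] Hz; split.
  move=> Hzc w Hwz Hwa; apply: bot_le Ho _; apply: Hm => //.
    by have [] := le_in Hwz.
  exact: (le_trans Hwz Hzc).
move=> Hd; have [_ [_ [_ [_ [distr _]]]]] := HBA.
have [x Hx] := meet_ex Hz Ha; have [y Hy] := meet_ex Hz Hc.
have [|_ [_ [_ K]]] := distr z a c t z x y Hj _ Hx Hy.
  split=> //; split; first exact: le_refl.
  by split=> //; case: Ht => _; apply.
apply: K => //; last by case: Hy => _ [_ []].
have [_ [H1 [H2 _]]] := Hx.
by have [_] := Hd x H1 H2; apply.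
Qed.

Lemma compl_sym a c : a ∈ A -> is_compl A le a c -> is_compl A le c a.
Proof.
move=> Ha [Hc [[o [Ho [oA [oa [oc om]]]]] [t [Ht [tA [at' [ct tm]]]]]]]; split=> //; split.
  by exists o; split=> //; split=> //; split=> //; split=> // z Hz H1 H2; apply: om.
by exists t; split=> //; split=> //; split=> //; split=> // z Hz H1 H2; apply: tm.
Qed.

Lemma compl_disj a c : a ∈ A -> is_compl A le a c -> disj c a.
Proof. by move=> Ha Hc; have cA := proj1 Hc; apply/(complE Ha Hc cA)/le_refl. Qed.

Lemma join_disj a b s z : is_join A le a b s -> z ∈ A -> disj z a -> disj z b -> disj z s.
Proof.
move=> [sA [Has [Hbs Hs]]] Hz Da Db; have [c Hc] := compl_ex Hz.
have cA : c ∈ A by case: Hc.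
have [aA _] := le_in Has; have [bA _] := le_in Hbs.
by apply: disj_sym; apply/(complE Hz Hc sA); apply: Hs => //;
  apply/(complE Hz Hc) => //; apply: disj_sym.
Qed.

(** Infinite distributivity: all of [B] lies below the complement of [z], hence so does its
    supremum. *)
Lemma sup_disj B s z : incl B A -> is_sup A le B s -> z ∈ A ->
  (forall b, b ∈ B -> disj z b) -> disj z s.
Proof.
move=> BA [sA [ub lub]] Hz H; have [c Hc] := compl_ex Hz.
have cA : c ∈ A by case: Hc.
apply: disj_sym; apply/(complE Hz Hc sA); apply: lub => // b Hb.
by apply/(complE Hz Hc); [apply: BA|apply/disj_sym/H].
Qed.

Lemma le_of_disj w b : w ∈ A -> b ∈ A ->
  (forall v, v ≼ w -> disj v b -> is_bot A le v) -> w ≼ b.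
Proof.
move=> wA bA H; have [c Hc] := compl_ex bA; have cA : c ∈ A by case: Hc.
apply/(complE cA (compl_sym bA Hc) wA) => v Hvw Hvc; apply: H => //.
by apply/(complE bA Hc); first by case: (le_in Hvc).
Qed.

Section Ultrafilter.
Variable u : M.
Hypothesis Hu : is_ultrafilter A le u.

Lemma uf_in a : a ∈ u -> a ∈ A.
Proof. by case: Hu => H _; apply: H. Qed.

Lemma uf_up a b : a ∈ u -> a ≼ b -> b ∈ u.
Proof. by have [_ [_ [_ [H _]]]] := Hu; apply: H. Qed.

Lemma uf_meet a b : a ∈ u -> b ∈ u -> exists m, [/\ m ∈ u, m ≼ a & m ≼ b].
Proof.
move=> Ha Hb; have [m Hm] := meet_ex (uf_in Ha) (uf_in Hb).
have [_ [_ [_ [_ [H _]]]]] := Hu; exists m.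
by split; [apply: H Hm|case: Hm => _ []|case: Hm => _ [_ []]].
Qed.

Lemma uf_bot z : is_bot A le z -> ~ z ∈ u.
Proof. by have [_ [_ [H _]]] := Hu; apply: H. Qed.

Lemma uf_disj a b : a ∈ u -> b ∈ u -> ~ disj a b.
Proof. by move=> Ha Hb H; have [m [Hm H1 H2]] := uf_meet Ha Hb; apply: uf_bot (H m H1 H2) Hm. Qed.

Lemma uf_compl a : a ∈ A -> ~ a ∈ u -> exists c, c ∈ u /\ disj c a.
Proof.
move=> Ha N; have [c Hc] := compl_ex Ha.
have [_ [_ [_ [_ [_ H]]]]] := Hu; have [//|K] := H a c Ha Hc.
by exists c; split=> //; apply: compl_disj.
Qed.

Lemma uf_top t : is_top A le t -> t ∈ u.
Proof.
by move=> [_ H]; have [_ [[a Ha] _]] := Hu; apply: (uf_up Ha); apply/H/uf_in.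
Qed.

(** Typical use: an ultrafilter that contains none of finitely many elements has a member disjoint
    from all of them. *)
Lemma uf_finite (R : M -> M -> Prop) F : dfn (fun e => R (e 0) (e 1)) -> finite F ->
  (forall i a b, i ∈ F -> b ≼ a -> R i a -> R i b) ->
  (forall i, i ∈ F -> exists a, a ∈ u /\ R i a) ->
  exists a, a ∈ u /\ forall i, i ∈ F -> R i a.
Proof.
move=> HR FF Hm; apply: (finite_directed (le := fun a b => b ≼ a)) => //.
- by case: Hu => _ [].
- by move=> a b Ha Hb; have [m [? ? ?]] := uf_meet Ha Hb; exists m.
- by move=> i a b Hi _ _ Ra Hba; apply: Hm Ra.
Qed.

End Ultrafilter.

Lemma ultrafilter_ext u v : is_ultrafilter A le u -> is_ultrafilter A le v ->
  incl u v -> u = v.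
Proof.
move=> Hu Hv H; apply: incl_asym => // a Hav; apply: NNPP => N.
have [c [Hc D]] := uf_compl Hu (uf_in Hv Hav) N.
exact: (uf_disj Hv (H c Hc) Hav D).
Qed.

(** Zorn's lemma for the filters avoiding the ideal [I]. If a maximal one contained neither [a] nor
    its complement, adding either would reach [I]; then a member of the filter would lie below an
    element of [I]. *)
Lemma ultrafilter_ex I : incl I A -> (exists a, a ∈ I) ->
  (forall a b, a ≼ b -> b ∈ I -> a ∈ I) ->
  (forall a b, a ∈ I -> b ∈ I -> exists s, [/\ s ∈ I, a ≼ s & b ≼ s]) ->
  (forall t, is_top A le t -> ~ t ∈ I) ->
  exists u, is_ultrafilter A le u /\ forall a, a ∈ u -> ~ a ∈ I.
Proof.
move=> IA [i0 Hi0] Id Ij It; have [t Ht] := top_ex.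
pose ok G := t ∈ G /\ (forall a b, a ∈ G -> a ≼ b -> b ∈ G) /\
  (forall a b, a ∈ G -> b ∈ G -> exists m, m ∈ G /\ m ≼ a /\ m ≼ b) /\
  (forall a, a ∈ G -> ~ a ∈ I).
have inF G : G ∈ sep (power A) ok <-> incl G A /\ ok G by rewrite in_sep ?in_power //; dfn_auto.
have [||G [/inF [GA [Gt [Gu [Gm GI]]]] Gmax]] := @zorn M (sep (power A) ok).
{ exists (sing t); apply/inF; split; first by move=> a /in_sing ->; case: Ht.
  split; first exact/in_sing.
  split; last split.
  { by move=> a b /in_sing -> H; apply/in_sing; apply: le_anti => //; case: Ht => _; apply; case: (le_in H). }
  { move=> a b /in_sing -> /in_sing ->; exists t; split; first exact/in_sing.
    by split; apply: le_refl; case: Ht. }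
  { by move=> a /in_sing ->; apply: It. } }
{ move=> C CF [G0 HG0] Cch; apply/inF; split; first by apply: union_sub => G /CF /inF [].
  split; first by apply/in_union; exists G0; split=> //; have /inF [_ []] := CF G0 HG0.
  split; last split.
  { move=> a b /in_union [G [Ha HG]] Hab; apply/in_union; exists G; split=> //.
    by have /inF [_ [_ [H _]]] := CF G HG; apply: H Ha Hab. }
  { move=> a b /in_union [G [Ha HG]] /in_union [G' [Hb HG']].
    have [K [HK HaK HbK]] : exists K, [/\ K ∈ C, a ∈ K & b ∈ K].
      by have [H|H] := Cch G G' HG HG'; [exists G'|exists G]; split=> //; apply: H.
    have /inF [_ [_ [_ [H _]]]] := CF K HK; have [m [Hm H']] := H a b HaK HbK.
    by exists m; split=> //; apply/in_union; exists K. }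
  { by move=> a /in_union [G [Ha HG]]; have /inF [_ [_ [_ [_ H]]]] := CF G HG; apply: H. } }
(* an element that could be added to [G] without meeting [I] belongs to [G] *)
have ext_or a : a ∈ A -> a ∈ G \/ exists z g, [/\ z ∈ I, g ∈ G & forall w, w ≼ g -> w ≼ a -> w ≼ z].
  move=> Ha; apply: NNPP => N.
  pose G' := sep A (fun z => exists g, g ∈ G /\ forall w, w ≼ g -> w ≼ a -> w ≼ z).
  have inG' z : z ∈ G' <-> z ∈ A /\ exists g, g ∈ G /\ forall w, w ≼ g -> w ≼ a -> w ≼ z.
    by apply: in_sep; dfn_auto.
  have GG' : incl G G' by move=> g Hg; apply/inG'; split; [apply: GA|exists g].
  suff E : G' = G.
    by apply: N; left; rewrite -E; apply/inG'; split=> //; exists t.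
  apply: Gmax => //; apply/inF; split; first by move=> z /inG' [].
  split; first exact: GG'.
  split; last split.
  { move=> z z' /inG' [_ [g [Hg K]]] Hz; apply/inG'; split; first by case: (le_in Hz).
    by exists g; split=> // w H1 H2; apply: le_trans (K w H1 H2) Hz. }
  { move=> z z' /inG' [Hz [g [Hg K]]] /inG' [Hz' [g' [Hg' K']]].
    have [m [Hm [H1 H2]]] := Gm g g' Hg Hg'; have [n Hn] := meet_ex Hz Hz'.
    exists n; case: (Hn) => nA [nz [nz' nm]]; split=> //; apply/inG'; split=> //.
    exists m; split=> // w Hwm Hwa; apply: nm; first by case: (le_in Hwm).
      by apply: K => //; apply: le_trans Hwm H1.
    by apply: K' => //; apply: le_trans Hwm H2. }
  { by move=> z /inG' [Hz [g [Hg K]]] HzI; apply: N; right; exists z, g. }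
exists G; split=> //; split=> //; split; first by exists t.
split.
  move=> z [Hz Hb] HzG; apply: (GI z HzG); apply: (Id z i0) => //; by apply/Hb/IA.
split=> //; split.
  move=> a b m Ha Hb [mA [ma [mb H]]]; have [n [Hn [na nb]]] := Gm a b Ha Hb.
  by apply: (Gu _ _ Hn); apply: H => //; apply: GA.
move=> a c Ha Hc; have cA : c ∈ A by case: Hc.
have [|[z [g [Hz Hg K]]]] := ext_or a Ha; first by left.
have [|[z' [g' [Hz' Hg' K']]]] := ext_or c cA; first by right.
have [m [Hm [mg mg']]] := Gm g g' Hg Hg'.
have [s [Hs zs zs']] := Ij z z' Hz Hz'.
case: (GI s) => //; apply: (Gu _ _ Hm); apply: le_of_disj; [exact: GA|exact: IA|].
move=> v Hvm Dvs.
have vA : v ∈ A by case: (le_in Hvm).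
have Dva : disj v a.
  move=> w Hwv Hwa; apply: (Dvs) => //; apply: le_trans zs; apply: K => //.
  exact: (le_trans (le_trans Hwv Hvm) mg).
apply: Dvs (le_refl vA) _; apply: le_trans zs'; apply: K'; first exact: (le_trans Hvm mg').
exact/(complE Ha Hc vA).
Qed.

(** The ideal to avoid consists of the z whose meet with [a] lies below [b]. It contains [b] and
    everything disjoint from [a], but not the top. *)
Lemma ultrafilter_sep a b : a ∈ A -> b ∈ A -> ~ a ≼ b ->
  exists u, [/\ is_ultrafilter A le u, a ∈ u & ~ b ∈ u].
Proof.
move=> Ha Hb Nab.
pose I := sep A (fun z => forall w, w ≼ z -> w ≼ a -> w ≼ b).
have inI z : z ∈ I <-> z ∈ A /\ forall w, w ≼ z -> w ≼ a -> w ≼ b.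
  by apply: in_sep; dfn_auto.
have bI : b ∈ I by apply/inI.
have [|||||u [Hu K]] := @ultrafilter_ex I.
- by move=> z /inI [].
- by exists b.
- move=> x y Hxy /inI [_ H]; apply/inI; split; first by case: (le_in Hxy).
  by move=> w Hw; apply: H; apply: le_trans Hw Hxy.
- move=> x y /inI [xA Hx] /inI [yA Hy]; have [s Hs] := join_ex xA yA.
  exists s; case: (Hs) => sA [xs [ys _]]; split=> //; apply/inI; split=> // w Hws Hwa.
  have wA : w ∈ A by case: (le_in Hwa).
  apply: le_of_disj => // v Hvw Dvb; have vA : v ∈ A by case: (le_in Hvw).
  apply: (join_disj Hs vA) (le_refl vA) (le_trans Hvw Hws) => z Hzv Hz; apply: Dvb => //.
    by apply: Hx => //; apply: le_trans Hzv (le_trans Hvw Hwa).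
  by apply: Hy => //; apply: le_trans Hzv (le_trans Hvw Hwa).
- move=> t [tA Ht] /inI [_ H]; apply: Nab; apply: H (le_refl Ha); exact: Ht.
- exists u; split=> //; last by move=> /K.
  apply: NNPP => N; have [c [Hc D]] := uf_compl Hu Ha N.
  apply: (K c Hc); apply/inI; split; first exact: (uf_in Hu Hc).
  by move=> w Hwc Hwa; have [_] := D w Hwc Hwa; apply.
Qed.

Section Stone.
Variables X T : M.
Hypothesis HS : is_stone_space A le X T.

Definition cl a := sep X (fun u => a ∈ u).

Lemma in_cl a u : u ∈ cl a <-> u ∈ X /\ a ∈ u.
Proof. by apply: in_sep; dfn_auto. Qed.

Lemma stone_uf u : u ∈ X <-> is_ultrafilter A le u.
Proof. by case: HS. Qed.

Lemma stone_open U : U ∈ T <-> incl U X /\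
  forall u, u ∈ U -> exists a, a ∈ u /\ forall v, v ∈ X -> a ∈ v -> v ∈ U.
Proof. by case: HS. Qed.

Lemma cl_open a : cl a ∈ T.
Proof.
apply/stone_open; split; first by move=> u /in_cl [].
by move=> u /in_cl [Hu Ha]; exists a; split=> // v Hv Hav; apply/in_cl.
Qed.

Lemma stone_topology : is_topology X T.
Proof.
split; last split; last split.
- by move=> U /stone_open [].
- apply/stone_open; split=> // u /stone_uf Hu; have [_ [[a Ha] _]] := Hu.
  by exists a.
- move=> C V CT /is_unionE ->; apply/stone_open; split.
    by apply: union_sub => U /CT /stone_open [].
  move=> u /in_union [U [Hu HU]]; have /stone_open [_ /(_ u Hu) [a [Ha K]]] := CT U HU.
  by exists a; split=> // v Hv Hav; apply/in_union; exists U; split=> //; apply: K.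
- move=> U W J /stone_open [UX HU] /stone_open [WX HW] HJ; apply/stone_open; split.
    by move=> u /HJ [/UX].
  move=> u /HJ [uU uW]; have [a [Ha Ka]] := HU u uU; have [b [Hb Kb]] := HW u uW.
  have Hu : is_ultrafilter A le u by apply/stone_uf/UX.
  have [m [Hm ma mb]] := uf_meet Hu Ha Hb.
  exists m; split=> // v Hv Hmv; have Hv' : is_ultrafilter A le v by apply/stone_uf.
  by apply/HJ; split; [apply: Ka|apply: Kb] => //; apply: (uf_up Hv' Hmv).
Qed.

Lemma stone_separate u v : u ∈ X -> v ∈ X -> u <> v -> exists a, a ∈ u /\ ~ a ∈ v.
Proof.
move=> /stone_uf Hu /stone_uf Hv N; apply: NNPP => K; apply: N.
apply: ultrafilter_ext => // a Ha; apply: NNPP => Na; apply: K; by exists a.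
Qed.

Lemma stone_hausdorff : is_hausdorff X T.
Proof.
move=> u v HuX HvX N; have [a [Ha Na]] := stone_separate HuX HvX N.
have Hu : is_ultrafilter A le u by apply/stone_uf.
have Hv : is_ultrafilter A le v by apply/stone_uf.
have [c [Hc D]] := uf_compl Hv (uf_in Hu Ha) Na.
exists (cl a), (cl c); split; first exact: cl_open.
split; first exact: cl_open.
split; first by apply/in_cl.
split; first by apply/in_cl.
move=> z [/in_cl [/stone_uf Hz Haz] /in_cl [_ Hcz]]; exact: (uf_disj Hz Hcz Haz D).
Qed.

(* The elements covered by finitely many members of [C] form an ideal. *)
Lemma stone_compact : is_compact X T.
Proof.
move=> C CT cov.
pose P a D := incl D C /\ finite D /\ forall u, u ∈ X -> a ∈ u -> exists U, U ∈ D /\ u ∈ U.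
have P_dfn : dfn (fun e => P (e 0) (e 1)) by dfn_auto.
pose I := sep A (fun a => exists D, P a D).
have inI a : a ∈ I <-> a ∈ A /\ exists D, P a D by apply: in_sep; dfn_auto.
have [t Ht] := top_ex.
apply: NNPP => N.
have [|||||u [Hu K]] := @ultrafilter_ex I.
- by move=> z /inI [].
- have [o Ho] := bot_ex; exists o; apply/inI; split; first by case: Ho.
  exists emptyset; split; first by move=> z /in_empty.
  split; first exact: finite_empty.
  by move=> u /stone_uf Hu Hou; case: (uf_bot Hu Ho).
- move=> a b Hab /inI [_ [D [DC [FD HD]]]]; apply/inI; split; first by case: (le_in Hab).
  exists D; split=> //; split=> // u Hu Hau; apply: HD => //.
  by apply: (uf_up _ Hau Hab); apply/stone_uf.
- move=> a b /inI [aA [D [DC [FD HD]]]] /inI [bA [D' [DC' [FD' HD']]]].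
  have [s Hs] := join_ex aA bA; exists s; case: (Hs) => sA [as' [bs _]].
  split=> //; apply/inI; split=> //; exists (cup D D'); split.
    by move=> U /in_cup [/DC|/DC'].
  split; first exact: finite_cup.
  move=> u HuX Hsu; have Hu : is_ultrafilter A le u by apply/stone_uf.
  case: (classic (a ∈ u)) => [/(HD u HuX) [U [HU HuU]]|Na].
    by exists U; split=> //; apply/in_cup; left.
  case: (classic (b ∈ u)) => [/(HD' u HuX) [U [HU HuU]]|Nb].
    by exists U; split=> //; apply/in_cup; right.
  have [c [Hc Dc]] := uf_compl Hu aA Na; have [d [Hd Dd]] := uf_compl Hu bA Nb.
  have [m [Hm mc md]] := uf_meet Hu Hc Hd.
  case: (uf_disj Hu Hm Hsu); apply: (join_disj Hs (uf_in Hu Hm)).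
    exact: (disj_le mc (le_refl aA) Dc).
  exact: (disj_le md (le_refl bA) Dd).
- move=> t' Ht' /inI [_ [D [DC [FD HD]]]]; apply: N; exists D; split=> //; split=> // u HuX.
  by apply: HD => //; apply: uf_top Ht'; apply/stone_uf.
- have HuX : u ∈ X by apply/stone_uf.
  have [U [HU HuU]] := cov u HuX.
  have /stone_open [_ /(_ u HuU) [a [Ha Ka]]] := CT U HU.
  apply: (K a Ha); apply/inI; split; first exact: (uf_in Hu Ha).
  exists (sing U); split; first by move=> z /in_sing ->.
  split; first exact: finite_upair.
  by move=> v Hv Hav; exists U; split; [apply/in_sing|apply: Ka].
Qed.

Lemma stone_compact_hausdorff : compact_hausdorff X T.
Proof. split; [exact: stone_topology|split; [exact: stone_compact|exact: stone_hausdorff]]. Qed.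

End Stone.

Lemma stone_ex : exists X T, is_stone_space A le X T.
Proof.
pose X := sep (power A) (is_ultrafilter A le).
have inX u : u ∈ X <-> is_ultrafilter A le u.
  by rewrite in_sep ?in_power; [dfn_auto|split=> [[]|H] //; split=> //; case: H].
pose T := sep (power X) (fun U => forall u, u ∈ U ->
  exists a, a ∈ u /\ forall v, v ∈ X -> a ∈ v -> v ∈ U).
exists X, T; split=> // U; rewrite in_sep ?in_power //; dfn_auto.
Qed.

End BooleanAlgebra.

(** * The weight of the Stone space, and copies of beta omega in it *)

Section StoneWeight.
Context {M : zmodel} (A le X T k : M).
Implicit Types (x y z a b c s t u v w m n f g h i B C D F Y Z U W : M).
Hypothesis HBA : is_boolean_algebra A le.
Hypothesis HS : is_stone_space A le X T.
Hypothesis Hk : is_omega1 k.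
Hypothesis HAk : equinumerous A k.

Let cl := @cl M X.

Lemma dterm_cl (t : (nat -> M) -> M) : dterm t -> dterm (fun e => cl (t e)).
Proof.
apply: dterm_op1.
apply: (@dfn_ext _ _ (fun e => forall u, u ∈ e 0 <-> u ∈ X /\ e 1 ∈ u)).
  move=> e; split=> [-> u|H]; first exact: in_cl.
  by apply: ext => u; rewrite in_cl.
by dfn_auto.
Qed.

Ltac dfn_hook ::= first
  [ apply dterm_upair | apply dterm_sing | apply dterm_opair | apply dterm_union
  | apply dterm_power | apply dterm_cup | apply dterm_adj | apply dterm_succ
  | apply dterm_ap | apply dfn_app | apply dterm_cl ].

Lemma cl_le a b : a ∈ A -> b ∈ A -> incl (cl a) (cl b) -> app le a b.
Proof.
move=> Ha Hb H; apply: NNPP => N; have [u [Hu Hau Nb]] := ultrafilter_sep HBA Ha Hb N.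
apply: Nb; have Hux : u ∈ X by apply/(stone_uf HS).
by have /in_cl [] : u ∈ cl b by apply: H; apply/in_cl.
Qed.

Lemma cl_inj a b : a ∈ A -> b ∈ A -> cl a = cl b -> a = b.
Proof.
move=> Ha Hb E; apply: (le_anti HBA).
  by apply: cl_le => //; rewrite E; exact: incl_refl.
by apply: cl_le => //; rewrite E; exact: incl_refl.
Qed.

Lemma algebra_uncountable : ~ countable A.
Proof.
move=> H; have [_ [N _]] := Hk; apply: N.
exact: (countable_injects H (equi_injects (equi_sym HAk))).
Qed.

Lemma finite_countable F : finite F -> countable F.
Proof.
move=> /finiteE [n [Hn /equi_injects E]]; apply/countableE; apply: (injects_trans E).
by apply: injects_incl => x; apply: om_trans.
Qed.

Lemma stone_infinite : ~ finite X.
Proof.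
move=> FX; apply: algebra_uncountable; apply: finite_countable.
apply: (finite_injects (finite_power FX)).
apply: (@injects_intro _ (fun a U => U = cl a)); first by dfn_auto.
  by move=> a Ha; exists (cl a); split=> //; apply/in_power => u /in_cl [].
by move=> a b U Ha Hb _ ->; apply: cl_inj.
Qed.

Lemma stone_clopen_base : exists B, is_base X T B /\ equinumerous B k.
Proof.
pose B := sep T (fun U => exists a, a ∈ A /\ U = cl a).
have inB U : U ∈ B <-> exists a, a ∈ A /\ U = cl a.
  rewrite in_sep; first by dfn_auto.
  split=> [[]//|H]; split=> //; move: H => [a [_ ->]]; exact: (cl_open HS).
exists B; split; first split.
{ by move=> U /inB [a [_ ->]]; exact: (cl_open HS). }
{ move=> U u HU Hu; have /(stone_open HS) [HUX /(_ u Hu) [a [Ha K]]] := HU.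
  have Huu : is_ultrafilter A le u by apply/(stone_uf HS)/HUX.
  exists (cl a); split; first by apply/inB; exists a; split=> //; exact: (uf_in Huu Ha).
  split; first by apply/in_cl; split=> //; apply: HUX.
  by move=> v /in_cl [Hv Hav]; apply: K. }
apply: equi_trans HAk; apply: equi_sym.
apply: (@equi_intro _ (fun a U => U = cl a)); first by dfn_auto.
- by move=> a Ha; exists (cl a); split=> //; apply/inB; exists a.
- by move=> U /inB.
- by move=> a b U Ha Hb _ ->; apply: cl_inj.
- by move=> a U U' _ _ _ -> ->.
Qed.

(* A countable base [B] would exhaust the algebra by the finite sets of those [a] for which
   [cl a] is a union of members of [B] of index less than [n]. *)
Lemma stone_base_uncountable B : is_base X T B -> ~ countable B.
Proof.
move=> [BT HB] /countableE [h [Hh /(injE Hh) Ih]]; apply: algebra_uncountable.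
have [g [Hg [/(injE Hg) Ig _]]] := HAk.
pose R n a := forall u, u ∈ cl a ->
  exists U, U ∈ B /\ ap h U ∈ n /\ u ∈ U /\ incl U (cl a).
have R_dfn : dfn (fun e => R (e 0) (e 1)) by dfn_auto.
have [[Ok _] _] := Hk.
apply: (@countable_union_chain _ R (fun a b => ap g a ∈ ap g b)) => //.
- by dfn_auto.
- move=> n a Hn H u /H [U [HU [Hn' HU']]]; exists U; split=> //; split=> //; exact: mem_succ.
- move=> a Ha.
  (* Members of the base inside [cl a], together with the open sets off [cl a]: a finite subcover
     involves only finitely many indices of the base. *)
  pose C := sep T (fun U => (U ∈ B /\ incl U (cl a)) \/ forall u, u ∈ U -> ~ a ∈ u).
  have inC U : U ∈ C <-> U ∈ T /\ ((U ∈ B /\ incl U (cl a)) \/ forall u, u ∈ U -> ~ a ∈ u).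
    by apply: in_sep; dfn_auto.
  have [||D [DC [FD HD]]] := stone_compact HBA HS (C := C).
  { by move=> U /inC []. }
  { move=> u Hu; case: (classic (a ∈ u)) => [Hau|N].
      have Huc : u ∈ cl a by apply/in_cl.
      have [W [HW [HuW HWa]]] := HB _ _ (cl_open HS a) Huc.
      by exists W; split=> //; apply/inC; split; [apply: BT|left].
    have Huu : is_ultrafilter A le u by apply/(stone_uf HS).
    have [c [Hc Dc]] := uf_compl HBA Huu Ha N.
    exists (cl c); split; last by apply/in_cl.
    apply/inC; split; first exact: (cl_open HS); right=> v /in_cl [/(stone_uf HS) Hv Hcv] Hav.
    exact: (uf_disj HBA Hv Hcv Hav Dc). }
  have [||||n [Hn Kn]] := @finite_bound M (fun U n => U ∈ B -> ap h U ∈ n) D.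
  { by dfn_auto. }
  { by []. }
  { by move=> U n m _ Hm K Hnm HU; apply: nat_lt_le_trans (K HU) Hnm. }
  { move=> U _; case: (classic (U ∈ B)) => HU; last by exists emptyset; split=> //; exact: om_zero.
    exists (succ (ap h U)); split; first exact/om_succ/(ap_in Hh).
    by move=> _; exact: self_succ. }
  exists n; split=> // u /in_cl [Hu Hau]; have [U [HU HuU]] := HD u Hu.
  have /inC [_ [[HUB HUa]|H]] := DC U HU; last by case: (H u).
  by exists U; split=> //; split; [apply: Kn|].
- move=> n Hn; apply: (finite_injects (finite_power (finite_nat Hn))).
  (* Once [R n a] holds, [cl a] is recovered from the set of those indices below n whose base
     members lie inside it. *)
  apply: (@injects_intro _ (fun a s => forall m, m ∈ s <-> m ∈ n /\
    exists U, U ∈ B /\ m = ap h U /\ incl U (cl a))); first by dfn_auto.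
  + move=> a _; exists (sep n (fun m => exists U, U ∈ B /\ m = ap h U /\ incl U (cl a))).
    have E m : m ∈ sep n (fun m => exists U, U ∈ B /\ m = ap h U /\ incl U (cl a)) <->
      m ∈ n /\ exists U, U ∈ B /\ m = ap h U /\ incl U (cl a) by apply: in_sep; dfn_auto.
    by split=> //; apply/in_power => m /E [].
  + have half a b s : R n a -> (forall m, m ∈ s <-> m ∈ n /\
        exists U, U ∈ B /\ m = ap h U /\ incl U (cl a)) ->
      (forall m, m ∈ s <-> m ∈ n /\ exists U, U ∈ B /\ m = ap h U /\ incl U (cl b)) ->
      incl (cl a) (cl b).
      move=> Ra Sa Sb u /Ra [U [HU [Hn' [HuU HUa]]]].
      have /Sb [_ [U' [HU' [E HUb]]]] : ap h U ∈ s by apply/Sa; split=> //; exists U.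
      by apply: HUb; rewrite -(Ih U U').
    move=> a b s; rewrite !in_sep; [by dfn_auto..|] => -[Ha Ra] [Hb Rb] _ Sa Sb.
    apply: (le_anti HBA); apply: cl_le => //; [exact: (half a b s)|exact: (half b a s)].
- by move=> a; exact: mem_irrefl.
- move=> a b c _ _ Hc Hab Hbc; exact: (ord_trans (ord_in Ok (ap_in Hg Hc)) Hbc Hab).
- move=> a b Ha Hb.
  have [H|[H|H]] := ord_total (ord_in Ok (ap_in Hg Ha)) (ord_in Ok (ap_in Hg Hb)); try tauto.
  by right; left; apply: Ig.
Qed.

Lemma stone_weight : has_weight X T k.
Proof.
split; first exact: stone_clopen_base.
move=> B HB; have [[Ok _] _] := Hk.
have [//|[a [Ha HBa]]] := ord_compare B Ok.
by case: (stone_base_uncountable HB); apply: countable_injects HBa; apply: omega1_elt Ha.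
Qed.

Lemma cantor Y : ~ injects (power Y) Y.
Proof.
move=> [f [Hf /(injE Hf) If]].
pose Z := sep Y (fun y => exists S, S ∈ power Y /\ y = ap f S /\ ~ y ∈ S).
have inZ y : y ∈ Z <-> y ∈ Y /\ exists S, S ∈ power Y /\ y = ap f S /\ ~ y ∈ S.
  by apply: in_sep; dfn_auto.
have HZ : Z ∈ power Y by apply/in_power => y /inZ [].
have HfZ := ap_in Hf HZ.
have N : ~ ap f Z ∈ Z.
  move=> K; have /inZ [_ [S [HS' [E]]]] := K; apply.
  by rewrite (If S Z HS' HZ).
by apply: (N); apply/inZ; split=> //; exists Z.
Qed.

(** The reverse injection comes from [ord_compare]: otherwise [power om] would inject into a
    countable ordinal, against Cantor. *)
Lemma CH_intro : injects (power om) k -> CH M.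
Proof.
move=> H; exists om, (power om); rewrite is_omegaE is_powerE; split=> //; split=> //.
exists k; split=> //; apply: cantor_bernstein => //.
have [[Ok _] _] := Hk.
have [//|[a [Ha HBa]]] := ord_compare (power om) Ok.
case: (@cantor om); apply/countableE.
by apply: countable_injects HBa; apply: omega1_elt Ha.
Qed.

Lemma finite_compact Y : finite Y -> is_compact Y (power Y).
Proof.
move=> FY C CP cov.
have [||f [Hf Kf]] := @choice M (fun y U => y ∈ U) Y C.
{ by dfn_auto. }
{ by move=> y /cov. }
pose D := sep C (fun U => exists y, y ∈ Y /\ U = ap f y).
have inD U : U ∈ D <-> U ∈ C /\ exists y, y ∈ Y /\ U = ap f y by apply: in_sep; dfn_auto.
exists D; split; first by move=> U /inD [].
split.
  apply: (@finite_image _ (fun y U => U = ap f y) Y) => //; first by dfn_auto.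
    by move=> U /inD [].
  by move=> y U U' -> ->.
move=> y Hy; exists (ap f y); split; last exact: Kf.
by apply/inD; split; [apply: ap_in Hf Hy|exists y].
Qed.

Lemma discrete_compact_hausdorff Y : finite Y -> compact_hausdorff Y (power Y).
Proof.
move=> FY; split; last split; last 1 first.
- move=> x y Hx Hy N; exists (sing x), (sing y).
  split; first by apply/in_power => z /in_sing ->.
  split; first by apply/in_power => z /in_sing ->.
  split; first exact/in_sing.
  split; first exact/in_sing.
  by move=> z [/in_sing -> /in_sing].
- split; first by move=> U /in_power.
  split; first exact/in_power/incl_refl.
  split; first by move=> C u CP /is_unionE ->; apply/in_power/union_sub => U /CP /in_power.
  by move=> U W I /in_power HU _ HI; apply/in_power => x /HI [/HU].
- exact: finite_compact.
Qed.

(* For a copy [h] of [beta omega], sending [a] to the trace [{n | a ∈ h n}] is onto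
   [power om]: a clopen partition of [beta omega] is separated by an element of the algebra. *)
Lemma stone_no_beta_omega : ~ CH M -> ~ exists B S h, is_beta_omega B S /\ embedding h B S X T.
Proof.
move=> NCH [B [S [h [[[Btop [Bcomp Bhd]] [o [P [i [/is_omegaE -> [/is_powerE -> [emb_i [_ univ]]]]]]]] [Hh [_ Hemb]]]]]].
have [Hi [Ii _]] := emb_i.
apply: NCH; apply: CH_intro.
have trace s : s ∈ power om -> exists a, a ∈ A /\
    forall n, n ∈ om -> n ∈ s <-> a ∈ ap h (ap i n).
  move=> /in_power Hs.
  (* The test space for the universal property is the discrete space {0,1}: the characteristic
     function of [s] extends to [F], whose fibres are the open sets [U0] and [U1]. *)
  pose zero := emptyset : M; pose one := succ zero; pose two := upair zero one.
  have N01 : zero <> one by move=> E; have := self_succ zero; rewrite -/one -E => /in_empty.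
  have Htwo : compact_hausdorff two (power two).
    exact/discrete_compact_hausdorff/finite_upair.
  have [||f [Hf Kf]] := @choice M (fun n v => (n ∈ s /\ v = one) \/ (~ n ∈ s /\ v = zero)) om two.
  { by dfn_auto. }
  { move=> n _; case: (classic (n ∈ s)) => Hn; [exists one|exists zero]; rewrite in_upair; tauto. }
  have [|F [[HF Fcont] KF]] := univ two (power two) f Htwo.
    split=> // W _; exists (sep om (fun n => exists y, app f n y /\ y ∈ W)).
    split; first by apply/in_power => n; rewrite in_sep; [dfn_auto|case].
    by move=> n; rewrite in_sep; [dfn_auto|].
  have pre v : v ∈ two -> exists U, U ∈ S /\ forall b, b ∈ U <-> b ∈ B /\ ap F b = v.
    move=> Hv; have [|U [HU KU]] := Fcont (sing v).
      by apply/in_power => z /in_sing ->.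
    exists U; split=> // b; rewrite KU; split=> -[Hb K]; split=> //.
      by move: K => [y [/(funE _ _ HF) [_ ->] /in_sing ->]].
    by exists v; rewrite (funE _ _ HF) in_sing.
  have two0 : zero ∈ two by apply/in_upair; left.
  have two1 : one ∈ two by apply/in_upair; right.
  have [U0 [HU0 K0]] := pre zero two0; have [U1 [HU1 K1]] := pre one two1.
  have /Hemb [W [HW KW]] := HU1.
  have KW' b : b ∈ U1 <-> b ∈ B /\ ap h b ∈ W.
    rewrite KW; split=> -[Hb K]; split=> //.
      by move: K => [y [/(funE _ _ Hh) [_ ->]]].
    by exists (ap h b); rewrite (funE _ _ Hh).
  (* [W] is an open set of the Stone space that traces [U1] on the copy; preimages of the clopen
     sets inside [W] cover [U1]. *)
  pose small a := a ∈ A /\ forall u, u ∈ X -> a ∈ u -> u ∈ W.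
  pose C := sep S (fun U => U = U0 \/ exists a, small a /\ forall b, b ∈ U -> a ∈ ap h b).
  have inC U : U ∈ C <-> U ∈ S /\ (U = U0 \/ exists a, small a /\ forall b, b ∈ U -> a ∈ ap h b).
    by apply: in_sep; dfn_auto.
  have [||D [DC [FD HD]]] := Bcomp C.
  { by move=> U /inC []. }
  { move=> b Hb; have /in_upair [E|E] := ap_in HF Hb.
      by exists U0; split; [apply/inC; split; [|left]|apply/K0].
    have bU1 : b ∈ U1 by apply/K1.
    have /KW' [_ HhW] := bU1.
    have /(stone_open HS) [_ /(_ _ HhW) [a [Ha Ka]]] := HW.
    have [U [HU KU]] : exists U, U ∈ S /\ is_preimage h B (cl a) U.
      exists (sep B (fun b => exists y, app h b y /\ y ∈ cl a)).
      have E' : is_preimage h B (cl a) (sep B (fun b => exists y, app h b y /\ y ∈ cl a)).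
        by move=> x; apply: in_sep; dfn_auto.
      by split=> //; apply/Hemb; exists (cl a); split=> //; exact: (cl_open HS).
    have hX : ap h b ∈ X by exact: (ap_in Hh Hb).
    exists U; split; last first.
      apply/KU; split=> //; exists (ap h b); rewrite (funE _ _ Hh); split=> //.
      by apply/in_cl.
    apply/inC; split=> //; right; exists a; split.
      by split=> //; apply: (uf_in (A := A) (le := le)) Ha; apply/(stone_uf HS).
    by move=> c /KU [_ [y [/(funE _ _ Hh) [_ ->] /in_cl []]]]. }
  have [o' Ho'] := bot_ex HBA.
  pose SM := sep A small.
  have inSM a : a ∈ SM <-> small a by rewrite in_sep; [dfn_auto|rewrite /small; tauto].
  (* A join of small elements is small, so a single small [a] serves all members of the finite
     subcover other than [U0]. *)
  have [||||||a [/inSM [HaA Ha] Ka]] := @finite_directed M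
    (fun U a => U = U0 \/ forall b, b ∈ U -> b ∈ B -> a ∈ ap h b) (app le) D SM.
  { by dfn_auto. }
  { by []. }
  { exists o'; apply/inSM; split; first by case: Ho'.
    by move=> u /(stone_uf HS) Hu /(uf_bot Hu Ho'). }
  { move=> a b /inSM [aA Ka] /inSM [bA Kb]; have [j Hj] := join_ex HBA aA bA.
    case: (Hj) => jA [aj [bj _]]; exists j; split=> //; apply/inSM; split=> // u Hu Hju.
    have Huu : is_ultrafilter A le u by apply/(stone_uf HS).
    case: (classic (a ∈ u)) => [|Na]; first exact: Ka.
    case: (classic (b ∈ u)) => [|Nb]; first exact: Kb.
    have [c [Hc Dc]] := uf_compl HBA Huu aA Na; have [d [Hd Dd]] := uf_compl HBA Huu bA Nb.
    have [m [Hm mc md]] := uf_meet HBA Huu Hc Hd.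
    case: (uf_disj HBA Huu Hm Hju); apply: (join_disj HBA Hj (uf_in Huu Hm)).
      exact: (disj_le HBA mc (le_refl HBA aA) Dc).
    exact: (disj_le HBA md (le_refl HBA bA) Dd). }
  { move=> U a b _ _ _ [->|H] Hab; [by left|right=> c Hc HcB].
    have Huu : is_ultrafilter A le (ap h c) by apply/(stone_uf HS)/(ap_in Hh HcB).
    exact: (uf_up Huu (H c Hc HcB) Hab). }
  { move=> U /DC /inC [_ [->|[a [Ha K]]]].
      exists o'; split; last by left.
      apply/inSM; split; first by case: Ho'.
      by move=> u /(stone_uf HS) Hu /(uf_bot Hu Ho').
    by exists a; split; [apply/inSM|right=> b /K]. }
  exists a; split=> // n Hn; have HinB := ap_in Hi Hn.
  have EF : ap F (ap i n) = ap f n.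
    have := KF n (ap i n) (ap f n); rewrite (funE _ _ Hi) (funE _ _ Hf) (funE _ _ HF).
    by case.
  split=> [Hns|Han].
    have [U [HU HiU]] := HD _ HinB.
    have [EU|H] := Ka U HU; last exact: H.
    move: HiU; rewrite EU K0 EF => -[_ E0].
    by case: (Kf n Hn) => [[_ E1]|[//]]; case: N01; rewrite -E0.
  have hW : ap h (ap i n) ∈ W by apply: Ha => //; apply: ap_in Hh _.
  have /K1 [_] : ap i n ∈ U1 by apply/KW'.
  by rewrite EF; case: (Kf n Hn) => [[//]|[_ ->]] /N01.
apply: (injects_trans _ (equi_injects HAk)).
apply: (@injects_intro _ (fun s a => forall n, n ∈ om -> n ∈ s <-> a ∈ ap h (ap i n))).
- by dfn_auto.
- exact: trace.
- move=> s s' a /in_power Hs /in_power Hs' _ K K'; apply: ext => n; split=> Hn.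
    by apply/K'; [apply: Hs|apply/K => //; apply: Hs].
  by apply/K; [apply: Hs'|apply/K' => //; apply: Hs'].
Qed.

End StoneWeight.

(** * Dyadic rationals and binary digits *)

Section Dyadic.
Context {M : zmodel}.
Implicit Types (x y z a b c s t u v w m n f g h i j k p q r B C D F Y Z U W : M).

(* A non-empty finite [p ⊂ omega] stands for the number with binary digits [p]. *)
Definition dyadic := sep (power om) (fun p => finite p /\ exists x : M, x ∈ p).

(** The numerical order of binary expansions, digit 0 being the most significant. *)
Definition lex p q := exists n, n ∈ q /\ ~ n ∈ p /\ forall m, m ∈ n -> m ∈ p <-> m ∈ q.

Definition dyadic_lt := sep (prod dyadic dyadic) (fun z => exists p q, z = opair p q /\ lex p q).

Lemma in_dyadic p : p ∈ dyadic <-> incl p om /\ finite p /\ exists x, x ∈ p.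
Proof. by rewrite in_sep ?in_power //; dfn_auto. Qed.

Lemma dyadic_ltE p q : app dyadic_lt p q <-> [/\ p ∈ dyadic, q ∈ dyadic & lex p q].
Proof.
rewrite appE in_sep; first by dfn_auto.
rewrite opair_prod; split=> [[[Hp Hq] [p' [q' [/opair_inj [E E'] H]]]]|[Hp Hq H]].
  by subst p' q'.
by split=> //; exists p, q.
Qed.

Lemma lex_irrefl p : ~ lex p p.
Proof. by move=> [n [Hn [N _]]]. Qed.

Lemma lex_trans p q r : incl r om -> incl q om -> lex p q -> lex q r -> lex p r.
Proof.
move=> Hr Hq [n [nq [np Kn]]] [m [mr [mq Km]]].
have Hn := Hq _ nq; have Hm := Hr _ mr.
have [H|[H|H]] := nat_total Hn Hm.
- exists n; split; first by apply/Km.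
  split=> // l Hl; rewrite Kn //; apply: Km; exact: (nat_trans Hm H Hl).
- by case: mq; rewrite -H.
- exists m; split=> //; split; first by rewrite Kn.
  by move=> l Hl; rewrite -Km //; apply: Kn; exact: (nat_trans Hn H Hl).
Qed.

Lemma lex_total p q : incl p om -> incl q om -> lex p q \/ p = q \/ lex q p.
Proof.
move=> Hp Hq; case: (classic (p = q)) => [->|N]; first by right; left.
have [||n [Hn [D K]]] := @nat_least M (fun n => ~ (n ∈ p <-> n ∈ q)).
{ by dfn_auto. }
{ apply: NNPP => N'; apply: N; apply: ext => z; apply: NNPP => K; apply: N'; exists z.
  split=> //; apply: NNPP => K'; apply: K; split=> H; case: K'; [exact: Hp|exact: Hq]. }
have {}K m : m ∈ n -> m ∈ p <-> m ∈ q by move=> Hm; apply: NNPP; apply: K.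
case: (classic (n ∈ p)) => H; [right; right|left]; exists n; split=> //; try tauto.
split; first tauto.
by move=> m /K; tauto.
Qed.

Lemma in_dyadic_adj p n : p ∈ dyadic -> n ∈ om -> adj p n ∈ dyadic.
Proof.
move=> /in_dyadic [Hp [Fp [x Hx]]] Hn; apply/in_dyadic; split.
  by move=> z /in_adj [/Hp|->].
by split; [apply: finite_adj|exists x; apply/in_adj; left].
Qed.

Lemma lex_adj p n : ~ n ∈ p -> lex p (adj p n).
Proof.
move=> N; exists n; split; first by apply/in_adj; right.
split=> // m Hm; rewrite in_adj; split=> [|[//|E]]; first by left.
by move: Hm; rewrite E => /mem_irrefl.
Qed.

(** Take [k] beyond all digits of [p] and beyond the first difference from [q]. Besides density, the
    freedom in [j] leaves room to place a digit pattern between [p] and [q]. *)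
Lemma lex_dense p q : p ∈ dyadic -> q ∈ dyadic -> lex p q ->
  exists k, [/\ k ∈ om, incl p k & forall j, j ∈ om -> k ∈ succ j -> lex (adj p j) q].
Proof.
move=> /in_dyadic [Hp [Fp _]] /in_dyadic [Hq _] [n [nq [np Kn]]]; have Hn := Hq _ nq.
have [l [Hl Kl]] := finite_om_bounded Fp Hp.
have [k [Hk [Hlk Hnk]]] := nat_max Hl (om_succ Hn).
exists k; split=> //.
  by move=> z /Kl Hz; exact: (nat_lt_le_trans Hk Hz Hlk).
move=> j Hj Hkj; have Hnj : n ∈ j.
  by apply: (nat_lt_le_trans Hj (self_succ n)); exact: (nat_le_trans Hj Hnk Hkj).
have Nj m : m ∈ succ n -> m <> j.
  by move=> Hm E; have := nat_le_lt_trans Hj Hm Hnj; rewrite E => /mem_irrefl.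
exists n; split=> //; split.
  by move=> /in_adj [//|]; apply: Nj; exact: self_succ.
move=> m Hm; rewrite in_adj Kn //; split=> [[//|/Nj]|]; last by left.
by case; exact: mem_succ.
Qed.

Lemma countable_dyadic : countable dyadic.
Proof.
apply: (@countable_union_chain _ (fun n p => incl p n) lex).
- by dfn_auto.
- by dfn_auto.
- by move=> n p _ H x /H; exact: mem_succ.
- move=> p /in_dyadic [Hp [Fp _]]; exact: finite_om_bounded.
- move=> n Hn; apply: (finite_sub (finite_power (finite_nat Hn))) => p.
  by rewrite in_sep ?in_power; [dfn_auto|case].
- exact: lex_irrefl.
- by move=> p q r _ /in_dyadic [Hq _] /in_dyadic [Hr _]; apply: lex_trans.
- by move=> p q /in_dyadic [Hp _] /in_dyadic [Hq _]; apply: lex_total.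
Qed.

Lemma dyadic_rationals : is_rationals dyadic dyadic_lt.
Proof.
split.
  exists (sing emptyset); apply/in_dyadic; split; first by move=> z /in_sing ->; exact: om_zero.
  by split; [apply: finite_upair|exists emptyset; apply/in_sing].
split; first exact: countable_dyadic.
split.
  move=> z; rewrite in_sep; first by dfn_auto.
  by move=> [/in_prod [p [q [Hp [Hq E]]]] _]; exists p, q; rewrite is_opairE.
split; first by move=> p /dyadic_ltE [_ _ /lex_irrefl].
split.
  move=> p q r /dyadic_ltE [Hp Hq H] /dyadic_ltE [_ Hr H']; apply/dyadic_ltE; split=> //.
  have /in_dyadic [Hq' _] := Hq; have /in_dyadic [Hr' _] := Hr; exact: (lex_trans Hr' Hq' H H').
split.
  move=> p q Hp Hq; have /in_dyadic [Hp' _] := Hp; have /in_dyadic [Hq' _] := Hq.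
  by rewrite !dyadic_ltE; have [H|[H|H]] := lex_total Hp' Hq'; [left|right; left|right; right].
split.
  move=> p q /dyadic_ltE [Hp Hq H]; have [k [Hk Hpk K]] := lex_dense Hp Hq H.
  have Hpk' := in_dyadic_adj Hp Hk.
  exists (adj p k); split; apply/dyadic_ltE; split=> //.
    by apply: lex_adj => /Hpk /mem_irrefl.
  by apply: K => //; exact: self_succ.
(* Below [p] lies the single digit following the first digit of [p]; above it, [p] with one digit
   added beyond its last. *)
move=> p Hp; have /in_dyadic [Hp' [Fp [x Hx]]] := Hp; split.
  have [||n [Hn [nP Kn]]] := @nat_least M (fun n => n ∈ p).
  { by dfn_auto. }
  { by exists x; split=> //; apply: Hp'. }
  exists (sing (succ n)); apply/dyadic_ltE; split=> //.
    apply/in_dyadic; split; first by move=> z /in_sing ->; exact: om_succ.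
    by split; [apply: finite_upair|exists (succ n); apply/in_sing].
  have Nn : n <> succ n by move=> E; have := self_succ n; rewrite -E => /mem_irrefl.
  exists n; split=> //; split; first by move=> /in_sing.
  move=> m Hm; split; last by move/(Kn _ Hm).
  by move=> /in_sing E; move: Hm; rewrite E => /(mem_asym (self_succ n)).
have [l [Hl Kl]] := finite_om_bounded Fp Hp'.
exists (adj p l); apply/dyadic_ltE; split=> //; first exact: in_dyadic_adj.
by apply: lex_adj => /Kl /mem_irrefl.
Qed.

(* [bit X i]: the digit [i] of the supremum of [X] is 1. The witness [r] consists of the
   digits before [i]. *)
Definition bit (X : M -> Prop) i := exists r, r ∈ dyadic /\ incl r i /\ X (adj r i) /\
  forall r', r' ∈ dyadic -> incl r' i -> app dyadic_lt r r' -> ~ X r'.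

Section Bits.
Variables (X : M -> Prop) (p k j : M).
Hypotheses (Hp : p ∈ dyadic) (Hk : k ∈ om) (Hj : j ∈ om) (Hpk : incl p k) (Hkj : k ∈ succ j).
Hypothesis HX : forall q r, X r -> app dyadic_lt q r -> X q.
Hypotheses (H1 : X (adj p (succ j))) (H0 : ~ X (adj p j)).

Let sub_nat i : i ∈ om -> k ∈ succ i -> incl p i.
Proof. by move=> Hi Hki z /Hpk Hz; exact: (nat_lt_le_trans Hi Hz Hki). Qed.

(** The digits before j+1 are those of [p]: a larger [r] with digits up to [j] is at least p ∪ {j},
    which is outside the cut. *)
Lemma bit_one : bit X (succ j).
Proof.
have pj := sub_nat Hj Hkj.
exists p; split=> //; split; first by move=> z /pj; exact: mem_succ.
split=> // r Hr Hrj /dyadic_ltE [_ _ [n [nr [np Kn]]]] Xr; apply: H0.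
have Hpj := in_dyadic_adj Hp Hj.
have /in_succ [Hn|E] := Hrj _ nr.
  apply: (HX Xr); apply/dyadic_ltE; split=> //; exists n; split=> //; split.
    by move=> /in_adj [//|E]; move: Hn; rewrite E => /mem_irrefl.
  move=> m Hm; rewrite in_adj Kn //; split=> [[//|E]|]; last by left.
  by move: (mem_asym Hn); rewrite -E.
suff <- : r = adj p j by [].
subst n; apply: ext => z; rewrite in_adj; split=> [Hz|[Hz|->] //].
  by have /in_succ [Hzj|->] := Hrj _ Hz; [left; apply/Kn|right].
by apply/Kn => //; apply: pj.
Qed.

(** Compare a witness [r] with [p]. If r < p, then [p], being in the cut, contradicts the maximality
    of [r]; otherwise r ∪ {i} is at least p ∪ {j}, which would then be in the cut. *)
Lemma bit_zero i : k ∈ succ i -> i ∈ succ j -> ~ bit X i.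
Proof.
move=> Hki Hij [r [Hr [Hri [Xri Hmax]]]].
have Hi := om_trans (om_succ Hj) Hij; have pi := sub_nat Hi Hki; have pj := sub_nat Hj Hkj.
have Hpj := in_dyadic_adj Hp Hj.
have Xp : X p.
  apply: (HX H1); apply/dyadic_ltE; split=> //; first exact/(in_dyadic_adj Hp)/om_succ.
  by apply: lex_adj => /pj Hs; move: (mem_asym Hs); apply; exact: self_succ.
have /in_dyadic [Hp' _] := Hp; have /in_dyadic [Hr' _] := Hr.
have [L|[E|L]] := lex_total Hr' Hp'.
- by apply: (Hmax p) => //; apply/dyadic_ltE.
- subst r; move: Hij => /in_succ [Hij|E]; last by apply: H0; rewrite -E.
  apply: H0; apply: (HX Xri); apply/dyadic_ltE; split=> //; first exact: in_dyadic_adj.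
  exists i; split; first by apply/in_adj; right.
  split; first by move=> /in_adj [/pi /mem_irrefl|E] //; move: Hij; rewrite E => /mem_irrefl.
  move=> m Hm; rewrite !in_adj; split=> -[|E]; try by left.
    by move: (mem_asym Hij); rewrite -E.
  by move: Hm; rewrite E => /mem_irrefl.
- apply: H0; apply: (HX Xri); apply/dyadic_ltE; split=> //; first exact: in_dyadic_adj.
  move: L => [n [nr [np Kn]]]; have Hni := Hri _ nr.
  have Hnj := nat_lt_le_trans Hj Hni Hij.
  exists n; split; first by apply/in_adj; left.
  split; first by move=> /in_adj [//|E]; move: Hnj; rewrite E => /mem_irrefl.
  move=> m Hm; rewrite !in_adj Kn //; split=> -[|E]; try by left.
    by move: (mem_asym Hnj); rewrite -E.
  by move: (mem_asym Hni); rewrite -E.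
Qed.

End Bits.

End Dyadic.

Arguments dyadic {M}.
Arguments dyadic_lt {M}.

(** * Absoluteness *)

(** By unification, everything proved for a [zmodel] applies inside the extension. *)
Canonical ext_model (V : set_structure) (P le : V) (W : generic_extension P le) : zmodel :=
  Zmodel (ext_ZFC W).

Section Absoluteness.
Context {V : zmodel} {P le : V} (W : generic_extension P le).
Implicit Types (a b c f g k n p r x y z A B : V) (u v w : W).

Notation "# x" := (emb W x) (at level 8, format "# x").

Lemma emb_ex x w : w ∈ #x -> exists y, y ∈ x /\ w = #y.
Proof.
by move=> H; have [y E] := emb_transitive H; exists y; split=> //; apply/(emb_mem W); rewrite -E.
Qed.

Lemma emb_inj x y : #x = #y -> x = y.
Proof. by move=> E; apply: ext => z; rewrite -!(emb_mem W) E. Qed.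

Lemma emb_ext x w : (forall z, #z ∈ w <-> z ∈ x) -> (forall v, v ∈ w -> exists y, v = #y) -> #x = w.
Proof.
move=> H K; apply: ext => v; split=> [/emb_ex [y [Hy ->]]|Hv]; first exact/H.
by have [y E] := K v Hv; rewrite E emb_mem -H -E.
Qed.

Lemma emb_incl x y : incl #x #y <-> incl x y.
Proof.
split=> [H z /(emb_mem W) /H /emb_mem //|H w /emb_ex [z [/H Hz ->]]].
exact/emb_mem.
Qed.

Lemma emb_upair x y : #(upair x y) = upair #x #y.
Proof.
apply: emb_ext => [z|v]; rewrite !in_upair; last by case=> ->; [exists x|exists y].
by split=> -[E|E]; [left; apply: emb_inj|right; apply: emb_inj|left; rewrite E|right; rewrite E].
Qed.

Lemma emb_opair x y : #(opair x y) = opair #x #y.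
Proof. by rewrite /opair !emb_upair. Qed.

Lemma emb_app r x y : app #r #x #y <-> app r x y.
Proof. by rewrite !appE -emb_opair emb_mem. Qed.

Lemma emb_app_ex r u v : app #r u v -> exists x y, [/\ u = #x, v = #y & app r x y].
Proof.
move=> H; have /appE /emb_ex [p [Hp E]] := H.
have /emb_ex [q [Hq Eq]] : upair u v ∈ #p by rewrite -E in_upair; right.
have /emb_ex [x [_ Ex]] : u ∈ #q by rewrite -Eq in_upair; left.
have /emb_ex [y [_ Ey]] : v ∈ #q by rewrite -Eq in_upair; right.
by exists x, y; split=> //; apply/emb_app; rewrite -Ex -Ey.
Qed.

Lemma emb_empty : #emptyset = emptyset.
Proof. by apply: emptyP => w /emb_ex [y [/in_empty]]. Qed.

Lemma emb_adj x y : #(adj x y) = adj #x #y.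
Proof.
apply: emb_ext => [z|v]; rewrite !in_adj ?emb_mem.
  by split=> -[H|H]; [left|right; apply: emb_inj|left|right; rewrite H].
by move=> [/emb_ex [z [_ ->]]|->]; [exists z|exists y].
Qed.

Lemma emb_succ x : #(succ x) = succ #x.
Proof. exact: emb_adj. Qed.

(** Foundation in the extension gives a least element of [#om] outside [om]; it comes from zero or a
    successor of V, which [emb] preserves. *)
Lemma emb_om : #om = om.
Proof.
apply: incl_asym => w.
  move=> Hw; apply: NNPP => N.
  have [||v [Hv [Nv Kv]]] := @mem_min _ (fun w => ~ w ∈ om) #om.
  { by dfn_auto. }
  { by exists w. }
  have [n [Hn E]] := emb_ex Hv; subst v.
  have [E|[m [Hm E]]] := nat_cases Hn; subst n; apply: Nv.
    by rewrite emb_empty; exact: om_zero.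
  rewrite emb_succ; apply: om_succ; apply: NNPP => K; apply: (Kv _ _ _ K).
    by apply/emb_mem; exact: self_succ.
  exact/emb_mem.
move: w; apply: nat_ind; first by dfn_auto.
  by rewrite -emb_empty emb_mem; exact: om_zero.
by move=> w _ /emb_ex [n [Hn ->]]; rewrite -emb_succ emb_mem; exact: om_succ.
Qed.

Lemma emb_nat w : w ∈ om -> exists n, n ∈ om /\ w = #n.
Proof. by rewrite -emb_om => /emb_ex. Qed.

Lemma emb_in_om n : #n ∈ om <-> n ∈ om.
Proof. by rewrite -emb_om emb_mem. Qed.

Lemma emb_fun f A B : is_fun f A B -> is_fun #f #A #B.
Proof.
move=> Hf; apply: fun_intro.
  move=> w /emb_ex [p [/(fun_prod Hf) /in_prod [x [y [Hx [Hy ->]]]] ->]].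
  by rewrite emb_opair opair_prod !emb_mem.
move=> w /emb_ex [x [Hx ->]]; exists #(ap f x); split.
  by apply/emb_app; exact: (fun_app Hf Hx).
move=> v /emb_app_ex [x' [y [/emb_inj <- ->]]].
by rewrite (funE _ _ Hf) => -[_ ->].
Qed.

Lemma emb_ap f A B x : is_fun f A B -> x ∈ A -> ap #f #x = #(ap f x).
Proof.
move=> Hf Hx; have := emb_app f x (ap f x).
rewrite (funE _ _ (emb_fun Hf)) (funE _ _ Hf) => -[_ H].
by have [_ ->] : #x ∈ #A /\ #(ap f x) = ap #f #x by apply: H.
Qed.

Lemma emb_injects A B : injects A B -> injects #A #B.
Proof.
move=> [f [Hf /(injE Hf) If]]; have HF := emb_fun Hf; exists #f; split=> //; apply/(injE HF).
move=> u v /emb_ex [x [Hx ->]] /emb_ex [y [Hy ->]]; rewrite !(emb_ap Hf) // => /emb_inj E.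
by rewrite (If x y).
Qed.

Lemma emb_equi A B : equinumerous A B -> equinumerous #A #B.
Proof.
move=> [f [Hf [If /(ontoE Hf) Sf]]]; have HF := emb_fun Hf; exists #f; split=> //; split.
  move: If => /(injE Hf) If; apply/(injE HF).
  move=> u v /emb_ex [x [Hx ->]] /emb_ex [y [Hy ->]]; rewrite !(emb_ap Hf) // => /emb_inj E.
  by rewrite (If x y).
apply/(ontoE HF) => v /emb_ex [y [/Sf [x [Hx ->]] ->]].
by exists #x; rewrite (emb_ap Hf) // emb_mem.
Qed.

Lemma emb_countable A : countable A -> countable #A.
Proof. by move=> /countableE H; apply/countableE; rewrite -emb_om; exact: emb_injects. Qed.

Lemma emb_finite A : finite A -> finite #A.
Proof.
move=> /finiteE [n [Hn E]]; apply/finiteE; exists #n; rewrite emb_in_om; split=> //.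
exact: emb_equi.
Qed.

Lemma emb_ordinal a : is_ordinal a -> is_ordinal #a.
Proof.
move=> [T H]; split=> w /emb_ex [x [Hx ->]]; first by apply/emb_incl; apply: T.
by move=> v /emb_ex [y [Hy ->]]; apply/emb_incl; apply: (H x).
Qed.

(** * Absoluteness of Boolean algebras *)

Section Algebra.
Variables A leA : V.
Hypothesis HBA : is_boolean_algebra A leA.

Lemma emb_bot z : is_bot #A #leA #z <-> is_bot A leA z.
Proof.
rewrite /is_bot emb_mem; apply: and_iff_compat_l; split=> H a.
  by move=> Ha; apply/emb_app; apply: H; apply/emb_mem.
by move=> /emb_ex [b [Hb ->]]; apply/emb_app; apply: H.
Qed.

Lemma emb_top z : is_top #A #leA #z <-> is_top A leA z.
Proof.
rewrite /is_top emb_mem; apply: and_iff_compat_l; split=> H a.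
  by move=> Ha; apply/emb_app; apply: H; apply/emb_mem.
by move=> /emb_ex [b [Hb ->]]; apply/emb_app; apply: H.
Qed.

Lemma emb_join a b s : is_join #A #leA #a #b #s <-> is_join A leA a b s.
Proof.
rewrite /is_join emb_mem !emb_app; do !apply: and_iff_compat_l; split=> H t.
  by move=> Ht H1 H2; apply/emb_app; apply: H; apply/emb_mem || apply/emb_app.
by move=> /emb_ex [t' [Ht ->]] /emb_app H1 /emb_app H2; apply/emb_app; apply: H.
Qed.

Lemma emb_meet a b s : is_meet #A #leA #a #b #s <-> is_meet A leA a b s.
Proof.
rewrite /is_meet emb_mem !emb_app; do !apply: and_iff_compat_l; split=> H t.
  by move=> Ht H1 H2; apply/emb_app; apply: H; apply/emb_mem || apply/emb_app.
by move=> /emb_ex [t' [Ht ->]] /emb_app H1 /emb_app H2; apply/emb_app; apply: H.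
Qed.

Lemma emb_compl a c : is_compl A leA a c -> is_compl #A #leA #a #c.
Proof.
move=> [Hc [[z [Hz Hm]] [t [Ht Hj]]]]; split; first exact/emb_mem.
by split; [exists #z|exists #t]; split; rewrite ?emb_bot ?emb_top ?emb_meet ?emb_join.
Qed.

Lemma emb_algebra : is_boolean_algebra #A #leA.
Proof.
have [[H1 [H2 [H3 H4]]] [[bt Hbt] [[tp Htp] [H5 [H6 H7]]]]] := HBA.
split; first split; last split; last split; last split; last split.
- by move=> w /emb_ex [p [/H1 [x [y [Hx [Hy /is_opairE ->]]]] ->]]; exists #x, #y;
    rewrite !emb_mem is_opairE emb_opair.
- split; first by move=> w /emb_ex [x [/H2 Hx ->]]; apply/emb_app.
  split.
    by move=> u v /emb_app_ex [x [y [-> -> H]]] /emb_app K; rewrite (H3 x y).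
  move=> u v w /emb_app_ex [x [y [-> -> H]]] /emb_app_ex [y' [z [/emb_inj <- -> K]]].
  by apply/emb_app; exact: (H4 _ _ _ H K).
- by exists #bt; apply/emb_bot.
- by exists #tp; apply/emb_top.
- move=> u v /emb_ex [x [Hx ->]] /emb_ex [y [Hy ->]].
  have [[s Hs] [m Hm]] := H5 x y Hx Hy.
  by split; [exists #s; apply/emb_join|exists #m; apply/emb_meet].
- move=> a b c s m x y Hs Hm Hx Hy.
  (* The distributive law concerns arbitrary elements of the extension. Each of them belongs to [#A]
     or occurs in [#leA], hence comes from V, where the law is known. *)
  have in_emb w : w ∈ #A -> exists x, w = #x by move=> /emb_ex [z [_ ->]]; exists z.
  have [a' Ea] : exists z, a = #z.
    by move: Hm => [_ [/emb_app_ex [? [z [_ -> _]]] _]]; exists z.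
  have [b' Eb] : exists z, b = #z.
    by move: Hs => [_ [/emb_app_ex [z [? [-> _ _]]] _]]; exists z.
  have [c' Ec] : exists z, c = #z.
    by move: Hs => [_ [_ [/emb_app_ex [z [? [-> _ _]]] _]]]; exists z.
  have [s' Es] : exists z, s = #z by apply: in_emb; case: Hs.
  have [m' Em] : exists z, m = #z by apply: in_emb; case: Hm.
  have [x' Ex] : exists z, x = #z by apply: in_emb; case: Hx.
  have [y' Ey] : exists z, y = #z by apply: in_emb; case: Hy.
  subst; move: Hs Hm Hx Hy; rewrite !emb_join !emb_meet; exact: H6.
- move=> w /emb_ex [x [/H7 [c Hc] ->]]; exists #c; exact: emb_compl.
Qed.

Lemma emb_disj a b : a ∈ A -> disj A leA a b -> disj #A #leA #a #b.
Proof.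
move=> Ha H w /emb_app_ex [z [a' [-> /emb_inj <- Hz]]] /emb_app Hz'.
by apply/emb_bot; apply: H.
Qed.

End Algebra.

End Absoluteness.

Section Extension.
Context {V : zmodel} {P le : V} (W : generic_extension P le).
Implicit Types (a b c f g p q r x y z A B I : V) (u v w i j k n m : W).

Notation "# x" := (emb W x) (at level 8, format "# x").

(** * Non-meager ground model reals *)

Let Q := #dyadic.
Let lt := #dyadic_lt.

(** [bit] with its quantifiers over the extension, so that it is definable there, where the sets
    [isE n] must be formed. *)
Let bitW w i := exists r : W, r ∈ Q /\ incl r i /\ adj r i ∈ w /\
  forall r' : W, r' ∈ Q -> incl r' i -> app lt r r' -> ~ r' ∈ w.

Lemma bitW_bit w (i : V) : bitW w #i <-> bit (fun q => #q ∈ w) i.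
Proof.
split=> [[r' [/emb_ex [r [Hr ->]] [/emb_incl Hri [K H]]]]|[r [Hr [Hri [K H]]]]].
  exists r; split=> //; split=> //; split; first by rewrite emb_adj.
  by move=> r'' Hr'' Hi L; apply: H; [apply/emb_mem|apply/emb_incl|apply/emb_app].
exists #r; split; first exact/emb_mem.
split; first exact/emb_incl.
split; first by rewrite -emb_adj.
by move=> v /emb_ex [r' [Hr' ->]] /emb_incl Hi /emb_app L; apply: H.
Qed.

Lemma emb_cut x : is_cut dyadic dyadic_lt x -> is_cut Q lt #x.
Proof.
move=> [H1 [[q Hq] [[r [Hr Nr]] [H4 H5]]]]; split; first exact/emb_incl.
split; first by exists #q; apply/emb_mem.
split; first by exists #r; rewrite !emb_mem.
split; first by move=> u v /emb_ex [y [Hy ->]] /emb_app_ex [p' [y' [-> /emb_inj <- L]]];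
  apply/emb_mem; exact: H4 Hy L.
move=> v /emb_ex [y [/H5 [s [Hs L]] ->]]; exists #s.
by rewrite emb_mem emb_app.
Qed.

(* Otherwise the ground model reals are covered by the nowhere dense sets [isE n] of those reals
   whose digits match no pair of [R] beyond [n]. *)
Lemma nonmeager_pattern (R : W -> W -> Prop) : preserves_reals_nonmeager P le ->
  dfn (fun e => R (e 0) (e 1)) ->
  (forall n, n ∈ om -> exists k j, [/\ R k j, n ∈ succ k, k ∈ succ j & j ∈ om]) ->
  exists I, incl I om /\ forall n, n ∈ om -> exists k j,
    [/\ R k j, n ∈ succ k, k ∈ succ j, j ∈ om &
      succ j ∈ #I /\ forall i, k ∈ succ i -> i ∈ succ j -> ~ i ∈ #I].
Proof.
move=> Hnm HR Hub; apply: NNPP => N.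
have [_ [_ [_ [_ [ltT [ltC [ltD _]]]]]]] := dyadic_rationals (M := V).
pose RV := sep (power dyadic) (fun x : V => is_cut dyadic dyadic_lt x).
have inRV x : x ∈ RV <-> is_cut dyadic dyadic_lt x.
  by rewrite in_sep ?in_power; [dfn_auto|split=> [[]|H] //; split=> //; case: H].
pose RW := sep (power Q) (fun w => is_cut Q lt w).
have inRW w : w ∈ RW <-> is_cut Q lt w.
  by rewrite in_sep ?in_power; [dfn_auto|split=> [[]|H] //; split=> //; case: H].
pose TW := sep (power RW) (fun u => forall w, w ∈ u -> exists p q : W, p ∈ Q /\ q ∈ Q /\
  in_interval Q lt p q w /\ forall v, v ∈ RW -> in_interval Q lt p q v -> v ∈ u).
have inTW u : u ∈ TW <-> incl u RW /\ forall w, w ∈ u -> exists p q : W, p ∈ Q /\ q ∈ Q /\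
    in_interval Q lt p q w /\ forall v, v ∈ RW -> in_interval Q lt p q v -> v ∈ u.
  by rewrite in_sep ?in_power //; dfn_auto.
pose isE n w := w ∈ RW /\ forall k j, R k j -> n ∈ succ k -> k ∈ succ j -> j ∈ om ->
  ~ (bitW w (succ j) /\ forall i, k ∈ succ i -> i ∈ succ j -> ~ bitW w i).
have isE_dfn : dfn (fun e => isE (e 0) (e 1)) by dfn_auto.
pose C := sep (power RW) (fun u => exists n, n ∈ om /\ forall w, w ∈ u <-> isE n w).
have inC u : u ∈ C <-> exists n, n ∈ om /\ forall w, w ∈ u <-> isE n w.
  rewrite in_sep; first by dfn_auto.
  split=> [[]//|H]; split=> //; move: H => [n [_ H]].
  by apply/in_power => w /H [].
apply: (Hnm W dyadic dyadic_lt RV RW TW) => //; first exact: dyadic_rationals.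
split.
  by move=> w /emb_ex [x [/inRV Hx ->]]; apply/inRW; exact: emb_cut.
exists C; split.
  apply/countableE; apply: (@injects_intro _ (fun u n => n ∈ om /\ forall w, w ∈ u <-> isE n w)).
  { by dfn_auto. }
  { by move=> u /inC [n [Hn H]]; exists n. }
  { by move=> u v n _ _ _ [_ H] [_ H']; apply: ext => w; rewrite H H'. }
split; last first.
  move=> w /emb_ex [x [/inRV Hx ->]].
  (* The digits of a ground model real form a set of V. The assumed failure applies to it and gives
     an [n] whose set contains the real. *)
  pose I := sep om (fun i : V => bit (fun q => q ∈ x) i).
  have inI (i : V) : i ∈ I <-> i ∈ om /\ bit (fun q => q ∈ x) i.
    by apply: in_sep; dfn_auto.
  have HI i : i ∈ om -> i ∈ #I <-> bitW #x i.
    move=> /emb_nat [i' [Hi' ->]]; rewrite emb_mem inI bitW_bit.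
    have E : bit (fun q : V => #q ∈ #x) i' <-> bit (fun q => q ∈ x) i'.
      split=> -[r [Hr [Hri [K H]]]]; exists r; split=> //; split=> //; split.
      { exact/(emb_mem W). }
      { by move=> r' H1 H2 H3 /(emb_mem W); apply: H. }
      { exact/emb_mem. }
      { by move=> r' H1 H2 H3 /emb_mem; apply: H. }
    by rewrite E; tauto.
  have [n [Hn Kn]] : exists n, n ∈ om /\ forall k j, R k j -> n ∈ succ k -> k ∈ succ j -> j ∈ om ->
      ~ (succ j ∈ #I /\ forall i, k ∈ succ i -> i ∈ succ j -> ~ i ∈ #I).
    apply: NNPP => N'; apply: N; exists I; split; first by move=> i /inI [].
    move=> n Hn; apply: NNPP => K; apply: N'; exists n; split=> // k j H1 H2 H3 H4 H5.
    by apply: K; exists k, j.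
  pose E := sep RW (fun w => isE n w).
  have inE v : v ∈ E <-> isE n v.
    by rewrite in_sep; [dfn_auto|split=> [[]|H] //; split=> //; case: H].
  exists E; split; first by apply/inC; exists n.
  apply/inE; split; first by apply/inRW; exact: emb_cut.
  move=> k j HRkj Hnk Hkj Hj [H1 H2]; apply: (Kn k j) => //; split.
    by apply/HI => //; exact: om_succ.
  move=> i Hki Hij; have Hi := om_trans (om_succ Hj) Hij.
  by rewrite HI //; apply: H2.
move=> E0 /inC [n [Hn HE]]; split; first by move=> w /HE [].
move=> [U [HU [[x Hx] HUE]]].
have /inTW [URW /(_ x Hx) [p' [q' [Hp' [Hq' [[px [r' [Hr' [rx rq]]]] Kpq]]]]]] := HU.
have [p [Hp Ep]] := emb_ex Hp'; have [q [Hq Eq]] := emb_ex Hq'; subst p' q'.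
have [r [Hr Er]] := emb_ex Hr'; subst r'; move: rq => /emb_app rq.
have /inRW [xQ [_ [_ [xlow _]]]] := URW x Hx.
have pr : app dyadic_lt p r.
  have [//|[E|L]] := ltC p r Hp Hr; first by case: rx; rewrite -E.
  by case: rx; apply: (xlow _ _ px); apply/emb_app.
have /dyadic_ltE [_ _ pq] := ltT _ _ _ pr rq.
have [k1 [Hk1 pk1 Kk1]] := lex_dense Hp Hq pq.
have [n2 [Hn2 [Hnn2 Hk1n2]]] := nat_max Hn (proj2 (emb_in_om W k1) Hk1).
have [k' [j' [HRkj Hn2k Hkj Hj']]] := Hub n2 Hn2.
have Hk' := om_trans (om_succ Hj') Hkj.
have Hnk := nat_le_trans Hk' Hnn2 Hn2k.
have [k [Hk Ek]] := emb_nat Hk'; have [j [Hj Ej]] := emb_nat Hj'; subst k' j'.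
have Hk1k : k1 ∈ succ k.
  by apply/(emb_mem W); rewrite emb_succ; exact: (nat_le_trans Hk' Hk1n2 Hn2k).
have {}Hkj' : k ∈ succ j by apply/(emb_mem W); rewrite emb_succ.
have pk : incl p k by move=> z /pk1 Hz; exact: (nat_lt_le_trans Hk Hz Hk1k).
have pj z : z ∈ p -> z ∈ j by move=> /pk Hz; exact: (nat_lt_le_trans Hj Hz Hkj').
(* Every real between [l] and [s] has digits 0 from [k] to [j] and 1 at j+1, so it avoids [E0]; and
   p < l < s < q keeps the interval inside [U]. *)
pose l := adj p (succ j); pose s := adj p j.
have Hl : l ∈ dyadic by apply: in_dyadic_adj => //; exact: om_succ.
have Hs : s ∈ dyadic by apply: in_dyadic_adj.
have Nj : ~ j ∈ p by move=> /pj /mem_irrefl.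
have pl : app dyadic_lt p l.
  by apply/dyadic_ltE; split=> //; apply: lex_adj => /pj H; exact: (mem_asym H (self_succ j)).
have sq : app dyadic_lt s q.
  by apply/dyadic_ltE; split=> //; apply: Kk1 => //; exact: (nat_le_trans Hj Hk1k Hkj').
have ls : app dyadic_lt l s.
  apply/dyadic_ltE; split=> //; exists j; split; first by apply/in_adj; right.
  split.
    move=> /in_adj [//|E]; have := self_succ j; rewrite -E; exact: mem_irrefl.
  move=> m Hm; rewrite !in_adj; split=> -[H|E]; try by left.
    by have := mem_asym Hm; rewrite E => H; case: H; exact: self_succ.
  by move: Hm; rewrite E => /mem_irrefl.
have [m [lm ms]] := ltD _ _ ls.
have [_ Hm _] := proj1 (dyadic_ltE _ _) lm.
(* The rational [m] as a real: a point of [U] with a neighbourhood that misses [E0]. *)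
pose y := sep Q (fun v => app lt v #m).
have iny v : v ∈ y <-> v ∈ Q /\ app lt v #m by apply: in_sep; dfn_auto.
have iny' z : #z ∈ y <-> app dyadic_lt z m.
  rewrite iny emb_app; split=> [[]|H] //; split=> //; apply/emb_mem.
  by have [] := proj1 (dyadic_ltE _ _) H.
have ycut : is_cut Q lt y.
  split; first by move=> v /iny [].
  split; first by exists #l; apply/iny'.
  split.
    exists #m; split; first exact/emb_mem.
    by move=> /iny' /dyadic_ltE [_ _ /lex_irrefl].
  split.
    move=> u v Hv /emb_app_ex [a [b [Ea Eb L]]]; subst; apply/iny'.
    by move: Hv => /iny'; apply: ltT.
  move=> v Hv; have [/emb_ex [a [Ha Ea]] _] := proj1 (iny v) Hv; subst.
  move: Hv => /iny' /ltD [b [ab bm]]; exists #b; split; first exact/iny'.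
  exact/emb_app.
have yint : in_interval Q lt #l #s y.
  split; first exact/iny'.
  exists #m; split; first exact/emb_mem.
  split; first by move=> /iny' /dyadic_ltE [_ _ /lex_irrefl].
  exact/emb_app.
pose U' := sep RW (fun w => in_interval Q lt #l #s w).
have inU' w : w ∈ U' <-> w ∈ RW /\ in_interval Q lt #l #s w by apply: in_sep; dfn_auto.
have HU' : U' ∈ TW.
  apply/inTW; split; first by move=> w /inU' [].
  move=> w /inU' [Hw Iw]; exists #l, #s; split; first exact/emb_mem.
  split; first exact/emb_mem.
  by split=> // v Hv Iv; apply/inU'.
have yRW : y ∈ RW by apply/inRW.
have yU : y ∈ U.
  apply: Kpq => //; split; first by apply/iny'; exact: (ltT _ _ _ pl lm).
  exists #m; split; first exact/emb_mem.
  split; first by move=> /iny' /dyadic_ltE [_ _ /lex_irrefl].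
  by apply/emb_app; exact: (ltT _ _ _ ms sq).
have [_ /(_ U' HU')] := HUE y yU.
case; first by apply/inU'.
move=> w [/inU' [/inRW [_ [_ [_ [wlow _]]]] [lw [v [Hv [vw vs]]]]] /HE [_ Kw]].
have Xlow a b : #b ∈ w -> app dyadic_lt a b -> #a ∈ w.
  by move=> Hb L; apply: (wlow _ _ Hb); apply/emb_app.
have Xs : ~ #s ∈ w by move=> K; apply: vw; apply: (wlow _ _ K vs).
apply: (Kw #k #j) => //; split.
  by rewrite -emb_succ bitW_bit; exact: (bit_one (X := fun q => #q ∈ w) Hp Hj pk Hkj' Xlow lw Xs).
move=> i; rewrite -emb_succ => Hki Hij.
have [i' [Hi' Ei]] := emb_ex Hij; subst i; rewrite bitW_bit.
apply: (bit_zero (X := fun q => #q ∈ w) Hp Hj pk Hkj' Xlow lw Xs) => //.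
by apply/(emb_mem W); rewrite emb_succ.
Qed.

(** * Preservation of the first uncountable cardinal *)

(* If [w1] were countable in the extension, [{w1}] would be a club of countable subsets of
   [w1] disjoint from the stationary set of those lying in the ground model. *)
Lemma proper_omega1 a : is_proper P le -> is_omega1 a -> is_omega1 #a.
Proof.
move=> Hproper Ha; have [Ca [Na _]] := Ha; have [Oa _] := Ca.
have oma := omega1_om Ha.
apply: omega1_intro; first exact: emb_ordinal; last first.
  by move=> w /emb_ex [b [Hb ->]]; apply: emb_countable; exact: omega1_elt Ha Hb.
move=> Cnt.
have infE (A : V) : countably_infinite A <-> equinumerous A om.
  by split=> [[o [/is_omegaE -> //]]|H]; exists om; rewrite is_omegaE.
pose S := sep (power a) (fun x : V => countably_infinite x).
have inS x : x ∈ S <-> incl x a /\ countably_infinite x by rewrite in_sep ?in_power //; dfn_auto.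
have HS : is_stationary a S.
  split; first by move=> x /inS.
  move=> C [C1 [C2 _]]; have [|y [Hy _]] := C2 om.
    split; first by case: Oa => T _; exact: T oma.
    by apply/infE; exact: equi_refl.
  by exists y; split=> //; apply/inS; apply: C1.
have [_ Hst] := Hproper W a S Ca Na HS.
have inf : countably_infinite #a.
  exists om; split; first exact/is_omegaE.
  apply: cantor_bernstein; first exact/countableE.
  rewrite -(emb_om W); apply: injects_incl; apply/emb_incl.
  by case: Oa => T _; exact: T oma.
have [|w [/in_sing -> /emb_mem /inS [_ /infE /equi_injects /countableE //]]] := Hst (sing #a).
split; first by move=> w /in_sing ->; split.
split; first by move=> w [Hw _]; exists #a; split=> //; apply/in_sing.
move=> D u HD [w Hw] _ _ /is_unionE ->; apply/in_sing; apply: ext => v.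
rewrite in_union; split=> [[w' [Hv /HD /in_sing <-]]|Hv] //.
by exists w; split=> //; have /in_sing -> := HD w Hw.
Qed.

(** Index [A] by [a]. The indices of the values of [h] are bounded by some [d], by regularity in the
    extension; the elements of index at most [d] form a set of V that is countable in V, hence
    enumerated there. *)
Lemma countable_cover A a (h : W) : is_proper P le -> is_omega1 a -> equinumerous A a ->
  is_fun h om #A -> exists c, is_fun c om A /\ forall i, i ∈ om -> exists n,
    n ∈ om /\ ap h i = ap #c n.
Proof.
move=> Hproper Ha [f [Hf [/(injE Hf) If /(ontoE Hf) Sf]]] Hh.
have HF := emb_fun W Hf; have Ha' := proper_omega1 Hproper Ha.
have [[Oa _] _] := Ha.
have [||g [Hg Kg]] := @choice _ (fun i v : W => v = ap #f (ap h i)) om #a.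
{ by dfn_auto. }
{ by move=> i Hi; exists (ap #f (ap h i)); split=> //; apply/(ap_in HF)/(ap_in Hh). }
have [d' [/emb_ex [d [Hd ->]] Kd]] := omega1_regular Ha' Hg.
have Od := ord_in Oa Hd.
pose B := sep A (fun x => ap f x ∈ succ d).
have inB x : x ∈ B <-> x ∈ A /\ ap f x ∈ succ d by apply: in_sep; dfn_auto.
have [x0 [Hx0 E0]] := Sf d Hd.
have /countableE [s [Hs /(injE Hs) Is]] : countable B.
  have /countableE [s [Hs /(injE Hs) Is]] := omega1_elt Ha Hd.
  have : countable (succ d).
    apply/countableE; apply: (@injects_intro _ (fun x (n : V) =>
      (x ∈ d /\ n = succ (ap s x)) \/ (x = d /\ n = emptyset))); first by dfn_auto.
    { move=> x /in_succ [Hx|->]; last by exists emptyset; split; [exact: om_zero|right].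
      by exists (succ (ap s x)); split; [apply/om_succ/(ap_in Hs)|left]. }
    { have N0 (n : V) : n ∈ om -> succ n <> emptyset.
        by move=> Hn E; have := self_succ n; rewrite E => /in_empty.
      move=> x x' n _ _ _ [[Hx ->]|[-> ->]] [[Hx' E]|[E' E]].
      + by apply: Is => //; apply: succ_inj => //; apply: ap_in Hs _.
      + by case: (N0 (ap s x)) => //; apply: ap_in Hs _.
      + by case: (N0 (ap s x')) => //; apply: ap_in Hs _.
      + by rewrite E'. }
  move=> Cd; apply: (countable_injects Cd).
  apply: (@injects_intro _ (fun x y => y = ap f x)); first by dfn_auto.
    by move=> x /inB [Hx K]; exists (ap f x).
  by move=> x x' y /inB [Hx _] /inB [Hx' _] _ -> E; apply: If.
(* [c] inverts the injection [s] of [B] into [om], with default value [x0] off its range. *)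
have [||c [Hc Kc]] := @choice V (fun n x : V => forall x', x' ∈ B -> ap s x' = n -> x = x') om A.
{ by dfn_auto. }
{ move=> n Hn; case: (classic (exists x, x ∈ B /\ ap s x = n)) => [[x [HxB E]]|N].
    exists x; split; first by have /inB [] := HxB.
    by move=> x' Hx' E'; apply: Is => //; rewrite E.
  by exists x0; split=> // x' Hx' E; case: N; exists x'. }
exists c; split=> // i Hi; have /emb_ex [x [Hx Ex]] := ap_in Hh Hi.
have HxB : x ∈ B.
  apply/inB; split=> //; apply/(emb_mem W); rewrite emb_succ -(emb_ap W Hf) // -Ex -Kg //.
  exact: Kd.
have Hsx := ap_in Hs HxB.
exists #(ap s x); rewrite emb_in_om; split=> //.
rewrite (emb_ap W Hc) // Ex; congr (emb W _); by rewrite (Kc (ap s x) Hsx x HxB).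
Qed.

End Extension.

(** * Finite partitions of a sigma-complete algebra *)

Section GroundAlgebra.
Context {M : zmodel} (A le c : M).
Implicit Types (x y z a b s t u v w m n f g h i j k l p q B C D F H I N Y Z : M).
Notation "a ≼ b" := (app le a b) (at level 70).
Hypothesis HBA : is_boolean_algebra A le.
Hypothesis Hsig : is_sigma_complete A le.
Hypothesis Hc : is_fun c om A.

Lemma sup_ex B : incl B A -> countable B -> exists s, s ∈ A /\
  (forall b, b ∈ B -> b ≼ s) /\
  forall z, z ∈ A -> (forall b, b ∈ B -> disj A le z b) -> disj A le z s.
Proof.
move=> BA CB; have [s Hs] := Hsig BA CB; exists s.
case: (Hs) => sA [ub _]; split=> //; split=> // z Hz.
exact: (sup_disj HBA BA Hs).
Qed.

Lemma countable_image (R : M -> M -> Prop) B : dfn (fun e => R (e 0) (e 1)) ->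
  (forall y, y ∈ B -> exists n, n ∈ om /\ R n y) ->
  (forall n y y', R n y -> R n y' -> y = y') -> countable B.
Proof.
move=> HR H U; apply/countableE; apply: (@injects_intro _ (fun y n => R n y)) => //.
  by dfn_auto.
by move=> y y' n _ _ _; apply: U.
Qed.

Lemma meet_unique a b m m' : is_meet A le a b m -> is_meet A le a b m' -> m = m'.
Proof.
by move=> [mA [ma [mb H]]] [mA' [ma' [mb' H']]]; apply: (le_anti HBA); [apply: H'|apply: H].
Qed.

Lemma compl_unique a b b' : a ∈ A -> is_compl A le a b -> is_compl A le a b' -> b = b'.
Proof.
move=> Ha Hb Hb'; have bA := proj1 Hb; have bA' := proj1 Hb'.
apply: (le_anti HBA).
  by apply/(complE HBA Ha Hb' bA)/(compl_disj HBA Ha Hb).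
by apply/(complE HBA Ha Hb bA')/(compl_disj HBA Ha Hb').
Qed.

(** A partition of unity whose parts may overlap: what matters is that every ultrafilter contains at
    least one of them. *)
Definition covers D := incl D A /\ finite D /\
  forall a, a ∈ A -> (forall p, p ∈ D -> disj A le p a) -> is_bot A le a.

Definition decides p a := p ≼ a \/ disj A le p a.

Lemma covers_top t : is_top A le t -> covers (sing t).
Proof.
move=> [tA Ht]; split; first by move=> p /in_sing ->.
split; first exact: finite_upair.
move=> a Ha K; apply: (K t) (Ht a Ha) (le_refl HBA Ha); exact/in_sing.
Qed.

(** Each part is split by [c n] and its complement; lower elements inherit the earlier decisions. *)
Lemma partition_ex n : n ∈ om -> exists D, covers D /\
  forall i p, i ∈ n -> p ∈ D -> decides p (ap c i).
Proof.
move: n; apply: nat_ind; first by dfn_auto.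
  have [t Ht] := top_ex HBA; exists (sing t); split; first exact: covers_top.
  by move=> i p /in_empty.
move=> n Hn [D [[DA [FD cov]] dec]].
have Hcn := ap_in Hc Hn; have [c' Hc'] := compl_ex HBA Hcn; have cA' := proj1 Hc'.
pose S a := sep A (fun q => exists p, p ∈ D /\ is_meet A le p a q).
have inS a q : q ∈ S a <-> exists p, p ∈ D /\ is_meet A le p a q.
  by rewrite in_sep; [dfn_auto|split=> [[]//|K]; split=> //; move: K => [p [_ []]]].
have FS a : finite (S a).
  apply: (@finite_image _ (fun p q => is_meet A le p a q) D) => //; first by dfn_auto.
    by move=> q /inS.
  by move=> p q q'; exact: meet_unique.
exists (cup (S (ap c n)) (S c')); split; first split; last first.
- move=> i q Hi /in_cup [] /inS [p [Hp Hq]]; case: (Hq) => qA [qp [qa _]].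
    move: Hi => /in_succ [Hi|->]; last by left.
    have [K|K] := dec i p Hi Hp; [left|right]; first exact: (le_trans HBA qp K).
    exact: (disj_le HBA qp (le_refl HBA (ap_in Hc (om_trans Hn Hi))) K).
  move: Hi => /in_succ [Hi|->]; last by right; apply/(complE HBA Hcn Hc' qA).
  have [K|K] := dec i p Hi Hp; [left|right]; first exact: (le_trans HBA qp K).
  exact: (disj_le HBA qp (le_refl HBA (ap_in Hc (om_trans Hn Hi))) K).
- split; first exact: finite_cup.
  move=> a Ha K; apply: cov => // p Hp z Hzp Hza.
  have pA := DA p Hp; have zA : z ∈ A by case: (le_in HBA Hzp).
  have [m Hm] := meet_ex HBA pA Hcn; have [m' Hm'] := meet_ex HBA pA cA'.
  have Dz : disj A le z (ap c n).
    move=> w Hwz Hwc; apply: (K m) => //.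
    { by apply/in_cup; left; apply/inS; exists p. }
    { case: Hm => _ [_ [_ Hm]]; apply: Hm => //; first by case: (le_in HBA Hwz).
      exact: (le_trans HBA Hwz Hzp). }
    exact: (le_trans HBA Hwz Hza).
  apply: (K m') => //.
    by apply/in_cup; right; apply/inS; exists p.
  by case: Hm' => _ [_ [_ Hm']]; apply: Hm' => //; apply/(complE HBA Hcn Hc' zA).
- by move=> q /in_cup [] /inS [p [_ []]].
Qed.

(* The partition of level [k] decides [c i] for all [i] below the next element of [I]. *)
Definition level I k N p := is_fun p N A /\
  (forall a, a ∈ A -> (forall m, m ∈ N -> disj A le (ap p m) a) -> is_bot A le a) /\
  forall i, i ∈ om -> (exists l, l ∈ I /\ k ∈ succ l) ->
    (forall l, l ∈ I -> k ∈ succ l -> i ∈ l) ->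
    forall m, m ∈ N -> decides (ap p m) (ap c i).

Lemma level_ex I k : incl I om -> exists N, N ∈ om /\ exists p, level I k N p.
Proof.
move=> HI.
have [D [[DA [FD cov]] dec]] : exists D, covers D /\ forall i, i ∈ om ->
    (exists l, l ∈ I /\ k ∈ succ l) ->
    (forall l, l ∈ I -> k ∈ succ l -> i ∈ l) -> forall p, p ∈ D -> decides p (ap c i).
  (* Without an element of [I] from [k] on there is nothing to decide, and the top alone covers. *)
  case: (classic (exists l, l ∈ I /\ k ∈ succ l)) => [[l [Hl Hkl]]|N].
    have [D [HD K]] := partition_ex (HI l Hl); exists D; split=> // i Hi _ Hil p.
    by apply: K; apply: Hil.
  by have [t Ht] := top_ex HBA; exists (sing t); split; first exact: covers_top.
have /finiteE [N [HN /equi_sym [p [Hp [_ /(ontoE Hp) Sp]]]]] := FD.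
exists N; split=> //; exists p; split.
  by apply: (fun_widen Hp) => m Hm; apply/DA/(ap_in Hp).
split.
  by move=> a Ha K; apply: cov => // d /Sp [m [Hm ->]]; apply: K.
by move=> i Hi H1 H2 m Hm; apply: dec => //; apply: (ap_in Hp).
Qed.

(** The sizes [N] are chosen before the enumerations [q] because [N] itself becomes the ground model
    bound in the Laver property; [power (prod om A)] is just a set to choose from. *)
Lemma levels_ex I : incl I om -> exists N q, is_fun N om om /\
  is_fun q om (power (prod om A)) /\ forall k, k ∈ om -> level I k (ap N k) (ap q k).
Proof.
move=> HI; have [||N [HN KN]] := @choice M (fun k N => exists p, level I k N p) om om.
{ by dfn_auto. }
{ by move=> k _; exact: level_ex. }
have [||q [Hq Kq]] := @choice M (fun k p => level I k (ap N k) p) om (power (prod om A)).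
{ by dfn_auto. }
{ move=> k Hk; have [p Hp] := KN k Hk; exists p; split=> //; apply/in_power => z.
  case: Hp => Hp _ /(fun_prod Hp) /in_prod [x [y [Hx [Hy ->]]]].
  by apply/opair_prod; split=> //; exact: (om_trans (ap_in HN Hk) Hx). }
by exists N, q.
Qed.

(** The guard [m ∈ ap N k] is there because the slalom may predict numbers that index no part. *)
Lemma slalom_sup N q H : is_fun N om om ->
  (forall k, k ∈ om -> is_fun (ap q k) (ap N k) A) ->
  exists d, is_fun d om A /\ forall k, k ∈ om ->
    (forall m, m ∈ ap H k -> m ∈ ap N k -> ap (ap q k) m ≼ ap d k) /\
    forall z, z ∈ A -> (forall m, m ∈ ap H k -> m ∈ ap N k -> disj A le z (ap (ap q k) m)) ->
      disj A le z (ap d k).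
Proof.
move=> HN Hq.
apply: (@choice M (fun k s => (forall m, m ∈ ap H k -> m ∈ ap N k -> ap (ap q k) m ≼ s) /\
    forall z, z ∈ A -> (forall m, m ∈ ap H k -> m ∈ ap N k -> disj A le z (ap (ap q k) m)) ->
      disj A le z s) om A); first by dfn_auto.
move=> k Hk.
pose B := sep A (fun y => exists m, m ∈ ap H k /\ m ∈ ap N k /\ y = ap (ap q k) m).
have inB y : y ∈ B <-> y ∈ A /\ exists m, m ∈ ap H k /\ m ∈ ap N k /\ y = ap (ap q k) m.
  by apply: in_sep; dfn_auto.
have inB' m : m ∈ ap H k -> m ∈ ap N k -> ap (ap q k) m ∈ B.
  by move=> H1 H2; apply/inB; split; [exact: (ap_in (Hq k Hk) H2)|exists m].
have [||s [sA [ub K]]] := @sup_ex B.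
{ by move=> y /inB []. }
{ apply: (@countable_image (fun m y => y = ap (ap q k) m)); first by dfn_auto.
    move=> y /inB [_ [m [_ [Hm ->]]]]; exists m; split=> //.
    exact: (om_trans (ap_in HN Hk) Hm).
  by move=> m y y' -> ->. }
exists s; split=> //; split; first by move=> m H1 H2; apply: ub; exact: inB'.
by move=> z Hz Kz; apply: K => // y /inB [_ [m [H1 [H2 ->]]]]; exact: Kz.
Qed.

(** [ap g k] is the meet of all [ap d j] with j < k, minus [ap d k]. It is obtained as the
    complement of a countable supremum, that of [ap d k] and the complements of the earlier
    terms. *)
Lemma disjointify d : is_fun d om A -> exists g, is_fun g om A /\ forall k, k ∈ om ->
  forall z, z ∈ A -> z ≼ ap g k <-> disj A le z (ap d k) /\ forall j, j ∈ k -> z ≼ ap d j.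
Proof.
move=> Hd.
apply: (@choice M (fun k s => forall z, z ∈ A -> z ≼ s <->
  disj A le z (ap d k) /\ forall j, j ∈ k -> z ≼ ap d j) om A); first by dfn_auto.
move=> k Hk.
have Hdj j : j ∈ k -> ap d j ∈ A by move=> Hj; exact: (ap_in Hd (om_trans Hk Hj)).
pose R j y := (j = k /\ y = ap d k) \/ (j ∈ k /\ is_compl A le (ap d j) y).
pose B := sep A (fun y => exists j, j ∈ om /\ R j y).
have inB y : y ∈ B <-> y ∈ A /\ exists j, j ∈ om /\ R j y by apply: in_sep; dfn_auto.
have BA : incl B A by move=> y /inB [].
have [//||s [sA [ub K]]] := @sup_ex B.
  apply: (@countable_image R); first by dfn_auto.
    by move=> y /inB [].
  move=> j y y' [[Ej ->]|[Hj Hy]] [[Ej' ->]|[Hj' Hy']] //.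
  { by move: Hj'; rewrite Ej => /mem_irrefl. }
  { by move: Hj; rewrite Ej' => /mem_irrefl. }
  exact: (compl_unique (Hdj j Hj) Hy Hy').
have [t Ht] := compl_ex HBA sA; exists t; split; first by case: Ht.
move=> z zA; rewrite (complE HBA sA Ht zA); split=> [D|[D1 D2]].
  have DB y : y ∈ B -> disj A le z y.
    by move=> Hy; exact: (disj_le HBA (le_refl HBA zA) (ub y Hy) D).
  split.
    by apply: DB; apply/inB; split; [exact: (ap_in Hd Hk)|exists k; split=> //; left].
  move=> j Hj; have [y Hy] := compl_ex HBA (Hdj j Hj); have yA := proj1 Hy.
  apply/(complE HBA yA (compl_sym (Hdj j Hj) Hy) zA); apply: DB; apply/inB; split=> //.
  by exists j; split; [exact: (om_trans Hk Hj)|right].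
apply: K => // y /inB [yA [j [_ [[_ ->]|[Hj Hy]]]]] //.
by apply/(complE HBA yA (compl_sym (Hdj j Hj) Hy) zA); exact: D2.
Qed.

Lemma family_sup g I : is_fun g om A -> incl I om -> exists s, s ∈ A /\
  (forall k, k ∈ I -> ap g k ≼ s) /\
  forall z, z ∈ A -> (forall k, k ∈ I -> disj A le z (ap g k)) -> disj A le z s.
Proof.
move=> Hg HI; pose B := sep A (fun y => exists k, k ∈ I /\ y = ap g k).
have inB y : y ∈ B <-> y ∈ A /\ exists k, k ∈ I /\ y = ap g k by apply: in_sep; dfn_auto.
have [||s [sA [ub K]]] := @sup_ex B.
{ by move=> y /inB []. }
{ apply: (@countable_image (fun k y => y = ap g k)); first by dfn_auto.
    by move=> y /inB [_ [k [/HI Hk ->]]]; exists k.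
  by move=> k y y' -> ->. }
exists s; split=> //; split.
  by move=> k Hk; apply: ub; apply/inB; split; [exact: (ap_in Hg (HI k Hk))|exists k].
by move=> z zA Kz; apply: K => // y /inB [_ [k [Hk ->]]]; exact: Kz.
Qed.

End GroundAlgebra.

(** * Convergent sequences *)

Section Convergence.
Context {V : zmodel} {P le : V} (W : generic_extension P le).
Variables (A leA w1 : V) (X T f x : W).
Implicit Types (a b c d p q z I N : V) (u v w i j k m n s t y : W).
Notation "# x" := (emb W x) (at level 8, format "# x").

Hypothesis Hproper : is_proper P le.
Hypothesis Hlaver : has_laver_property P le.
Hypothesis Hnm : preserves_reals_nonmeager P le.
Hypothesis HBA : is_boolean_algebra A leA.
Hypothesis Hsig : is_sigma_complete A leA.
Hypothesis Hw1 : is_omega1 w1.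
Hypothesis HAw1 : equinumerous A w1.
Hypothesis HS : is_stone_space #A #leA X T.
Hypothesis Hf : is_fun f om X.
Hypothesis Hconv : converges X T f x.
Hypothesis Hnec : ~ eventually_constant f.

Let HBW : is_boolean_algebra #A #leA := emb_algebra W HBA.

Let uf_X u : u ∈ X -> is_ultrafilter #A #leA u.
Proof. by move=> /(stone_uf HS). Qed.

Let uf_x : is_ultrafilter #A #leA x.
Proof. by apply: uf_X; case: Hconv. Qed.

Let uf_f n : n ∈ om -> is_ultrafilter #A #leA (ap f n).
Proof. by move=> Hn; apply/uf_X/(ap_in Hf). Qed.

Lemma uf_disj_ground u a b : is_ultrafilter #A #leA u -> #a ∈ u -> #b ∈ u ->
  ~ disj A leA a b.
Proof.
move=> Hu Ha Hb D; apply: (uf_disj HBW Hu Ha Hb).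
by apply: emb_disj D; apply/(emb_mem W); exact: (uf_in Hu Ha).
Qed.

Lemma eventually_in v : v ∈ x -> exists k, k ∈ om /\
  forall n, n ∈ om -> k ∈ succ n -> v ∈ ap f n.
Proof.
move=> Hv; have [Hx K] := Hconv.
have [|k [/is_natE Hk Kk]] := K (cl X v) (cl_open HS v); first by apply/in_cl.
exists k; split=> // n Hn Hkn.
have /in_cl [] // : ap f n ∈ cl X v.
by apply: (Kk n) => //; [apply/is_natE|apply/ord_leE|exact: (fun_app Hf)].
Qed.

Lemma eventually_notin v : v ∈ #A -> ~ v ∈ x -> exists k, k ∈ om /\
  forall n, n ∈ om -> k ∈ succ n -> ~ v ∈ ap f n.
Proof.
move=> Hv Nv; have [w [Hw D]] := uf_compl HBW uf_x Hv Nv.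
have [k [Hk Kk]] := eventually_in Hw; exists k; split=> // n Hn Hkn Hvn.
exact: (uf_disj HBW (uf_f Hn) (Kk n Hn Hkn) Hvn D).
Qed.

Lemma often_distinct k : k ∈ om -> exists n, n ∈ om /\ k ∈ succ n /\ ap f n <> x.
Proof.
move=> Hk; apply: NNPP => N; apply: Hnec; exists k, x; split; first exact/is_natE.
move=> n /is_natE Hn /ord_leE Hkn; apply/(funE _ _ Hf); split=> //.
by apply: NNPP => E; apply: N; exists n; split=> //; split=> // E'; apply: E.
Qed.

Lemma separating_sequence : exists c (h : W), [/\ is_fun c om A, is_fun h om #A,
  forall n, n ∈ om -> ap f n <> x -> ap h n ∈ ap f n /\ ~ ap h n ∈ x &
  forall n, n ∈ om -> exists i, i ∈ om /\ ap h n = ap #c i].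
Proof.
have [||h [Hh Kh]] := @choice _ (fun n v => ap f n <> x -> v ∈ ap f n /\ ~ v ∈ x) om #A.
{ by dfn_auto. }
{ move=> n Hn; case: (classic (ap f n = x)) => [E|N].
    by have [_ [[v Hv] _]] := uf_x; exists v; split=> //; exact: (uf_in uf_x Hv).
  have [v [Hv Nv]] := stone_separate HBW HS (ap_in Hf Hn) (proj1 Hconv) N.
  by exists v; split=> //; exact: (uf_in (uf_f Hn) Hv). }
have [c [Hc Kc]] := countable_cover Hproper Hw1 HAw1 Hh.
by exists c, h.
Qed.

Section Separated.
Variables (c : V) (h : W).
Hypothesis Hc : is_fun c om A.
Hypothesis Hh : is_fun h om #A.
Hypothesis Hsep : forall n, n ∈ om -> ap f n <> x -> ap h n ∈ ap f n /\ ~ ap h n ∈ x.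
Hypothesis Hcov : forall n, n ∈ om -> exists i, i ∈ om /\ ap h n = ap #c i.

(* [j] lists [s] terms of the sequence, of index at least [k], that differ from the limit
   and from each other; each is separated from the later ones by the value of [h]. *)
Definition spread s k j := is_fun j s om /\
  forall t, t ∈ s -> k ∈ succ (ap j t) /\ ap f (ap j t) <> x /\
    forall t', t' ∈ t -> ~ ap h (ap j t') ∈ ap f (ap j t).

(** No value of [h] used so far belongs to [x], so all late terms omit these values; among the late
    terms, one differs from [x]. *)
Lemma spread_ex k s : k ∈ om -> s ∈ om -> exists j, spread s k j.
Proof.
move=> Hk; move: s; apply: nat_ind; first by dfn_auto.
  exists emptyset; split; last by move=> t /in_empty.
  by apply: fun_intro => [p /in_empty|t /in_empty].
move=> s Hs [j [Hj Kj]].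
have [||||m [Hm Km]] := @finite_bound _ (fun t m => forall n, n ∈ om -> m ∈ succ n ->
  ~ ap h (ap j t) ∈ ap f n) s.
{ by dfn_auto. }
{ exact: finite_nat. }
{ by move=> t n m Ht Hm K Hlm l Hl Hml; apply: K => //; exact: (nat_le_trans Hl Hlm Hml). }
{ move=> t Ht; have [_ [N _]] := Kj t Ht; have Hjt := ap_in Hj Ht.
  have [_ Nx] := Hsep Hjt N; exact: (eventually_notin (ap_in Hh Hjt) Nx). }
have [m' [Hm' [Hkm' Hmm']]] := nat_max Hk Hm.
have [n [Hn [Hmn Nn]]] := often_distinct Hm'.
have [||j' [Hj' Kj']] := @choice _ (fun t v => (t ∈ s /\ v = ap j t) \/ (t = s /\ v = n)) (succ s) om.
{ by dfn_auto. }
{ move=> t /in_succ [Ht|->]; last by exists n; split=> //; right.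
  by exists (ap j t); split; [exact: (ap_in Hj Ht)|left]. }
have old t : t ∈ s -> ap j' t = ap j t.
  move=> Ht; have [[_ //]|[E _]] := Kj' t (mem_succ Ht).
  by move: Ht; rewrite E => /mem_irrefl.
have new : ap j' s = n by have [[/mem_irrefl]|[_ E]] := Kj' s (self_succ s).
exists j'; split=> // t /in_succ [Ht|->].
  rewrite old //; have [K1 [K2 K3]] := Kj t Ht; split=> //; split=> // t' Ht'.
  by rewrite old; [exact: (nat_trans Hs Ht Ht')|exact: K3].
rewrite new; split; first exact: (nat_le_trans Hn Hkm' Hmn).
split=> // t' Ht'; rewrite old //; apply: Km => //; exact: (nat_le_trans Hn Hmm' Hmn).
Qed.

(** The group has k+2 terms, one more than the k+1 parts that a slalom allows at [k]; [n] bounds how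
    much of [c] separates them. *)
Definition spread_below k n := exists j, spread (succ (succ k)) k j /\
  forall t, t ∈ succ (succ k) -> exists i, i ∈ succ n /\ ap h (ap j t) = ap #c i.

Lemma spread_below_dfn : dfn (fun e : nat -> ext_model W => spread_below (e 0) (e 1)).
Proof. by dfn_auto. Qed.

Lemma spread_below_ex k : k ∈ om -> exists n, [/\ n ∈ om, k ∈ succ n & spread_below k n].
Proof.
move=> Hk; have Hkk := om_succ (om_succ Hk).
have [j [Hj Kj]] := spread_ex Hk Hkk.
have [||||m [Hm Km]] := @finite_bound _ (fun t n => exists i, i ∈ succ n /\
  ap h (ap j t) = ap #c i) (succ (succ k)).
{ by dfn_auto. }
{ exact: finite_nat. }
{ move=> t n m Ht Hm [i [Hi E]] Hlm; exists i; split=> //; exact: (nat_le_trans Hm Hi Hlm). }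
{ move=> t Ht; have [i [Hi E]] := Hcov (ap_in Hj Ht).
  by exists i; split=> //; exists i; split=> //; exact: self_succ. }
have [n [Hn [Hkn Hmn]]] := nat_max Hk Hm.
exists n; split=> //; exists j; split=> // t Ht; have [i [Hi E]] := Km t Ht.
exists i; split=> //; exact: (nat_le_trans Hn Hi Hmn).
Qed.

(* The [k+2] spread points cannot all lie in the [k+1] parts predicted by the slalom. *)
Lemma escaping : exists d, [/\ is_fun d om A,
  forall k, k ∈ om -> ap #d k ∈ x &
  forall n, n ∈ om -> exists m k, [/\ m ∈ om, n ∈ succ m, k ∈ om & ~ ap #d k ∈ ap f m]].
Proof.
have [|I [HI KI]] := nonmeager_pattern Hnm spread_below_dfn.
  move=> n Hn; have [m [Hm Hnm' Hnm'']] := spread_below_ex Hn.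
  by exists n, m; split=> //; exact: self_succ.
have [N [q [HN [Hq Klev]]]] := levels_ex HBA Hc HI.
have Hqk (k : V) : k ∈ om -> is_fun (ap q k) (ap N k) A by move=> /Klev [].
have HNW := emb_fun W HN; have HqW := emb_fun W Hq.
have HNk k : k ∈ om -> ap #N k ∈ om.
  by move=> Hk; rewrite -(emb_om W); apply: (ap_in HNW); rewrite emb_om.
(* [g] gives the index of a part containing [x]. If there were none, a member of [x] would be
   disjoint from all the parts, hence a bottom. *)
have [||g [Hg Kg]] := @choice _ (fun k m => m ∈ ap #N k /\ ap (ap #q k) m ∈ x) om om.
{ by dfn_auto. }
{ move=> k0 Hk0; have [k [Hk E]] := emb_nat Hk0; subst k0.
  apply: NNPP => Nm.
  have [_ [cov _]] := Klev k Hk.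
  have [||||v [Hv Kv]] := @uf_finite _ #A #leA HBW x uf_x
    (fun m v => disj #A #leA v (ap (ap #q #k) m)) (ap #N #k).
  { by rewrite /disj; dfn_auto. }
  { exact/finite_nat/HNk. }
  { move=> m v w Hm Hwv D z' Hz'; apply: D; exact: (le_trans HBW Hz' Hwv). }
  { move=> m0 Hm0; have Hm0' := Hm0; move: Hm0'; rewrite (emb_ap W HN Hk) => /emb_ex [m [Hm Em]].
    subst m0; apply: (uf_compl HBW uf_x).
      by rewrite (emb_ap W Hq Hk) (emb_ap W (Hqk k Hk) Hm) emb_mem; exact: (ap_in (Hqk k Hk) Hm).
    move=> K; apply: Nm; exists #m; split; last by split.
    by rewrite emb_in_om; exact: (om_trans (ap_in HN Hk) Hm). }
  { have /emb_ex [a [Ha Ea]] := uf_in uf_x Hv; subst v.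
    apply: (uf_bot uf_x _ Hv); apply/emb_bot; apply: cov => // m Hm.
    have Hm' : #m ∈ ap #N #k by rewrite (emb_ap W HN Hk) emb_mem.
    have D := Kv _ Hm'; move: D; rewrite (emb_ap W Hq Hk) (emb_ap W (Hqk k Hk) Hm) => D z Hz1 Hz2.
    by apply/(emb_bot W); apply: D; apply/emb_app. } }
have gle : eventually_le g #N.
  exists emptyset; split; first exact/is_natE/om_zero.
  move=> n a b /is_natE Hn _ /(funE _ _ Hg) [_ ->].
  have HNW' := HNW; move: HNW'; rewrite emb_om => HNW' /(funE _ _ HNW') [_ ->].
  by left; have [] := Kg n Hn.
have [||H [[o [/is_omegaE Eo [HH KH]]] Hpred]] := Hlaver (W := W) (f := N) (g := g) _ _ gle.
{ by exists om; rewrite is_omegaE. }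
{ by exists om; rewrite is_omegaE. }
subst o.
have [d [Hd Kd]] := slalom_sup HBA Hsig H HN Hqk.
have Hdk (k : V) : k ∈ om -> ap #d #k = #(ap d k) by move=> Hk; exact: (emb_ap W Hd Hk).
have HHk (k : V) : k ∈ om -> app H k (ap H k).
  move=> Hk; have [_ /(_ k Hk) [y [Hy Uy]]] := HH.
  by rewrite (ap_unique Hy) // => z' /Uy <-.
have emb_Hk (k : V) w : k ∈ om -> app #H #k w -> w = #(ap H k).
  move=> Hk /emb_app_ex [k' [y [/emb_inj <- -> Hy]]].
  have [_ /(_ k Hk) [z [Hz Uz]]] := HH; by rewrite -(Uz _ Hy) -(Uz _ (HHk k Hk)).
exists d; split=> //.
  move=> k0 Hk0; have [k [Hk E]] := emb_nat Hk0; subst k0.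
  have [w [m' [Hw [/(funE _ _ Hg) [_ ->] Hmw]]]] := Hpred #k (proj2 (is_natE _) Hk0).
  rewrite (emb_Hk _ _ Hk Hw) in Hmw.
  have [Hgk Hgx] := Kg _ Hk0.
  have [m [HmH Em]] := emb_ex Hmw.
  move: Hgk Hgx; rewrite Em (emb_ap W HN Hk) emb_mem => HmN.
  rewrite (emb_ap W Hq Hk) (emb_ap W (Hqk k Hk) HmN) Hdk // => Hx.
  have [ub _] := Kd k Hk; apply: (uf_up uf_x Hx); apply/emb_app; exact: ub.
move=> n Hn; have [k0 [l0 [[j [[Hj Kj] Kc]] Hnk Hkl Hl0 [HlI HkI]]]] := KI n Hn.
have Hk0 := om_trans (om_succ Hl0) Hkl.
have [k [Hk Ek]] := emb_nat Hk0; have [l [Hl El]] := emb_nat Hl0; subst k0 l0.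
have Hkk := om_succ (om_succ Hk0).
apply: NNPP => Nesc.
have Hin t : t ∈ succ (succ #k) -> ap #d #k ∈ ap f (ap j t).
  move=> Ht; apply: NNPP => K; apply: Nesc; exists (ap j t), #k; split=> //.
    exact: (ap_in Hj Ht).
  have [Hkj _] := Kj t Ht; exact: (nat_le_trans (ap_in Hj Ht) Hnk Hkj).
apply: (pigeonhole (om_succ Hk0)).
have [_ [_ [s [/is_succE Es Hinj]]]] := KH k _ (HHk k Hk); subst s.
rewrite -(emb_succ W); apply: (injects_trans _ (emb_injects W Hinj)); rewrite emb_succ.
have [_ [_ lev]] := Klev k Hk.
(* [I] has no element from [k] to [l], so its next one is l+1 and the partition at level [k] decides
   [c i] for all i ≤ l. *)
have dec i : i ∈ succ #l -> exists i' : V, [/\ i = #i', i' ∈ om &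
    forall m : V, m ∈ ap N k -> decides A leA (ap (ap q k) m) (ap c i')].
  rewrite -emb_succ => /emb_ex [i' [Hi' ->]].
  have Hio := om_trans (om_succ Hl) Hi'.
  exists i'; split=> //; apply: lev => //.
    exists (succ l); split; first by apply/(emb_mem W); rewrite emb_succ.
    by apply: mem_succ; apply/(emb_mem W); rewrite emb_succ.
  move=> l' Hl' Hkl'; have Hl'o := HI _ Hl'.
  have [K|//] := nat_le_lt Hl'o Hio.
  case: (HkI #l'); rewrite ?emb_mem -?emb_succ ?emb_mem //.
  exact: (nat_le_trans Hl K Hi').
(* Each term of the group contains [d k], the supremum of the predicted parts, and therefore
   contains one of these finitely many parts. *)
apply: (@injects_intro _ (fun t m => m ∈ #(ap N k) /\ ap (ap #q #k) m ∈ ap f (ap j t))).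
- by dfn_auto.
- move=> t Ht; apply: NNPP => Nm; have Hjt := ap_in Hj Ht.
  have [||||v [Hv Kv]] := @uf_finite _ #A #leA HBW _ (uf_f Hjt)
    (fun m v => m ∈ #(ap N k) -> disj #A #leA v (ap (ap #q #k) m)) #(ap H k).
  + by rewrite /disj; dfn_auto.
  + by apply: emb_finite; have [_ [F _]] := KH k _ (HHk k Hk).
  + move=> m v w Hm Hwv D Hm' z' Hz'; apply: D => //; exact: (le_trans HBW Hz' Hwv).
  + move=> m0 Hm0; case: (classic (m0 ∈ #(ap N k))) => Hm0'; last first.
      by have [_ [[v Hv] _]] := uf_f Hjt; exists v.
    have mA : ap (ap #q #k) m0 ∈ #A.
      have [m [Hm Em]] := emb_ex Hm0'; subst m0.
      rewrite (emb_ap W Hq Hk) (emb_ap W (Hqk k Hk) Hm) emb_mem; exact: (ap_in (Hqk k Hk) Hm).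
    have [|v [Hv Dv]] := uf_compl HBW (uf_f Hjt) mA; last by exists v.
    by move=> K; apply: Nm; exists m0.
  + have /emb_ex [a [Ha Ea]] := uf_in (uf_f Hjt) Hv; subst v.
    have [_ K] := Kd k Hk.
    have := Hin t Ht; rewrite Hdk // => Hdt.
    apply: (uf_disj_ground (uf_f Hjt) Hv Hdt); apply: K => // m HmH HmN.
    have Hm' : #m ∈ #(ap H k) by apply/emb_mem.
    have Hm'' : #m ∈ #(ap N k) by apply/emb_mem.
    have D := Kv _ Hm' Hm''; move: D; rewrite (emb_ap W Hq Hk) (emb_ap W (Hqk k Hk) HmN).
    by move=> D z Hz1 Hz2; apply/(emb_bot W); apply: D; apply/emb_app.
(* Two terms cannot share a part: it decides the value of [h] at the earlier one, which belongs to
   the earlier term and not to the later one. *)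
- have half t t' m : t ∈ succ (succ #k) -> t' ∈ t -> m ∈ #(ap N k) ->
    ap (ap #q #k) m ∈ ap f (ap j t) -> ap (ap #q #k) m ∈ ap f (ap j t') -> False.
    move=> Ht Ht't /emb_ex [m' [Hm' ->]].
    rewrite (emb_ap W Hq Hk) (emb_ap W (Hqk k Hk) Hm') => K K'.
    have Ht' := nat_trans Hkk Ht Ht't.
    have Hjt := ap_in Hj Ht; have Hjt' := ap_in Hj Ht'.
    have [_ [_ /(_ _ Ht't) Nsep]] := Kj t Ht.
    have [_ [Nx _]] := Kj t' Ht'.
    have [Hsep' _] := Hsep Hjt' Nx.
    have [i [Hi Ei]] := Kc t' Ht'.
    have [i' [Ei' Hio Hdec]] := dec i Hi; subst i.
    move: Nsep Hsep'; rewrite Ei (emb_ap W Hc Hio) => N1 N2.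
    have [L|D] := Hdec m' Hm'.
      by apply: N1; apply: (uf_up (uf_f Hjt) K); apply/emb_app.
    exact: (uf_disj_ground (uf_f Hjt') K' N2 D).
  move=> t t' m Ht Ht' _ [Hm K] [_ K'].
  have [L|[//|L]] := nat_total (om_trans Hkk Ht) (om_trans Hkk Ht').
    by case: (half t' t m).
  by case: (half t t' m).
Qed.

End Separated.

Lemma no_convergent_sequence : False.
Proof.
have [c [h [Hc Hh Hsep Hcov]]] := separating_sequence.
have [d [Hd Hdx Hesc]] := escaping Hc Hh Hsep Hcov.
have [g [Hg Kg]] := disjointify HBA Hsig Hd.
have HgW := emb_fun W Hg; rewrite emb_om in HgW.
have gA (k : V) : k ∈ om -> ap g k ∈ A by move=> Hk; exact: (ap_in Hg Hk).
have g_disj_d (k : V) : k ∈ om -> disj A leA (ap g k) (ap d k).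
  by move=> Hk; have [] := proj1 (Kg k Hk _ (gA k Hk)) (le_refl HBA (gA k Hk)).
have g_le_d (k j : V) : k ∈ om -> j ∈ k -> app leA (ap g k) (ap d j).
  by move=> Hk Hj; have [_] := proj1 (Kg k Hk _ (gA k Hk)) (le_refl HBA (gA k Hk)); apply.
have g_disj_lt (k j : V) : k ∈ om -> j ∈ k -> disj A leA (ap g k) (ap g j).
  move=> Hk Hj; apply: (disj_sym); apply: (disj_le HBA _ (g_le_d k j Hk Hj)).
    exact/(le_refl HBA)/gA/(om_trans Hk Hj).
  exact/g_disj_d/(om_trans Hk Hj).
have g_disj (k j : V) : k ∈ om -> j ∈ om -> k <> j -> disj A leA (ap g k) (ap g j).
  move=> Hk Hj N; have [L|[//|L]] := nat_total Hk Hj; last exact: g_disj_lt.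
  by apply: disj_sym; exact: g_disj_lt.
have gW (k : V) : k ∈ om -> ap #g #k = #(ap g k) by move=> Hk; exact: (emb_ap W Hg Hk).
have dW (k : V) : k ∈ om -> ap #d #k = #(ap d k) by move=> Hk; exact: (emb_ap W Hd Hk).
have g_uniq u k j : is_ultrafilter #A #leA u -> k ∈ om -> j ∈ om ->
    ap #g k ∈ u -> ap #g j ∈ u -> k = j.
  move=> Hu /emb_nat [k' [Hk ->]] /emb_nat [j' [Hj ->]]; rewrite !gW // => K K'.
  apply: NNPP => N; apply: (uf_disj_ground Hu K K'); apply: g_disj => // E.
  by apply: N; rewrite E.
(* The index found is the first one whose [d] the ultrafilter misses. *)
have g_first u k : is_ultrafilter #A #leA u -> k ∈ om -> ~ ap #d k ∈ u ->
    exists j, j ∈ om /\ ap #g j ∈ u.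
  move=> Hu Hk0 N0.
  have [||k0 [{}Hk0 [{}N0 Kk]]] := @nat_least _ (fun k => ~ ap #d k ∈ u).
  { by dfn_auto. }
  { by exists k. }
  exists k0; split=> //; have [k' [Hk Ek]] := emb_nat Hk0; subst k0.
  have [||||v [Hv Kv]] := @uf_finite _ #A #leA HBW u Hu
    (fun j v => (j = #k' -> disj #A #leA v (ap #d #k')) /\ (j ∈ #k' -> app #leA v (ap #d j))) (succ #k').
  { by rewrite /disj; dfn_auto. }
  { exact/finite_nat/om_succ. }
  { move=> j v w _ Hwv [K1 K2]; split=> [E z' Hz'|Hj].
      by apply: K1 => //; exact: (le_trans HBW Hz' Hwv).
    exact: (le_trans HBW Hwv (K2 Hj)). }
  { move=> j /in_succ [Hj|->].
      have Hdj : ap #d j ∈ u by apply: NNPP; exact: Kk.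
      exists (ap #d j); split=> //; split=> [E|_].
        by move: Hj; rewrite E => /mem_irrefl.
      exact/(le_refl HBW)/(uf_in Hu Hdj).
    have [|w [Hw Dw]] := uf_compl HBW Hu _ N0.
      by rewrite dW // emb_mem; exact: (ap_in Hd Hk).
    by exists w; split=> //; split=> // /mem_irrefl. }
  have /emb_ex [a [Ha Ea]] := uf_in Hu Hv; subst v.
  rewrite gW //; apply: (uf_up Hu Hv); apply/emb_app/(Kg k' Hk a Ha); split.
    have [D _] := Kv _ (self_succ #k'); move: (D eq_refl); rewrite dW // => {}D z Hz1 Hz2.
    by apply/(emb_bot W); apply: D; apply/emb_app.
  move=> j Hj; have Hj' : #j ∈ #k' by apply/emb_mem.
  have [_ L] := Kv _ (mem_succ Hj'); move: (L Hj').
  by rewrite dW ?emb_app //; exact: (om_trans Hk Hj).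
have g_x k : k ∈ om -> ~ ap #g k ∈ x.
  move=> Hk0 K; have := Hdx k Hk0; move: Hk0 K => /emb_nat [k' [Hk ->]].
  by rewrite gW // dW // => K K'; apply: (uf_disj_ground uf_x K K'); exact: g_disj_d.
have g_A k : k ∈ om -> ap #g k ∈ #A by move=> Hk; exact: (ap_in HgW Hk).
(* This bound and the next trade indices of [g] for indices of the sequence: late terms avoid the
   early [g k], and late [g k] avoid the early terms. *)
have bound_n k1 : k1 ∈ om -> exists n1, n1 ∈ om /\ forall k, k ∈ k1 -> forall n, n ∈ om ->
    n1 ∈ succ n -> ~ ap #g k ∈ ap f n.
  move=> Hk1; apply: finite_bound.
  { by dfn_auto. }
  { exact: finite_nat. }
  { by move=> k n m _ Hm K Hlm l Hl Hml; apply: K => //; exact: (nat_le_trans Hl Hlm Hml). }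
  { move=> k Hk; have Hko := om_trans Hk1 Hk; exact: (eventually_notin (g_A k Hko) (g_x k Hko)). }
have bound_k n0 : n0 ∈ om -> exists k1, k1 ∈ om /\ forall n, n ∈ n0 -> forall k, k ∈ om ->
    ap #g k ∈ ap f n -> k ∈ k1.
  move=> Hn0; apply: finite_bound.
  { by dfn_auto. }
  { exact: finite_nat. }
  { by move=> n i m _ Hm K Him k Hk Hkn; exact: (nat_lt_le_trans Hm (K k Hk Hkn) Him). }
  { move=> n Hn; have Hno := om_trans Hn0 Hn.
    case: (classic (exists k, k ∈ om /\ ap #g k ∈ ap f n)) => [[k [Hk Hkn]]|N].
      exists (succ k); split; first exact: om_succ.
      by move=> j Hj Hjn; rewrite (g_uniq _ _ _ (uf_f Hno) Hj Hk Hjn Hkn); exact: self_succ.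
    by exists emptyset; split; [exact: om_zero|move=> k Hk Hkn; case: N; exists k]. }
pose occurs k := k ∈ om /\ exists n, n ∈ om /\ ap #g k ∈ ap f n.
have occurs_often k0 : k0 ∈ om -> exists k, occurs k /\ k0 ∈ succ k.
  move=> Hk0; have [n1 [Hn1 Kn1]] := bound_n k0 Hk0.
  have [m [k [Hm Hnm' Hk N]]] := Hesc n1 Hn1.
  have [j [Hj Hjm]] := g_first _ _ (uf_f Hm) Hk N.
  exists j; split; first by split=> //; exists m.
  apply: nat_le_ltN => // Hjk; exact: (Kn1 j Hjk m Hm Hnm' Hjm).
(* The pattern puts j+1 into [I] and keeps [k] out of it, so that [I] splits the occurring indices
   infinitely often. *)
have [||I [HI KI]] := @nonmeager_pattern _ _ _ W (fun k j => occurs k /\ occurs (succ j)) Hnm.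
{ by dfn_auto. }
{ move=> n Hn; have [k [Ok Hnk]] := occurs_often n Hn; have Hk : k ∈ om by case: Ok.
  have [k2 [Ok2 Hkk2]] := occurs_often (succ k) (om_succ Hk); have Hk2 : k2 ∈ om by case: Ok2.
  have [E|[j [Hj E]]] := nat_cases Hk2; subst k2.
    by move: Hkk2 => /in_succ [/in_empty|E] //; have := self_succ k; rewrite E => /in_empty.
  exists k, j; split=> //.
  have /in_succ [K|K] := Hkk2.
    by apply: (nat_trans (om_succ Hj) K); exact: self_succ.
  by rewrite -K; exact: self_succ. }
have [b [bA [ub Kb]]] := family_sup HBA Hsig Hg HI.
(* The term containing [g k] misses [b] because [g k] is disjoint from every [g i] with [i] in [I];
   the one containing [g (j+1)] contains [b]. *)
have both n0 : n0 ∈ om -> exists m m', [/\ m ∈ om, m' ∈ om, n0 ∈ succ m, n0 ∈ succ m' &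
    ~ #b ∈ ap f m /\ #b ∈ ap f m'].
  move=> Hn0; have [k1 [Hk1 Kk1]] := bound_k n0 Hn0.
  have [k [j [[[Hk [m [Hm Hkm]]] [Hj' [m' [Hm' Hjm]]]] Hk1k Hkj Hj [HjI HkI]]]] := KI k1 Hk1.
  exists m, m'; split=> //.
  { apply: nat_le_ltN => // Hmn; have Hkk1 := Kk1 m Hmn k Hk Hkm.
    by have := nat_le_lt_trans Hk1 Hk1k Hkk1 => /mem_irrefl. }
  { apply: nat_le_ltN => // Hmn; have Hjk1 := Kk1 m' Hmn _ Hj' Hjm.
    have Hk1j : k1 ∈ succ j by exact: (nat_le_trans Hj Hk1k Hkj).
    exact: (mem_asym Hk1j Hjk1). }
  { have [k' [Hk' Ek]] := emb_nat Hk; subst k; have [j' [Hj'' Ej]] := emb_nat Hj; subst j.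
    rewrite gW // in Hkm; move: Hjm HjI; rewrite -emb_succ gW; first exact: om_succ.
    move=> Hjm /emb_mem HjI; split; last by apply: (uf_up (uf_f Hm') Hjm); apply/emb_app; exact: ub.
    move=> Hbm; apply: (uf_disj_ground (uf_f Hm) Hkm Hbm); apply: Kb => [|i Hi]; first exact: gA.
    apply: g_disj => //; first exact: HI.
    by move=> E; subst i; case: (HkI #k') => //; [exact: self_succ|apply/emb_mem]. }
case: (classic (#b ∈ x)) => Hbx.
  have [n0 [Hn0 K0]] := eventually_in Hbx; have [m [_ [Hm _ Hnm' _ [N _]]]] := both n0 Hn0.
  by apply: N; exact: K0.
have [|n0 [Hn0 K0]] := eventually_notin _ Hbx; first exact/emb_mem.
have [_ [m [_ Hm _ Hnm' [_ K]]]] := both n0 Hn0.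
exact: (K0 m Hm Hnm' K).
Qed.

End Convergence.

Lemma efimov_ground_algebra (V : zmodel) (P le : V) (W : generic_extension P le) (A leA : V) :
  is_proper P le -> has_laver_property P le -> preserves_reals_nonmeager P le -> ~ CH W ->
  is_boolean_algebra A leA -> is_sigma_complete A leA -> card_omega1 A ->
  exists X T w1 : W, is_stone_space (emb W A) (emb W leA) X T /\ is_efimov X T /\
    is_omega1 w1 /\ has_weight X T w1.
Proof.
move=> Hproper Hlaver Hnm NCH HBA Hsig [w1 [Hw1 HAw1]].
have HBW := emb_algebra W HBA.
have Hw1W := proper_omega1 W Hproper Hw1; have HAw1W := emb_equi W HAw1.
have [X [T HS]] := stone_ex (emb W A) (emb W leA).
exists X, T, (emb W w1); split=> //; split; last by split=> //; exact: (stone_weight HBW HS Hw1W HAw1W).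
split; first exact: (stone_compact_hausdorff HBW HS).
split; first exact: (stone_infinite HBW HS Hw1W HAw1W).
split; last exact: (stone_no_beta_omega HBW HS Hw1W HAw1W NCH).
move=> [o [f [x [/is_omegaE -> [Hf [Hconv Hnec]]]]]].
exact: (no_convergent_sequence Hproper Hlaver Hnm HBA Hsig Hw1 HAw1 HS Hf Hconv Hnec).
Qed.

Unset Implicit Arguments.

Theorem theorem6p11 (V : set_structure) (HV : ZFC V)
  (P le : V) (HP : is_forcing P le)
  (Hproper : is_proper P le)
  (Hlaver : has_laver_property P le)
  (Hnonmeager : preserves_reals_nonmeager P le)
  (VG : generic_extension P le)
  (HnotCH : ~ CH VG)
  (A leA : V)
  (HA : is_boolean_algebra A leA)
  (Hsigma : is_sigma_complete A leA)
  (Hcard : card_omega1 A) :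
  exists X T w1 : VG,
    is_stone_space (emb VG A) (emb VG leA) X T /\
    is_efimov X T /\
    is_omega1 w1 /\ has_weight X T w1.
Proof.
exact: (@efimov_ground_algebra (Zmodel HV) P le VG A leA).
Qed.
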